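(* Let $\mathsf k$ be algebraically closed of characteristic $0$, and let $T=(1,2,\ldots,d-1,d^k,d-1,\ldots,2,1)$ ($d\ge2$ occurring $k\ge1$ times). The CIJT partitions of diagonal lengths $T$ correspond one-to-one with the subsets of the active Hessians for $T$, the CIJT partition $P=P_{\ell,A}$ (for $A=R/\operatorname{Ann}F$ a graded complete intersection of Hilbert function $T$ and $\ell$ a nonzero linear form) corresponding to the set of active Hessians $h^i$ with $h^i_\ell(F)=0$. Moreover, fix a nonzero linear form $\ell$, and for a CIJT partition $P$ of diagonal lengths $T$ let $\mathbb V(E_P)$ denote the locus in $CI_T$ of algebras $A$ with $P_{\ell,A}=P$. Then the Zariski closure of $\mathbb V(E_P)$ in $CI_T$ is $$\overline{\mathbb V(E_P)}=\bigcup_{P'\le P}\mathbb V(E_{P'}),$$ the union being over the CIJT partitions $P'$ of diagonal lengths $T$ with $P'\le P$ in the dominance order.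
   Context: $R=\mathsf k[x,y]$ with the standard grading, $j=2d+k-3$. Here $T_i=i+1$ for $0\le i\le d-1$, $T_i=d$ for $d-1\le i\le d+k-2$, $T_i=j+1-i$ for $d+k-2\le i\le j$. $G_T$ is the (smooth projective) variety parametrizing graded quotients $A=R/I$ of Hilbert function $T$ (a closed subvariety of $\prod_i\mathrm{Grass}(R_i)$ via $I\mapsto(I_i)_{i\le j+1}$), and $CI_T\subset G_T$ is the open dense subvariety parametrizing complete intersections. The diagonal lengths of a partition $P=(p_1\ge\cdots\ge p_s>0)$ are $(t_0,t_1,\ldots)$ with $t_i=\#\{(r,c): 1\le r\le s,\ 1\le c\le p_r,\ r+c-2=i\}$. The Jordan type $P_{\ell,A}$ is the partition of Jordan block sizes of multiplication by $\ell$ on $A$. A CIJT partition of diagonal lengths $T$ is a partition of diagonal lengths $T$ equal to $P_{\ell,A}$ for some graded Artinian complete intersection quotient $A$ of $R$ and nonzero linear form $\ell$. Dominance order: $(q_1\ge\cdots\ge q_{t'})\le(p_1\ge\cdots\ge p_t)$ iff $\sum_{u\le i}q_u\le\sum_{u\le i}p_u$ for all $i\le\min\{t,t'\}$. $R$ acts on $\mathcal E=\mathsf k[X,Y]$ by differentiation ($x=\partial_X$, $y=\partial_Y$), written $f\circ F$. Every graded complete intersection of socle degree $j$ is $R/\operatorname{Ann}F$, $F\in\mathcal E_j$, $\operatorname{Ann}F=\{f\in R: f\circ F=0\}$. For $0\le i\le d-1$, given a basis $(\alpha_1,\ldots,\alpha_{i+1})$ of $A_i$, the $i$-th Hessian is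 $h^i(F)=\det[\alpha_u\alpha_v\circ F]_{u,v}$, well defined up to a nonzero scalar; for $\ell=ax+by$, $h^i_\ell(F)$ is its value at $(X,Y)=(a,b)$. The active Hessians for $T$ are $h^0,\ldots,h^{d-2}$, and also $h^{d-1}$ when $k\ge2$. *)

(* Defs.v *)
From mathcomp Require Import all_boot all_order all_algebra.
From mathcomp Require Import mpoly.

Set Implicit Arguments.
Unset Strict Implicit.
Unset Printing Implicit Defensive.

Import GRing.Theory.
Local Open Scope ring_scope.

(** * Graded ideals of [R = K[x,y]] *)

(* Ideals are Prop-valued predicates: membership need not be decidable. *)
Definition is_ideal (K : fieldType) (I : {mpoly K[2]} -> Prop) : Prop :=
  [/\ I 0,
      forall f g, I f -> I g -> I (f + g)
    & forall f g, I g -> I (f * g)].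

Definition graded_ideal (K : fieldType) (I : {mpoly K[2]} -> Prop) : Prop :=
  is_ideal I /\ forall f i, I f -> I (pihomog mdeg i f).

(* The classes modulo [I] of the [b u], which lie in the subspace [V], form a
   basis of [(V + I) / I]. *)
Definition quotient_basis (K : fieldType) (I V : {mpoly K[2]} -> Prop)
    (U : finType) (b : U -> {mpoly K[2]}) : Prop :=
  [/\ forall u, V (b u),
      forall c : U -> K, I (\sum_u c u *: b u) -> forall u, c u = 0
    & forall f, V f -> exists c : U -> K, I (f - \sum_u c u *: b u)].

Definition forms (K : fieldType) (i : nat) (f : {mpoly K[2]}) : Prop :=
  f \is i.-homog.

Definition basis_of_degree (K : fieldType) (I : {mpoly K[2]} -> Prop) (i : nat)
    (U : finType) (b : U -> {mpoly K[2]}) : Prop :=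
  quotient_basis I (forms i) b.

Definition hilbert_function (K : fieldType) (I : {mpoly K[2]} -> Prop)
    (T : nat -> nat) : Prop :=
  forall i, exists b : 'I_(T i) -> {mpoly K[2]}, basis_of_degree I i b.

Definition artinian (K : fieldType) (I : {mpoly K[2]} -> Prop) : Prop :=
  exists (n : nat) (b : 'I_n -> {mpoly K[2]}),
    quotient_basis I (fun _ => True) b.

(* [I] is generated by the regular sequence [f, g] of forms. *)
Definition complete_intersection (K : fieldType) (I : {mpoly K[2]} -> Prop) :
    Prop :=
  exists (m n : nat) (f g : {mpoly K[2]}),
    [/\ f \is m.-homog /\ g \is n.-homog,
        forall h, I h <-> exists p q, h = p * f + q * g,
        forall h, h * f = 0 -> h = 0,
        forall h, (exists p, h * g = p * f) -> exists p, h = p * f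
      & ~ I 1].

Definition graded_artinian_CI (K : fieldType) (I : {mpoly K[2]} -> Prop) :
    Prop :=
  [/\ graded_ideal I, artinian I & complete_intersection I].

(** * The Hilbert function [T = (1, 2, ..., d-1, d^k, d-1, ..., 2, 1)] *)

Definition socle_degree (d k : nat) : nat := (2 * d + k - 3)%N.

Definition hilbT (d k i : nat) : nat :=
  if (i < d)%N then i.+1
  else if (i <= d + k - 2)%N then d
  else ((socle_degree d k).+1 - i)%N.

(** * Partitions *)

Definition is_partition (P : seq nat) : bool :=
  sorted geq P && all (fun p => 0 < p)%N P.

Definition diagonal_length (P : seq nat) (i : nat) : nat :=
  (\sum_(r < size P) \sum_(c < nth 0 P r) (r + c == i))%N.

Definition dominated (Q P : seq nat) : Prop :=
  forall i, (i <= minn (size Q) (size P))%N ->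
    (sumn (take i Q) <= sumn (take i P))%N.

(** * Jordan types *)

Definition linear_form (K : fieldType) (v : 'I_2 -> K) : {mpoly K[2]} :=
  \sum_i v i *: 'X_i.

(* Multiplication by [l] on [R/I] has Jordan type [P]: there is a basis of
   [R/I] which is a union of strings [g_r, l g_r, ..., l^(P_r - 1) g_r] with
   [l^(P_r) g_r = 0], i.e. in which the matrix is block diagonal with nilpotent
   Jordan blocks of sizes [P_0, P_1, ...]. *)
Definition jordan_type (K : fieldType) (I : {mpoly K[2]} -> Prop)
    (l : {mpoly K[2]}) (P : seq nat) : Prop :=
  is_partition P /\
  exists g : 'I_(size P) -> {mpoly K[2]},
    quotient_basis I (fun _ => True)
      (fun u : {r : 'I_(size P) & 'I_(nth 0%N P r)} =>
         l ^+ tagged u * g (tag u))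
    /\ forall r : 'I_(size P), I (l ^+ nth 0%N P r * g r).

Definition CIJT (K : fieldType) (T : nat -> nat) (P : seq nat) : Prop :=
  [/\ is_partition P,
      forall i, diagonal_length P i = T i
    & exists (I : {mpoly K[2]} -> Prop) (v : 'I_2 -> K),
        [/\ graded_artinian_CI I, linear_form v != 0
          & jordan_type I (linear_form v) P]].

(** * Inverse systems and Hessians *)

(* [diffact f F] is [f o F], with [x = d/dX] and [y = d/dY]. *)
Definition diffact (K : fieldType) (f F : {mpoly K[2]}) : {mpoly K[2]} :=
  \sum_(m <- msupp f) f@_m *: F^`M[m].

Definition Ann (K : fieldType) (F : {mpoly K[2]}) : {mpoly K[2]} -> Prop :=
  fun f => diffact f F = 0.

Definition hessian (K : fieldType) (n : nat) (alpha : 'I_n -> {mpoly K[2]})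
    (F : {mpoly K[2]}) : {mpoly K[2]} :=
  \det (\matrix_(u, v) diffact (alpha u * alpha v) F).

(* The active Hessians are the [h^i] with [i < num_active d k]. *)
Definition num_active (d k : nat) : nat := (d - 1 + (2 <= k))%N.

(** * [G_T], [CI_T] and the Zariski topology *)

Definition G_T (K : fieldType) (T : nat -> nat) (I : {mpoly K[2]} -> Prop) :
    Prop :=
  graded_ideal I /\ hilbert_function I T.

Definition CI_T (K : fieldType) (T : nat -> nat) (I : {mpoly K[2]} -> Prop) :
    Prop :=
  G_T T I /\ complete_intersection I.

(* The form of degree [i] with coordinates [w] in the basis
   [x^i, x^(i-1) y, ..., y^i] of [R_i]. *)
Definition form_of (K : fieldType) (i : nat) (w : 'rV[K]_i.+1) : {mpoly K[2]} :=
  \sum_(v < i.+1) w 0 v *: ('X_ord0 ^+ (i - v) * 'X_ord_max ^+ v).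

(* The rows of [M] form a basis of [I_i]. *)
Definition frame (K : fieldType) (I : {mpoly K[2]} -> Prop) (i m : nat)
    (M : 'M[K]_(m, i.+1)) : Prop :=
  row_free M /\ forall w : 'rV[K]_i.+1, I (form_of w) <-> (w <= M)%MS.

(* Indices of the Pluecker coordinates on
   [Grass(R_0) * ... * Grass(R_(N-1))], for subspaces of codimension [T i] in
   [R_i]: a factor [i], and a sequence of [i + 1 - T i] columns.  All column
   sequences are allowed, so that each usual coordinate occurs several times
   up to sign, together with coordinates that vanish identically. *)
Definition plucker_index (T : nat -> nat) (N : nat) : finType :=
  {i : 'I_N & {ffun 'I_(i.+1 - T i) -> 'I_i.+1}}.

Definition plucker (K : fieldType) (T : nat -> nat) (N : nat)
    (M : forall i : 'I_N, 'M[K]_(i.+1 - T i, i.+1))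
    (u : plucker_index T N) : K :=
  \det (colsub (tagged u) (M (tag u))).

(* Homogeneous in the Pluecker coordinates of each of the [N] factors. *)
Definition multihomogeneous (K : fieldType) (T : nat -> nat) (N : nat)
    (p : {mpoly K[#|plucker_index T N|]}) : Prop :=
  exists delta : 'I_N -> nat, forall m, m \in msupp p -> forall i : 'I_N,
    (\sum_(u : plucker_index T N | tag u == i) m (enum_rank u))%N = delta i.

Definition vanishes_at (K : fieldType) (T : nat -> nat) (N : nat)
    (p : {mpoly K[#|plucker_index T N|]}) (I : {mpoly K[2]} -> Prop) : Prop :=
  forall M : forall i : 'I_N, 'M[K]_(i.+1 - T i, i.+1),
    (forall i, frame I (M i)) -> p.@[fun n => plucker M (enum_val n)] = 0.

(* [Z] is the trace on [CI_T] of a closed subset of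
   [Grass(R_0) * ... * Grass(R_(N-1))]. *)
Definition zariski_closed (K : fieldType) (T : nat -> nat) (N : nat)
    (Z : ({mpoly K[2]} -> Prop) -> Prop) : Prop :=
  exists S : {mpoly K[#|plucker_index T N|]} -> Prop,
    (forall p, S p -> multihomogeneous p) /\
    forall I, Z I <-> CI_T T I /\ forall p, S p -> vanishes_at p I.

Definition zariski_closure (K : fieldType) (T : nat -> nat) (N : nat)
    (V : ({mpoly K[2]} -> Prop) -> Prop) (I : {mpoly K[2]} -> Prop) : Prop :=
  CI_T T I /\
  forall Z, zariski_closed T N Z -> (forall J, V J -> Z J) -> Z I.

Definition V_E (K : fieldType) (T : nat -> nat) (l : {mpoly K[2]})
    (P : seq nat) (I : {mpoly K[2]} -> Prop) : Prop :=
  CI_T T I /\ jordan_type I l P.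

(* Main.v *)
(* Let [l] be the linear form and dehomogenize by [l = 1]: a graded complete
   intersection becomes a coprime pair [(f, g)] of univariate polynomials with
   formal degrees [d <= n = d + k - 1], and multiplication by [l] becomes the
   inclusion of the polynomials of degree [<= b] into those of degree [<= b + 1].
   The active Hessian [h^i] is nonzero at [l] exactly when [i + 1] is a node, that
   is, the degree of a remainder in the Euclidean algorithm for [(g, f)].  The
   multiples [z^m r] of the remainders have one polynomial in each degree, and
   the degrees of the cofactors tell in which degree each of them falls into the
   ideal; a dimension count then shows that they generate the strings of a Jordan
   basis.  Hence the Jordan type is determined by the set of nodes, and its
   partial sums interpolate the concave function [i (d + n - i)] at the nodes, so
   that dominance is inclusion of node sets.

   For the closure, the vanishing of [h^i] at [l] is a linear condition on the
   Pluecker coordinates of the ideal in degree [j - i].  Conversely, a node can be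
   inserted into a gap of the Euclidean algorithm by a one-parameter deformation:
   a quotient [a] of degree [q = m1 + m2] is replaced by two quotients of degrees
   [m1] and [m2], obtained from a factorization of [1 + s^q D_s] with [D_0 = a],
   which Hensel lifting provides.  The Sylvester matrices of the deformed pair
   are frames of the deformed ideal that are polynomial in [s]. *)
Require Import Defs.
From HB Require Import structures.
From mathcomp Require Import all_boot all_order all_algebra.
From mathcomp Require Import perm ssrcomplements mpoly.
From mathcomp Require Import zify ring.

Set Implicit Arguments.
Unset Strict Implicit.
Unset Printing Implicit Defensive.

Import GRing.Theory.
Local Open Scope ring_scope.

(** * Node sets and their partitions *)

Section Nodes.
Local Open Scope nat_scope.

(** The degree count behind the strings: a remainder of degree [lo], with [hi] the next node above,
    has a cofactor of degree [n - hi] at [f] and of degree at most [d - hi] at [g]. Its multiple of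
    degree [a] therefore enters the ideal in degree [a + d + n - lo - hi]. With [j = d + n - 2],
    multiplication by [l ^ (j - 2 i)] from degree [i] to degree [j - i] is then injective exactly
    when [i + 1] is a node, and up to powers of a factorial [h^i] at [l] is its Gram determinant. If
    [d = n] (that is, [k = 1]), then [d] is always a node, which is why [h^(d-1)] is active only for
    [k >= 2]. The obstacle in the closure is that quotients of degrees [m1] and [m2] must merge into
    one of degree [m1 + m2]. In the composite of two steps with quotients [s^-q U] and [N], the
    entry [s^-q (N U - 1)] has to tend to [a] while [N] and [U] tend to 1. This is the equation
    [N U = 1 + s^q D]; the roots of both factors escape to infinity, and rescaling [z] by [s] brings
    them back to the distinct roots of a binomial. *)

Fixpoint lo_node (node : pred nat) (a : nat) : nat :=
  if a is b.+1 then if node b.+1 then b.+1 else lo_node node b else 0.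

(** When no node lies above [a] up to [t], [find] returns the length of the list and the value is
    [t + 1]; for [a < t] with [t] a node this does not occur. *)
Definition hi_node (node : pred nat) (t a : nat) : nat :=
  a.+1 + find node (iota a.+1 (t - a)).

Lemma lo_node_le node a : lo_node node a <= a.
Proof. by elim: a => //= a IH; case: ifP => // _; apply: leqW. Qed.

Lemma lo_nodeP (node : pred nat) a : node 0 -> node (lo_node node a).
Proof. by move=> n0; elim: a => //= a IH; case: ifP. Qed.

Lemma lo_node_max (node : pred nat) a x : node x -> x <= a -> x <= lo_node node a.
Proof.
move=> nx; elim: a => [|a IH] /=; first by rewrite leqn0 => /eqP ->.
case: ifP => // na; rewrite leq_eqVlt => /orP[/eqP xa|]; last exact: IH.
by rewrite -xa nx in na.
Qed.

Lemma hi_node_gt node t a : a < hi_node node t a.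
Proof. by rewrite /hi_node; lia. Qed.

Lemma hi_node_min (node : pred nat) t a x :
  node x -> a < x -> x <= t -> hi_node node t a <= x.
Proof.
move=> nx ax xt; rewrite /hi_node.
suff : find node (iota a.+1 (t - a)) <= x - a.+1 by lia.
rewrite leqNgt; apply/negP => /(before_find 0).
by rewrite nth_iota ?subnKC ?nx //; lia.
Qed.

Lemma hi_nodeP (node : pred nat) t a :
  node t -> a < t -> node (hi_node node t a) /\ hi_node node t a <= t.
Proof.
move=> nt lt_at; split; last exact: hi_node_min.
have hasn : has node (iota a.+1 (t - a)).
  by apply/hasP; exists t => //; rewrite mem_iota; lia.
have := nth_find 0 hasn; rewrite nth_iota //.
by move: hasn; rewrite has_find size_iota.
Qed.

Lemma lo_node_eq (node : pred nat) a x :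
  node 0 -> node x -> x <= a -> (forall y, node y -> y <= a -> y <= x) ->
  lo_node node a = x.
Proof.
move=> n0 nx xa max_x; apply/eqP; rewrite eqn_leq lo_node_max // andbT.
by rewrite max_x ?lo_nodeP ?lo_node_le.
Qed.

Lemma hi_node_eq (node : pred nat) t a x :
  node t -> node x -> a < x <= t -> (forall y, node y -> a < y -> x <= y) ->
  hi_node node t a = x.
Proof.
move=> nt nx /andP[ax xt] min_x; apply/eqP; rewrite eqn_leq hi_node_min //=.
have [] := @hi_nodeP node t a nt (leq_trans ax xt).
by move=> nh _; rewrite min_x ?hi_node_gt.
Qed.

Lemma lo_node_mono node a b : a <= b -> lo_node node a <= lo_node node b.
Proof.
elim: b => [|b IH]; first by rewrite leqn0 => /eqP ->.
rewrite leq_eqVlt => /orP[/eqP -> //|] /IH /= le_lo; case: ifP => // _.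
by apply: (leq_trans le_lo); apply: leqW; apply: lo_node_le.
Qed.

Lemma hi_node_mono (node : pred nat) t a b :
  node t -> a <= b -> b < t -> hi_node node t a <= hi_node node t b.
Proof.
move=> nt ab bt; have [nh ht] := hi_nodeP nt bt.
by apply: hi_node_min => //; apply: leq_ltn_trans ab (hi_node_gt _ _ _).
Qed.

Lemma lo_hi_same (node : pred nat) t a b :
  node 0 -> node t -> a < t -> lo_node node a <= b < hi_node node t a ->
  lo_node node b = lo_node node a /\ hi_node node t b = hi_node node t a.
Proof.
move=> n0 nt lt_at /andP[lob bhi]; have [nh ht] := hi_nodeP nt lt_at.
have key y : node y -> y <= lo_node node a \/ hi_node node t a <= y.
  move=> ny; case: (leqP y a) => ya; first by left; apply: lo_node_max.
  case: (leqP y t) => yt; first by right; apply: hi_node_min.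
  by right; apply: leq_trans ht (ltnW yt).
split.
  by apply: lo_node_eq => // [|y /key ? ?]; [apply: lo_nodeP | lia].
by apply: hi_node_eq => // [|y /key ? ?]; lia.
Qed.

(* [d] and [n] are the degrees of the generators, so that the socle degree is
   [d + n - 2].  The string of multiplication by [l] starting in degree [a] has
   length [part a]. *)
Definition part (d n : nat) (node : pred nat) (t a : nat) : nat :=
  d + n - lo_node node a - hi_node node t a.

Definition node_partition (d n : nat) (node : pred nat) (t : nat) : seq nat :=
  mkseq (part d n node t) t.

(* [t] is the number of strings: [t = n] when the generator of degree [d] is
   divisible by [l]. *)
Definition node_set (d n : nat) (node : pred nat) (t : nat) : Prop :=
  [/\ 0 < d <= n, node 0, node t
    & t = d \/ t = n /\ forall x, d <= x < n -> ~~ node x].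

Section NodeSet.
Variables (d n : nat) (node : pred nat) (t : nat).
Hypothesis hN : node_set d n node t.

Local Notation lo := (lo_node node).
Local Notation hi := (hi_node node t).
Local Notation p := (part d n node t).

Lemma lo_hi_lt a : a < t -> lo a + hi a < d + n.
Proof.
case: hN => /andP[d0 dn] n0 nt ht lt_at; have [nh lh] := hi_nodeP nt lt_at.
have := lo_node_le node a; have nlo := lo_nodeP a n0.
case: ht => [td|[tn gap]]; first by lia.
have := gap (lo a); rewrite nlo; lia.
Qed.

Lemma part_gt0 a : a < t -> 0 < p a.
Proof. by move=> /lo_hi_lt; rewrite /part; lia. Qed.

Lemma part_le a b : a <= b -> b < t -> p b <= p a.
Proof.
case: hN => _ _ nt _ ab bt; have := lo_node_mono node ab.
have := hi_node_mono nt ab bt; rewrite /part; lia.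
Qed.

Lemma size_node_partition : size (node_partition d n node t) = t.
Proof. exact: size_mkseq. Qed.

Lemma nth_node_partition a : a < t -> nth 0 (node_partition d n node t) a = p a.
Proof. by move=> ?; rewrite nth_mkseq. Qed.

Lemma node_partition_is_partition : is_partition (node_partition d n node t).
Proof.
apply/andP; split.
  apply/(sortedP 0) => i; rewrite size_node_partition => it.
  by rewrite !nth_node_partition ?(ltnW it) //; apply: part_le.
apply/(all_nthP 0) => i; rewrite size_node_partition => it.
by rewrite nth_node_partition // part_gt0.
Qed.

Lemma reflect_lt (a : 'I_t) : lo a + hi a - a.+1 < t.
Proof.
case: hN => _ n0 nt _; have := lo_node_le node a.
have [_] := hi_nodeP nt (ltn_ord a); have := ltn_ord a; lia.
Qed.

(** Reverses each gap between consecutive nodes. The string born in degree [a] ends at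
    [a + p a = d + n - 1 - reflect_node a], so strings die symmetrically to the way they are
    born. *)
Definition reflect_node (a : 'I_t) : 'I_t := Ordinal (reflect_lt a).

Lemma reflect_nodeK : involutive reflect_node.
Proof.
case: hN => _ n0 nt _ a; apply: val_inj => /=.
have := lo_node_le node a; have := hi_node_gt node t a => ? ?.
have [|-> ->] := @lo_hi_same node t a (lo a + hi a - a.+1) n0 nt (ltn_ord a); lia.
Qed.

Lemma sum_gt m b : \sum_(a < m) (b < a) = m.-1 - b.
Proof.
elim: m => [|m IH]; first by rewrite big_ord0.
by rewrite big_ord_recr /= IH; case: (ltnP b m); lia.
Qed.

(** In degree [b] a string is either alive, unborn ([b < a]) or dead, the last exactly when
    [d + n - 2 - b < reflect_node a]. Since the reflection permutes the strings, the number of dead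
    ones depends on [t] but not on the nodes. *)
Lemma count_alive b :
  \sum_(a < t) (a <= b < a + p a) =
  if b < d + n - 1 then t - (t.-1 - b) - (t.-1 - (d + n - 2 - b)) else 0.
Proof.
case: (hN) => /andP[d0 dn] n0 nt ht.
have lohi (a : 'I_t) : [/\ lo a <= a, a < hi a, hi a <= t & lo a + hi a < d + n].
  have [_ ?] := hi_nodeP nt (ltn_ord a).
  by rewrite lo_node_le hi_node_gt lo_hi_lt.
case: ifP => [bj|/negbT bj]; last first.
  rewrite big1 // => a _; have [? ? ? ?] := lohi a.
  by rewrite /part; case: andP => // -[? ?]; lia.
have split1 (a : 'I_t) : (a <= b < a + p a) + (b < a) +
    (d + n - 2 - b < reflect_node a) = 1.
  have [? ? ? ?] := lohi a; rewrite /part /=.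
  case: (leqP a b) => ?; case: (ltnP b (a + _)) => ?;
    case: (ltnP (d + n - 2 - b)) => ? //=; lia.
have : \sum_(a < t) ((a <= b < a + p a) + (b < a) +
    (d + n - 2 - b < reflect_node a)) = t.
  by rewrite (eq_bigr _ (fun a _ => split1 a)) sum1_card card_ord.
rewrite !big_split /=.
have -> : \sum_(a < t) (d + n - 2 - b < reflect_node a) =
          \sum_(a < t) (d + n - 2 - b < a).
  by rewrite [RHS](reindex_inj (inv_inj reflect_nodeK)).
rewrite !sum_gt; lia.
Qed.

Lemma count_alive_hilbT b :
  \sum_(a < t) (a <= b < a + p a) = hilbT d (n - d).+1 b.
Proof.
rewrite count_alive /hilbT /socle_degree.
have : d = t \/ n = t by case: hN => _ _ _ [->|[-> _]]; [left | right].
case: hN => /andP[d0 dn] _ _ _ [] <-.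
  by case: ltnP => ?; case: ltnP => ?; [| case: leqP | | case: leqP]; lia.
by case: ltnP => ?; case: ltnP => ?; [| case: leqP | | case: leqP]; lia.
Qed.

(** Row [a] meets diagonal [b] exactly when the string born in degree [a] is alive in degree [b];
    indexing strings by their starting degree makes diagonal lengths into dimensions. *)
Lemma node_partition_diagonal b :
  diagonal_length (node_partition d n node t) b = hilbT d (n - d).+1 b.
Proof.
rewrite /diagonal_length size_node_partition -count_alive_hilbT.
apply: eq_bigr => a _; rewrite nth_node_partition //.
elim: (p a) => [|m IH]; first by rewrite big_ord0 addn0; case: andP => // -[]; lia.
rewrite big_ord_recr /= IH.
case: (leqP a b) => ?; case: (ltnP b (a + m)) => ?; case: (ltnP b (a + m.+1)) => ?;
  case: (eqVneq (a + m) b) => ? //=; lia.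
Qed.

Lemma sum_take_node_partition i : i <= t ->
  sumn (take i (node_partition d n node t)) = \sum_(a < i) p a.
Proof.
move=> it; rewrite /node_partition /mkseq -map_take take_iota.
by rewrite (minn_idPl it) sumnE big_map -(big_mkord xpredT) /index_iota subn0.
Qed.

(* The partial sums interpolate the concave function [i (d + n - i)] linearly
   between the nodes. *)
Lemma partial_sum i : i < t ->
  \sum_(a < i) p a + (i - lo i) * (hi i - i) = i * (d + n - i).
Proof.
case: (hN) => /andP[d0 dn] n0 nt ht.
elim: i => [|i IH] it; first by rewrite big_ord0 /= sub0n !mul0n.
have it' := ltnW it; have {IH} := IH it'; rewrite big_ord_recr /=.
have lhl := lo_hi_lt it'; have := lo_node_le node i; have := hi_node_gt node t i.
have tn : t < d + n by lia.
have [_ hit] := hi_nodeP nt it'.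
case: ifP => [ni|/negbT ni].
  have ehi : hi i = i.+1 by apply/eqP; rewrite eqn_leq hi_node_min ?hi_node_gt //; lia.
  rewrite /part !ehi in lhl *; rewrite !subnn mul0n; set l := lo i in lhl *.
  have [r er] : exists r, d + n = i.+1 + r by exists (d + n - i.+1); lia.
  rewrite !er !addKn; have -> : i.+1 + r - i = r.+1 by lia.
  set s := \sum_(_ < _) _; rewrite mulnS mulSn; move: (i * r) => ir; lia.
have [nh _] := hi_nodeP nt it'.
have ne : hi i <> i.+1 by move=> e; rewrite -e nh in ni.
move=> h1 h2.
have [|_ ->] := @lo_hi_same node t i i.+1 n0 nt it'; first by lia.
rewrite /part; set l := lo i in h2 lhl *; set h := hi i in h1 lhl ne hit *.
(* Slack variables replace the truncated subtractions by sums and leave a polynomial identity. *)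
have [u eu] : exists u, i = l + u by exists (i - l); lia.
have [w ew] : exists w, h = i.+2 + w by exists (h - i.+2); lia.
have [r er] : exists r, d + n = (l + h).+1 + r by exists (d + n - (l + h).+1); lia.
rewrite er eu ew eu.
have -> : l + u - l = u by lia.
have -> : (l + u).+1 - l = u.+1 by lia.
have -> : (l + u).+2 + w - (l + u) = w.+2 by lia.
have -> : (l + u).+2 + w - (l + u).+1 = w.+1 by lia.
have -> : (l + ((l + u).+2 + w)).+1 + r - (l + u) = l + w + r + 3 by lia.
have -> : (l + ((l + u).+2 + w)).+1 + r - (l + u).+1 = l + w + r + 2 by lia.
have -> : (l + ((l + u).+2 + w)).+1 + r - l - ((l + u).+2 + w) = r.+1 by lia.
nia.
Qed.

Lemma top_prod : t * (d + n - t) = d * n.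
Proof.
by case: hN => _ _ _ [e|[e _]]; rewrite e ?addKn // addnK mulnC.
Qed.

Lemma total_sum : \sum_(a < t) p a = d * n.
Proof.
case: (hN) => /andP[d0 dn] n0 nt ht.
have t0 : 0 < t by lia.
(* [partial_sum] stops at [t - 1], where [hi = t]; the last part is added separately. *)
have lt_t : t.-1 < t by lia.
have := partial_sum lt_t; have := lo_hi_lt lt_t.
have -> : \sum_(a < t) p a = \sum_(a < t.-1) p a + p t.-1.
  have aux (F : nat -> nat) m : 0 < m -> \sum_(a < m) F a = \sum_(a < m.-1) F a + F m.-1.
    by case: m => // m _; rewrite big_ord_recr.
  exact: aux.
have := hi_nodeP nt lt_t; have := hi_node_gt node t t.-1 => h1 [_ h2].
rewrite /part; have -> : hi t.-1 = t by lia.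
have := lo_node_le node t.-1; set l := lo _; set s := \sum_(_ < _) _.
have -> : t - t.-1 = 1 by lia.
rewrite muln1 => h3 h4 h5.
have : s + (d + n - l - t) = (t.-1 * (d + n - t.-1) - (t.-1 - l)) + (d + n - l - t) by lia.
move=> ->.
have [u eu] : exists u, d + n = t + l + u.+1 by exists (d + n - (t + l).+1); lia.
have et : t.-1 * (d + n - t.-1) + (d + n - t) = t * (d + n - t) + t.-1.
  rewrite -[in t * _](prednK t0) mulSn.
  have -> : d + n - t.-1 = (d + n - t).+1 by lia.
  by rewrite mulnS; lia.
have := top_prod; lia.
Qed.

End NodeSet.

Lemma node_set_top_ge d n node t : node_set d n node t -> d <= t <= n.
Proof. by case=> /andP[_ dn] _ _ [->|[-> _]]; rewrite dn leqnn. Qed.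

(** * Dominance as inclusion of node sets *)

Section Dominance.
Variables (d n : nat) (node node' : pred nat) (t t' : nat).
Hypotheses (hN : node_set d n node t) (hN' : node_set d n node' t').

(** At a node [x] of [node'] the partial sum attains [x * (d + n - x)], so domination forces the
    correction [(x - lo) * (hi - x)] of the other partition to vanish, which makes [x] a node.
    Conversely, additional nodes shrink both factors of the correction. Nodes above [d] carry no
    information: they are cut off if the top is [d], and only [n] is left if the top is [n]. *)
Lemma node_partition_dominated :
  dominated (node_partition d n node' t') (node_partition d n node t) <->
  (forall x, x <= d -> node' x -> node x).
Proof.
have /andP[dt tn] := node_set_top_ge hN; have /andP[dt' t'n] := node_set_top_ge hN'.
have [_ n0 nt ht] := hN; have [_ n0' nt' ht'] := hN'.
split=> [dom x xd nx|sub i].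
  have xt : x <= t by lia.
  have xt' : x <= t' by lia.
  have := dom x; rewrite !size_node_partition !sum_take_node_partition //.
  rewrite leq_min xt xt' => /(_ isT); case: (ltngtP x t) xt => // [xt _|-> _ //].
  have := partial_sum hN xt.
  have -> : \sum_(a < x) part d n node' t' a = x * (d + n - x).
    case: (ltngtP x t') xt' => // [lt_xt' _|-> _].
      have := partial_sum hN' lt_xt'.
      have -> : lo_node node' x = x by apply: lo_node_eq.
      by rewrite subnn mul0n addn0.
    by rewrite (total_sum hN') (top_prod hN').
  move=> e le_sum.
  have : (x - lo_node node x) * (hi_node node t x - x) == 0.
    by rewrite -leqn0 -(leq_add2l (\sum_(a < x) part d n node t a)) addn0 e.
  rewrite muln_eq0 => /orP[]; have := hi_node_gt node t x; last by lia.
  have := lo_node_le node x => *.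
  have -> : x = lo_node node x by lia.
  exact: lo_nodeP.
rewrite !size_node_partition leq_min => /andP[it' it].
rewrite !sum_take_node_partition //.
have [/andP[d0 dn] _ _ _] := hN.
case: (ltngtP i t) it => // [lt_it _|it_ _]; last first.
  rewrite it_ (total_sum hN).
  have le_t' : t <= t' by lia.
  case: (ltngtP t t') le_t' => // [lt _|-> _]; last by rewrite (total_sum hN').
  have := partial_sum hN' lt.
  by rewrite (top_prod hN) => <-; apply: leq_addr.
case: (ltngtP i t') it' => // [lt_it' _|it'_ _]; last first.
  rewrite it'_ (total_sum hN') in lt_it *.
  have := partial_sum hN lt_it.
  have e : t' = d.
    by case: ht' => // -[e _]; lia.
  have nd : node t' by apply: sub => //; lia.
  have -> : lo_node node t' = t' by apply: lo_node_eq.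
  by rewrite subnn mul0n addn0 => ->; rewrite (top_prod hN').
have e := partial_sum hN lt_it; have e' := partial_sum hN' lt_it'.
have [nh' h't'] := hi_nodeP nt' lt_it'.
have le_hi : hi_node node t i <= hi_node node' t' i.
  have := hi_node_gt node' t' i => hgt; case: (leqP (hi_node node' t' i) d) => hd.
    by apply: hi_node_min => //; [apply: sub | lia].
  case: ht => [td|[_ gap]]; have [_] := hi_nodeP nt lt_it; first lia.
  case: ht' => [? ?|[t'n_ gap'] ?]; first by lia.
  have := gap' (hi_node node' t' i); rewrite nh'; lia.
have le_lo : lo_node node' i <= lo_node node i.
  have := lo_node_le node' i => le; have nlo := lo_nodeP i n0'.
  case: (leqP (lo_node node' i) d) => hd; first by apply: lo_node_max; rewrite ?sub.
  case: ht' => [?|[_ gap']]; first by lia.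
  have := gap' (lo_node node' i); rewrite nlo; lia.
have := hi_node_gt node t i; have := lo_node_le node i => h1 h2.
have le_prod : (i - lo_node node i) * (hi_node node t i - i) <=
       (i - lo_node node' i) * (hi_node node' t' i - i) by apply: leq_mul; lia.
by rewrite -(leq_add2r ((i - lo_node node i) * (hi_node node t i - i))) e -e' leq_add2l.
Qed.

End Dominance.

Lemma hilbT_gt0 d k i : 0 < d -> 0 < k -> (0 < hilbT d k i) = (i < 2 * d + k - 2).
Proof.
by move=> ? ?; rewrite /hilbT /socle_degree; case: ifP; [|case: ifP]; lia.
Qed.

Lemma hilbT_le d k i : 0 < d -> 0 < k -> hilbT d k i <= d.
Proof.
by move=> ? ?; rewrite /hilbT /socle_degree; case: ifP; [|case: ifP]; lia.
Qed.

Lemma hilbT_small d k i : i < d -> hilbT d k i = i.+1.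
Proof. by rewrite /hilbT => ->. Qed.

Lemma hilbT_inj d k d' k' : 0 < d -> 0 < k -> 0 < d' -> 0 < k' ->
  hilbT d k =1 hilbT d' k' -> d = d' /\ k = k'.
Proof.
move=> d0 k0 d0' k0' e.
have le_d : d <= d'.
  by have := @hilbT_le d' k' d.-1 d0' k0'; rewrite -e hilbT_small; lia.
have le_d' : d' <= d.
  by have := @hilbT_le d k d'.-1 d0 k0; rewrite e hilbT_small; lia.
have := @hilbT_gt0 d k (2 * d + k - 2) d0 k0; rewrite e hilbT_gt0 // ltnn => h1.
have := @hilbT_gt0 d' k' (2 * d' + k' - 2) d0' k0'; rewrite -e hilbT_gt0 // ltnn => h2.
by split; lia.
Qed.

End Nodes.

(** * Quotient bases and uniqueness of Jordan types *)

Section IdealFacts.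
Variables (K : fieldType) (I : {mpoly K[2]} -> Prop).
Hypothesis idI : is_ideal I.

Lemma ideal0 : I 0. Proof. by case: idI. Qed.

Lemma idealD f g : I f -> I g -> I (f + g). Proof. by case: idI => _ + _; apply. Qed.

Lemma idealM f g : I g -> I (f * g). Proof. by case: idI => _ _; apply. Qed.

Lemma idealZ (c : K) f : I f -> I (c *: f).
Proof. by rewrite -mul_mpolyC; apply: idealM. Qed.

Lemma idealN f : I f -> I (- f).
Proof. by rewrite -scaleN1r; apply: idealZ. Qed.

Lemma idealB f g : I f -> I g -> I (f - g).
Proof. by move=> If Ig; apply/idealD/idealN. Qed.

Lemma ideal_sum (J : finType) (Q : pred J) (F : J -> {mpoly K[2]}) :
  (forall i, Q i -> I (F i)) -> I (\sum_(i | Q i) F i).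
Proof. by move=> IF; apply: big_ind => //; [apply: ideal0 | apply: idealD]. Qed.

Lemma ideal_congr f g : I (f - g) -> I g -> I f.
Proof. by move=> Ifg Ig; rewrite -(subrK g f); apply: idealD. Qed.

Definition span_mod (U : finType) (b : U -> {mpoly K[2]}) (f : {mpoly K[2]}) :=
  exists c : U -> K, I (f - \sum_u c u *: b u).

Section Span.
Variables (U : finType) (b : U -> {mpoly K[2]}).

Lemma span_mod_ideal f : I f -> span_mod b f.
Proof.
move=> If; exists (fun _ : U => 0%R); rewrite big1 ?subr0 // => u _.
by rewrite scale0r.
Qed.

Lemma span_modD f g : span_mod b f -> span_mod b g -> span_mod b (f + g).
Proof.
move=> [c Ic] [e Ie]; exists (fun u => c u + e u).
have -> : \sum_u (c u + e u) *: b u = \sum_u c u *: b u + \sum_u e u *: b u.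
  by rewrite -big_split; apply: eq_bigr => u _; rewrite scalerDl.
by rewrite opprD addrACA; apply: idealD.
Qed.

Lemma span_modZ (c : K) f : span_mod b f -> span_mod b (c *: f).
Proof.
move=> [e Ie]; exists (fun u => c * e u).
have -> : \sum_u (c * e u) *: b u = c *: \sum_u e u *: b u.
  by rewrite scaler_sumr; apply: eq_bigr => u _; rewrite scalerA.
by rewrite -scalerBr; apply: idealZ.
Qed.

Lemma span_mod_sum (J : finType) (Q : pred J) (F : J -> {mpoly K[2]}) :
  (forall i, Q i -> span_mod b (F i)) -> span_mod b (\sum_(i | Q i) F i).
Proof.
move=> sF; apply: big_ind => //; last exact: span_modD.
exact/span_mod_ideal/ideal0.
Qed.

Lemma span_mod_mem u : span_mod b (b u).
Proof.
exists (fun v => (v == u)%:R); rewrite (bigD1 u) //= eqxx scale1r.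
rewrite big1 ?addr0 ?subrr; first exact: ideal0.
by move=> v /negPf ->; rewrite scale0r.
Qed.

Lemma span_mod_congr f g : I (f - g) -> span_mod b g -> span_mod b f.
Proof.
by move=> Ifg sg; rewrite -(subrK g f); apply: span_modD => //; apply: span_mod_ideal.
Qed.

End Span.

(** If [b] had more elements than [b'], its coordinate matrix would have a nonzero left kernel,
    which is a relation modulo [I]. Membership in [I] is only a proposition, so the matrix is
    obtained by finite choice. *)
Lemma quotient_basis_card_le (V : {mpoly K[2]} -> Prop) (U U' : finType)
    (b : U -> {mpoly K[2]}) (b' : U' -> {mpoly K[2]}) :
  quotient_basis I V b -> quotient_basis I V b' -> (#|U| <= #|U'|)%N.
Proof.
move=> [Vb free_b _] [_ _ span_b']; rewrite leqNgt; apply/negP => lt_UU'.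
have /fin_all_exists[C IC] := fun u => span_b' _ (Vb u).
pose M : 'M[K]_(#|U|, #|U'|) := \matrix_(i, j) C (enum_val i) (enum_val j).
have : kermx M != 0.
  by rewrite kermx_eq0 /row_free neq_ltn (leq_ltn_trans (rank_leq_col M)).
rewrite -mxrank_eq0; move=> /negP; apply; apply/eqP; apply/eqP.
rewrite mxrank_eq0; apply/eqP/row_matrixP => i; rewrite row0.
set x := row i _; have xM : x *m M = 0 by rewrite -row_mul mulmx_ker row0.
have x0 : forall u, x 0 (enum_rank u) = 0.
  apply: free_b.
  apply: (@ideal_congr _ (\sum_u x 0 (enum_rank u) *: \sum_v C u v *: b' v)).
    rewrite -sumrB; apply: ideal_sum => u _; rewrite -scalerBr.
    exact: idealZ.
  have -> : \sum_u x 0 (enum_rank u) *: (\sum_v C u v *: b' v) =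
            \sum_v (\sum_u x 0 (enum_rank u) * C u v) *: b' v.
    under eq_bigr do rewrite scaler_sumr.
    rewrite exchange_big; apply: eq_bigr => v _; rewrite scaler_suml.
    by apply: eq_bigr => u _; rewrite scalerA.
  rewrite big1 ?ideal0 //; first exact: ideal0.
  move=> v _; have /matrixP/(_ 0 (enum_rank v)) := xM; rewrite mxE [RHS]mxE => e.
  rewrite (reindex (fun i : 'I_#|U| => enum_val i)) /=; last exact/onW_bij/enum_val_bij.
  rewrite [X in X *: _](_ : _ = 0) ?scale0r // -[RHS]e; apply: eq_bigr => j _.
  by rewrite enum_valK [M _ _]mxE enum_rankK.
by apply/rowP => j; rewrite -(enum_valK j) x0 mxE.
Qed.

Lemma quotient_basis_card (V : {mpoly K[2]} -> Prop) (U U' : finType)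
    (b : U -> {mpoly K[2]}) (b' : U' -> {mpoly K[2]}) :
  quotient_basis I V b -> quotient_basis I V b' -> #|U| = #|U'|.
Proof.
move=> hb hb'; apply/eqP; rewrite eqn_leq.
by rewrite (quotient_basis_card_le hb hb') (quotient_basis_card_le hb' hb).
Qed.

Lemma hilbert_function_unique T T' :
  hilbert_function I T -> hilbert_function I T' -> T =1 T'.
Proof.
move=> hT hT' i; have [b hb] := hT i; have [b' hb'] := hT' i.
by have := quotient_basis_card hb hb'; rewrite !card_ord.
Qed.

(** The members of the strings at height at least [m] span the image of [l ^ m]. Their number, the
    rank of [l ^ m] on the quotient, is an invariant from which the partition is recovered. *)
Lemma power_basis (l : {mpoly K[2]}) (P : seq nat) (g : 'I_(size P) -> {mpoly K[2]})
    (m : nat) :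
  quotient_basis I (fun _ => True)
    (fun u : {r : 'I_(size P) & 'I_(nth 0%N P r)} => l ^+ tagged u * g (tag u)) ->
  (forall r : 'I_(size P), I (l ^+ nth 0%N P r * g r)) ->
  quotient_basis I (fun f => exists h, I (f - l ^+ m * h))
    (fun u : {u : {r : 'I_(size P) & 'I_(nth 0%N P r)} | (m <= tagged u)%N} =>
       l ^+ tagged (val u) * g (tag (val u))).
Proof.
move=> [_ free_b span_b] Ig; split=> [u|c Ic u|f [h If]].
- exists (l ^+ (tagged (val u) - m) * g (tag (val u))).
  by rewrite mulrA -exprD subnKC ?subrr; [apply: ideal0 | apply: (valP u)].
- pose c' v := oapp c 0 (insub v).
  suff /(_ (val u)) : forall v, c' v = 0 by rewrite /c' valK.
  apply: free_b; rewrite (bigID (fun v : {r : 'I_(size P) & 'I_(nth 0%N P r)} => m <= tagged v)%N) /=.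
  rewrite [X in _ + X]big1 ?addr0.
    rewrite (reindex_omap (val : {u : {r : 'I_(size P) & 'I_(nth 0%N P r)} |
      (m <= tagged u)%N} -> _) insub) /= => [|v mv]; last by rewrite insubT.
    move: Ic; congr (I _); apply: eq_big => w; first by rewrite (valP w) valK eqxx.
    by rewrite /c' valK.
  by move=> v mv; rewrite /c' insubF ?scale0r //; apply: negPf.
- apply: (span_mod_congr If); have [c Ic] := span_b h Logic.I.
  apply: (@span_mod_congr _ _ _ (l ^+ m * \sum_u c u *: (l ^+ tagged u * g (tag u)))).
    by rewrite -mulrBr; apply: idealM.
  rewrite mulr_sumr; apply: span_mod_sum => u _; rewrite -scalerAr; apply: span_modZ.
  rewrite mulrA -exprD.
  case: (ltnP (m + tagged u) (nth 0%N P (tag u))) => hu; last first.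
    apply: span_mod_ideal; rewrite -(subnK hu) exprD -mulrA; exact/idealM/Ig.
  pose w : {u : {r : 'I_(size P) & 'I_(nth 0%N P r)} | (m <= tagged u)%N} :=
    exist _ (Tagged (fun r : 'I_(size P) => 'I_(nth 0%N P r)) (Ordinal hu))
      (leq_addr _ _).
  exact: (@span_mod_mem _ _ w).
Qed.

Lemma card_power_index (P : seq nat) (m : nat) :
  #|{: {u : {r : 'I_(size P) & 'I_(nth 0%N P r)} | (m <= tagged u)%N}}| =
  (\sum_(p <- P) (p - m))%N.
Proof.
rewrite card_sig -sum1_card (big_nth 0%N) big_mkord.
have := @sig_big_dep nat 0%N addn 'I_(size P) (fun r => 'I_(nth 0%N P r)) xpredT
  (fun r j => (m <= j)%N) (fun _ _ => 1%N).
rewrite /= => <-; apply: eq_bigr => r _.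
rewrite big_mkcond /=; elim: (nth 0%N P r) => [|k IH]; first by rewrite big_ord0.
by rewrite big_ord_recr /= IH; case: ifP; lia.
Qed.

End IdealFacts.

(** The first difference in [m] counts the parts larger than [m], the second the parts equal to
    [m + 1]; sorted lists with the same multiplicities coincide. *)
Lemma partition_eq (P Q : seq nat) : is_partition P -> is_partition Q ->
  (forall m, \sum_(p <- P) (p - m) = \sum_(p <- Q) (p - m))%N -> P = Q.
Proof.
move=> /andP[sP pP] /andP[sQ pQ] eq_sum.
have step (S : seq nat) m : (\sum_(p <- S) (p - m) =
    \sum_(p <- S) (p - m.+1) + count (fun p => m < p) S)%N.
  rewrite -sum1_count [X in (_ = _ + X)%N]big_mkcond -big_split /=.
  by apply: eq_bigr => p _; case: ifP; lia.
have eq_gt m : count (fun p => m < p)%N P = count (fun p => m < p)%N Q.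
  by apply/eqP; rewrite -(eqn_add2l (\sum_(p <- P) (p - m.+1))) -step !eq_sum -step.
have count0 (S : seq nat) : all (fun p => 0 < p)%N S -> count_mem 0%N S = 0%N.
  by move=> pS; apply/eqP; rewrite -leqn0 leqNgt -has_count has_pred1;
     apply/negP => /(allP pS).
have countS (S : seq nat) m : (count (fun p => m < p) S =
    count (fun p => m.+1 < p) S + count_mem m.+1 S)%N.
  by elim: S => //= p S ->; case: (ltngtP p m.+1); lia.
apply: (@sorted_eq _ geq) => //.
- by move=> a b c /=; lia.
- by move=> a b /=; lia.
apply/allP => x _ /=; apply/eqP; case: x => [|m]; first by rewrite !count0.
by apply/eqP; rewrite -(eqn_add2l (count (fun p => m.+1 < p)%N P)) -countS !eq_gt -countS.
Qed.

Lemma jordan_type_unique (K : fieldType) (I : {mpoly K[2]} -> Prop)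
    (l : {mpoly K[2]}) (P Q : seq nat) :
  is_ideal I -> jordan_type I l P -> jordan_type I l Q -> P = Q.
Proof.
move=> idI [pP [g [bP Ig]]] [pQ [h [bQ Ih]]]; apply: partition_eq => // m.
rewrite -!card_power_index.
exact: (quotient_basis_card idI (power_basis idI m bP Ig) (power_basis idI m bQ Ih)).
Qed.

(** * The Euclidean algorithm *)

(* [lia] compares atoms syntactically, while [size p] may be reached through
   different coercion paths. *)
Definition poly_size (K : fieldType) (p : {poly K}) : nat := size p.

Ltac size_lia :=
  repeat match goal with
  | |- context [@size ?A (@polyseq ?R ?p)] =>
      change (@size A (@polyseq R p)) with (poly_size p)
  | H : context [@size ?A (@polyseq ?R ?p)] |- _ =>
      change (@size A (@polyseq R p)) with (poly_size p) in H
  end; lia.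

Section Euclid.
Variable K : fieldType.
Implicit Types s : seq ({poly K} * K).

(* [(a, c)] records a division step [r_(i-1) = a r_i + c r_(i+1)]; the list of
   these steps, ending with the pair of remainders [(1, 0)], encodes a coprime
   pair. *)
Fixpoint euclid_pair s : {poly K} * {poly K} :=
  if s is x :: s' then
    (x.1 * (euclid_pair s').1 + x.2 *: (euclid_pair s').2, (euclid_pair s').1)
  else (1, 0).

Definition euclid_steps s : bool :=
  all (fun x : {poly K} * K => (1 < size x.1)%N && (x.2 != 0)) s.

Fixpoint euclid_deg s : nat :=
  if s is x :: s' then ((size x.1).-1 + euclid_deg s')%N else 0%N.

Fixpoint euclid_nodes s : seq nat :=
  if s is x :: s' then euclid_deg s :: euclid_nodes s' else [:: 0%N].

Lemma size_euclid s : euclid_steps s ->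
  size (euclid_pair s).1 = (euclid_deg s).+1 /\
  (size (euclid_pair s).2 < size (euclid_pair s).1)%N.
Proof.
elim: s => [_|[a c] s IH] /=; first by rewrite size_poly1 size_poly0.
case/andP=> /andP[/= sa c0] /IH[IH1 IH2].
have A0 : (euclid_pair s).1 != 0 by rewrite -size_poly_eq0 IH1.
have a0 : a != 0 by rewrite -size_poly_eq0; case: (size a) sa.
have sM : size (a * (euclid_pair s).1) = ((size a).-1 + euclid_deg s).+1.
  by rewrite size_mul // IH1; size_lia.
have sZ : (size (c *: (euclid_pair s).2)%R < size (a * (euclid_pair s).1)%R)%N.
  by rewrite sM (leq_ltn_trans (size_scale_leq _ _)) //; size_lia.
by rewrite size_polyDl // sM IH1; split=> //; size_lia.
Qed.

Lemma euclid_coprime s : euclid_steps s ->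
  coprimep (euclid_pair s).1 (euclid_pair s).2.
Proof.
elim: s => [_|[a c] s IH] /=; first by rewrite coprime1p.
case/andP=> /andP[/= sa c0] /IH cop.
rewrite coprimep_sym coprimep_addl_mul.
by rewrite coprimepZr.
Qed.

(** The common factor [c] is the last nonzero remainder, a constant by coprimality; it has to be
    split off since the lists start from the pair [(1, 0)]. *)
Lemma euclidP (A B : {poly K}) : (size B < size A)%N -> coprimep A B ->
  exists s (c : K), [/\ euclid_steps s, c != 0, A = c *: (euclid_pair s).1
    & B = c *: (euclid_pair s).2].
Proof.
elim: {B}_.+1 {-2}B (ltnSn (size B)) A => // m IH B sB A sBA cop.
have [B0|B0] := eqVneq B 0.
  move: cop; rewrite B0 coprimep0 => /eqpP[[x y] /= /andP[x0 y0]] e.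
  exists [::], (y / x); split; rewrite ?scaler0 ?mulf_neq0 ?invr_neq0 //=.
  by apply: (scalerI x0); rewrite e scalerA mulrC divfK.
have sR : (size (A %% B)%R < size B)%N by rewrite ltn_modp.
have [||s [c [sv c0 eB eR]]] := IH (A %% B) _ B sR.
- by apply: leq_trans sR _.
- by rewrite coprimep_sym coprimep_modl.
exists ((A %/ B, 1) :: s), c; split=> //=.
  rewrite sv oner_neq0 !andbT size_divp //.
  by case: (size B) (size_poly_gt0 B) sBA; rewrite B0; size_lia.
by rewrite {1}(divp_eq A B) {2}eB eR scale1r scalerDr scalerAr.
Qed.

Lemma euclid_nodes_deg s : euclid_deg s \in euclid_nodes s.
Proof. by case: s => [|x s] //=; rewrite inE eqxx. Qed.

Lemma euclid_nodes0 s : 0%N \in euclid_nodes s.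
Proof. by elim: s => //= x s IH; rewrite inE IH orbT. Qed.

Lemma euclid_nodes_le s y : y \in euclid_nodes s -> (y <= euclid_deg s)%N.
Proof.
elim: s => [|x s IH] /=; first by rewrite inE => /eqP ->.
by rewrite inE => /orP[/eqP -> //|/IH]; size_lia.
Qed.

(* The shifted remainders, with the degrees of their cofactors. *)
Lemma euclid_remainder s a : euclid_steps s -> (a < euclid_deg s)%N ->
  exists lo hi u v,
    [/\ lo \in euclid_nodes s, hi \in euclid_nodes s, (lo <= a < hi)%N
      & forall y, y \in euclid_nodes s -> (y <= lo)%N || (hi <= y)%N] /\
    [/\ size (u * (euclid_pair s).1 + v * (euclid_pair s).2) = a.+1,
        u = 0 \/ (size u + lo + hi <= size (euclid_pair s).2 + a)%N
      & (size v + lo + hi <= size (euclid_pair s).1 + a)%N].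
Proof.
elim: s => //= -[q c] s IH /= /andP[/andP[sq c0] sv] lt_a.
have [sA sB] := size_euclid sv.
have [|/= sA' sB'] := @size_euclid ((q, c) :: s); first by rewrite /= sq c0.
case: (ltnP a (euclid_deg s)) => ha.
  have [lo [hi [u [v [[nlo nhi lo_hi gap] [sw su sv']]]]]] := IH sv ha.
  (* The second remainder of the tail is [c^-1] times the new first component minus [q] times the
     new second one; substituting it into the combination for the tail gives these cofactors. *)
  exists lo, hi, (c^-1 *: v), (u - c^-1 *: (v * q)); split; split=> //.
  - by rewrite inE nlo orbT.
  - by rewrite inE nhi orbT.
  - by move=> y; rewrite inE => /orP[/eqP -> | /gap //]; have := euclid_nodes_le nhi; size_lia.
  - rewrite -sw; congr (size (polyseq _)); rewrite -!mul_polyC.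
    have e : (c^-1)%:P * c%:P = 1 :> {poly K} by rewrite -polyCM mulVf.
    rewrite -[v in RHS]mul1r -e; ring.
  - by right; apply: leq_trans sv'; rewrite !leq_add2r size_scale_leq.
  have le1 : (size (u - c^-1 *: (v * q))%R <= maxn (size u) (size (v * q)%R))%N.
    rewrite (leq_trans (size_polyD _ _)) // size_polyN geq_max leq_maxl /=.
    by rewrite (leq_trans (size_scale_leq _ _)) // leq_maxr.
  have le2 := size_polyMleq v q.
  have hu : (size u + lo + hi <= size (euclid_pair s).2 + a)%N \/ size u = 0%N.
    by case: su => [->|]; [right; rewrite size_poly0 | left].
  have := euclid_nodes_le nhi; rewrite sA'.
  have : (lo <= euclid_deg s)%N := euclid_nodes_le nlo.
  move: le1; rewrite leq_max; case: (eqVneq v 0) => [->|v0].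
    rewrite mul0r size_poly0 leqn0 size_poly_eq0; move: lo_hi.
    by move=> ? /orP[|/eqP ->]; rewrite ?size_poly0; size_lia.
  have : (0 < size v)%N by rewrite size_poly_gt0.
  size_lia.
(* In the topmost gap the multiple of the second component alone has the right degree. Its other
   cofactor is 0, for which the size inequality may fail; hence the alternative [u = 0]. *)
exists (euclid_deg s), ((size q).-1 + euclid_deg s)%N, 0, ('X^(a - euclid_deg s)).
split; split=> //.
- by rewrite inE euclid_nodes_deg orbT.
- by rewrite inE eqxx.
- by rewrite ha lt_a.
- by move=> y; rewrite inE => /orP[/eqP -> | /euclid_nodes_le ->]; rewrite ?leqnn ?orbT.
- by rewrite mul0r add0r mulrC size_mulXn ?sA -?size_poly_eq0 ?sA //; size_lia.
- by left.
- by rewrite size_polyXn sA'; size_lia.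
Qed.

(** Monomial quotients, one for each gap and of the length of the gap, realize any node set. *)
Lemma euclid_steps_exists (node : pred nat) x : node 0%N -> node x ->
  exists s, [/\ euclid_steps s, euclid_deg s = x
    & forall y, (y \in euclid_nodes s) = node y && (y <= x)%N].
Proof.
move=> n0; elim: x {-2}x (leqnn x) => [|m IH] x.
  rewrite leqn0 => /eqP -> _; exists [::]; split=> // y; rewrite inE leqn0.
  by case: eqP => [->|]; rewrite ?n0 ?andbF.
move=> xm nx; have [x0|x0] := posnP x; first by apply: IH; rewrite ?x0.
have lo_le := lo_node_le node x.-1.
have [|s [sv sd sn]] := IH (lo_node node x.-1) _ (lo_nodeP _ n0); first by size_lia.
exists (('X^(x - lo_node node x.-1), 1) :: s); split=> /=.
- by rewrite sv oner_neq0 size_polyXn !andbT; size_lia.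
- by rewrite size_polyXn sd; size_lia.
move=> y; rewrite inE size_polyXn sd sn subnK; last by size_lia.
case: eqP => [->|ne] /=; first by rewrite nx leqnn.
case ny: (node y) => //=; apply/idP/idP => [|yx]; first by size_lia.
by apply: lo_node_max => //; size_lia.
Qed.

Lemma euclid_deg_cat s s' : euclid_deg (s ++ s') = (euclid_deg s + euclid_deg s')%N.
Proof. by elim: s => //= x s ->; rewrite addnA. Qed.

Lemma euclid_split s x : (x < euclid_deg s)%N -> x \notin euclid_nodes s ->
  exists pre q c post, s = pre ++ (q, c) :: post /\
    (euclid_deg post < x < euclid_deg post + (size q).-1)%N.
Proof.
elim: s => //= -[q c] s IH /= lt_x; rewrite inE negb_or => /andP[_ nx].
case: (ltnP x (euclid_deg s)) => hx.
  have [pre [q' [c' [post [-> e]]]]] := IH hx nx.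
  by exists ((q, c) :: pre), q', c', post.
exists [::], q, c, s; split=> //; rewrite ltn_neqAle hx andbT addnC lt_x andbT.
by apply: contra nx => /eqP <-; apply: euclid_nodes_deg.
Qed.

Lemma euclid_nodes_refine pre (q q1 q2 : {poly K}) (c c1 c2 : K) post y :
  ((size q1).-1 + (size q2).-1 = (size q).-1)%N ->
  (y \in euclid_nodes (pre ++ (q1, c1) :: (q2, c2) :: post)) =
  (y \in euclid_nodes (pre ++ (q, c) :: post)) ||
  (y == (size q2).-1 + euclid_deg post)%N.
Proof.
move=> e; elim: pre => [|x pre IH] /=.
  by rewrite !inE addnA e -!orbA; congr (_ || _); rewrite orbC.
have ed : euclid_deg (pre ++ (q1, c1) :: (q2, c2) :: post) =
    euclid_deg (pre ++ (q, c) :: post).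
  by rewrite !euclid_deg_cat /=; move: e; size_lia.
by rewrite !inE IH ed orbA.
Qed.

End Euclid.

(** * Dehomogenization *)

Section Homogenization.
Variables (K : fieldType) (v w : 'I_2 -> K).

(* When [det(v, w) = 1], the substitution [l = 1], [l' = z] for the linear forms
   [l], [l'] of coefficients [v], [w]. *)
Definition dehom (f : {mpoly K[2]}) : {poly K} :=
  mmap polyC (fun i => if i == ord0 then (w ord_max)%:P - v ord_max *: 'X
                       else v ord0 *: 'X - (w ord0)%:P) f.

HB.instance Definition _ := GRing.RMorphism.copy dehom
  (mmap polyC (fun i => if i == ord0 then (w ord_max)%:P - v ord_max *: 'X
                       else v ord0 *: 'X - (w ord0)%:P)).

(** Coefficients beyond [b] are dropped, which keeps the map total and linear; it inverts [dehom]
    only under a size bound. *)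
Definition homogenize (b : nat) (q : {poly K}) : {mpoly K[2]} :=
  \sum_(i < b.+1) q`_i *: (linear_form v ^+ (b - i) * linear_form w ^+ i).

Local Notation l := (linear_form v).
Local Notation l' := (linear_form w).

Lemma linear_formE (u : 'I_2 -> K) :
  linear_form u = u ord0 *: 'X_ord0 + u ord_max *: 'X_ord_max.
Proof.
rewrite /linear_form big_ord_recl big_ord1.
by have -> : lift ord0 ord0 = ord_max :> 'I_2 by apply: val_inj.
Qed.

Lemma X_homog (i : 'I_2) : ('X_i : {mpoly K[2]}) \is 1.-homog.
Proof. by rewrite dhomogX; apply/eqP; exact: mdeg1. Qed.

Lemma linear_form_homog (u : 'I_2 -> K) : linear_form u \is 1.-homog.
Proof. by apply: rpred_sum => i _; apply/rpredZ/X_homog. Qed.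

Lemma homogenize_homog b q : homogenize b q \is b.-homog.
Proof.
apply: rpred_sum => i _; apply: rpredZ.
have := dhomogM (dhomogMn (b - i) (linear_form_homog v))
                (dhomogMn i (linear_form_homog w)).
by rewrite !mul1n subnK // -ltnS.
Qed.

Lemma hom_is_linear b : linear (homogenize b).
Proof.
move=> c p q; rewrite /homogenize scaler_sumr -big_split; apply: eq_bigr => i _ /=.
by rewrite coefD coefZ scalerDl scalerA.
Qed.

HB.instance Definition _ b :=
  GRing.isLinear.Build K {poly K} {mpoly K[2]} _ (homogenize b) (hom_is_linear b).

Lemma dehomZ c f : dehom (c *: f) = c *: dehom f.
Proof. by rewrite /dehom mmapZ mul_polyC. Qed.

Lemma hom_mulv b (q : {poly K}) : (size q <= b.+1)%N -> homogenize b.+1 q = l * homogenize b q.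
Proof.
move=> sq; rewrite /homogenize big_ord_recr /= nth_default // scale0r addr0 mulr_sumr.
apply: eq_bigr => i _; rewrite -scalerAr mulrA -exprS subSn //.
by rewrite -ltnS.
Qed.

Lemma hom_mulw b q : homogenize b.+1 (q * 'X) = l' * homogenize b q.
Proof.
rewrite /homogenize big_ord_recl /= coefMX eqxx scale0r add0r mulr_sumr.
apply: eq_bigr => i _; rewrite coefMX /= subSS -scalerAr.
by rewrite mulrCA -exprS.
Qed.

Hypothesis det_vw : v ord0 * w ord_max - v ord_max * w ord0 = 1.

Lemma dehom_v : dehom l = 1.
Proof.
rewrite linear_formE rmorphD /= !dehomZ /dehom !mmapX !mmap1U /=.
rewrite -[RHS]polyC1 -det_vw polyCB !polyCM -!mul_polyC; ring.
Qed.

Lemma dehom_w : dehom l' = 'X.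
Proof.
rewrite linear_formE rmorphD /= !dehomZ /dehom !mmapX !mmap1U /=.
rewrite -[RHS]mul1r -[X in X * _]polyC1 -det_vw polyCB !polyCM -!mul_polyC; ring.
Qed.

Lemma homK b (q : {poly K}) : (size q <= b.+1)%N -> dehom (homogenize b q) = q.
Proof.
move=> sq; rewrite /homogenize rmorph_sum /=.
under eq_bigr do rewrite dehomZ rmorphM !rmorphXn /= dehom_v dehom_w expr1n mul1r.
by rewrite -poly_def; apply/polyP => i; rewrite coef_poly;
   case: ltnP => // /(leq_trans sq) ?; rewrite nth_default.
Qed.

(** The size bound and the inversion formula are carried together, one variable at a time, because
    homogenizing the product by a variable uses the bound for the previous factor. *)
Lemma dehom_X_spec b (f : {mpoly K[2]}) (i : 'I_2) :
  (size (dehom f) <= b.+1)%N /\ homogenize b (dehom f) = f ->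
  (size (dehom ('X_i * f)) <= b.+2)%N /\ homogenize b.+1 (dehom ('X_i * f)) = 'X_i * f.
Proof.
case=> sf ef.
have key (x y : K) : 'X_i = x *: l + y *: l' ->
    dehom 'X_i = x%:P + y *: 'X ->
    (size (dehom ('X_i * f)) <= b.+2)%N /\ homogenize b.+1 (dehom ('X_i * f)) = 'X_i * f.
  move=> eX edX; have -> : dehom ('X_i * f) = x *: dehom f + y *: (dehom f * 'X).
    rewrite rmorphM /= edX mulrDl mul_polyC -scalerAl; congr (_ + _ *: _).
    exact: mulrC.
  split.
    apply: leq_trans (size_polyD _ _) _; rewrite geq_max.
    apply/andP; split; apply: leq_trans (size_scale_leq _ _) _; first exact: leqW.
    by apply: leq_trans (size_polyMleq _ _) _; rewrite size_polyX addn2 /= ltnS.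
  by rewrite linearD !linearZ /= hom_mulv // hom_mulw ef eX mulrDl -!scalerAl.
have dX : dehom 'X_i = if i == ord0 then (w ord_max)%:P - v ord_max *: 'X
                       else v ord0 *: 'X - (w ord0)%:P.
  by rewrite /dehom mmapX mmap1U.
have [i0|i0] := eqVneq i ord0.
  apply: (key (w ord_max) (- v ord_max)); last by rewrite dX i0 eqxx scaleNr.
  rewrite i0 !linear_formE !scalerDr !scalerA addrACA -!scalerDl.
  have -> : w ord_max * v ord0 + - v ord_max * w ord0 = 1 by rewrite -det_vw; ring.
  have -> : w ord_max * v ord_max + - v ord_max * w ord_max = 0 by ring.
  by rewrite scale1r scale0r addr0.
have {}i0 : i = ord_max.
  by move: i0; clear; case: i => [[|[|]]] // ? _; apply: val_inj.
apply: (key (- w ord0) (v ord0)); last first.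
  by rewrite dX i0 /= addrC -polyCN.
rewrite i0 !linear_formE !scalerDr !scalerA addrACA -!scalerDl.
have -> : - w ord0 * v ord_max + v ord0 * w ord_max = 1 by rewrite -det_vw; ring.
have -> : - w ord0 * v ord0 + v ord0 * w ord0 = 0 by ring.
by rewrite scale1r scale0r add0r.
Qed.

Lemma dehom_mnm_spec (m : 'X_{1..2}) :
  (size (dehom 'X_[m]) <= (mdeg m).+1)%N /\ homogenize (mdeg m) (dehom 'X_[m]) = 'X_[m].
Proof.
rewrite mpolyXE_id mdegE !big_ord_recl !big_ord0 mulr1 addn0.
elim: (m ord0) => [|a IH]; last by rewrite exprS -mulrA addSn; apply: dehom_X_spec.
rewrite expr0 mul1r add0n.
elim: (m _) => [|a IH]; last by rewrite exprS; apply: dehom_X_spec.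
by rewrite expr0 rmorph1 size_poly1 /homogenize big_ord1 coef1 scale1r mul1r.
Qed.

Lemma dehom_spec b f : f \is b.-homog ->
  (size (dehom f) <= b.+1)%N /\ homogenize b (dehom f) = f.
Proof.
move=> /dhomogP hf; rewrite [f]mpolyE !rmorph_sum /= !big_seq.
split.
  apply: (leq_trans (size_sum _ _ _)); apply/bigmax_leqP_seq => m mf _.
  rewrite dehomZ (leq_trans (size_scale_leq _ _)) //.
  by have [+ _] := dehom_mnm_spec m; rewrite hf.
rewrite linear_sum; apply: eq_bigr => m mf; rewrite dehomZ linearZ /=.
by have [_] := dehom_mnm_spec m; rewrite hf // => ->.
Qed.

Lemma size_dehom b f : f \is b.-homog -> (size (dehom f) <= b.+1)%N.
Proof. by case/dehom_spec. Qed.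

Lemma dehomK b f : f \is b.-homog -> homogenize b (dehom f) = f.
Proof. by case/dehom_spec. Qed.

Lemma dehom_inj b f g : f \is b.-homog -> g \is b.-homog ->
  dehom f = dehom g -> f = g.
Proof. by move=> hf hg e; rewrite -(dehomK hf) e dehomK. Qed.

Lemma homM a b (p q : {poly K}) : (size p <= a.+1)%N -> (size q <= b.+1)%N ->
  homogenize (a + b) (p * q) = homogenize a p * homogenize b q.
Proof.
move=> sp sq; apply: (@dehom_inj (a + b)); first exact: homogenize_homog.
  by apply: dhomogM; apply: homogenize_homog.
rewrite rmorphM /= !homK //; apply: leq_trans (size_polyMleq _ _) _.
move: sp sq; set x := size p; set y := size q; lia.
Qed.

Lemma homogenize_mulvn a b (q : {poly K}) : (size q <= a.+1)%N -> homogenize (b + a) q = l ^+ b * homogenize a q.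
Proof.
move=> sq; elim: b => [|b IH]; first by rewrite mul1r.
by rewrite addSn hom_mulv ?IH ?exprS ?mulrA // (leq_trans sq) // ltnS leq_addl.
Qed.

End Homogenization.

Lemma complement_exists (K : fieldType) (v : 'I_2 -> K) : linear_form v != 0 ->
  exists w : 'I_2 -> K, v ord0 * w ord_max - v ord_max * w ord0 = 1.
Proof.
move=> v0; have [e0|e0] := eqVneq (v ord0) 0; last first.
  exists (fun i => if i == ord0 then 0 else (v ord0)^-1) => /=.
  by rewrite mulr0 subr0 divff.
have [e1|e1] := eqVneq (v ord_max) 0.
  by case/eqP: v0; rewrite linear_formE e0 e1 !scale0r addr0.
exists (fun i => if i == ord0 then - (v ord_max)^-1 else 0) => /=.
by rewrite mulr0 mulrN opprK add0r divff.
Qed.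

(** * Homogeneous components of a product *)

Section Components.
Variable K : fieldType.
Implicit Types f g h : {mpoly K[2]}.

Lemma pihomog_sum f : f = \sum_(i < msize f) pihomog mdeg i f.
Proof. exact: pihomog_partitionE. Qed.

(** Allows arbitrary cofactors in an identity between forms to be replaced by homogeneous ones of
    the right degree. *)
Lemma pihomog_homogM f g m i : g \is m.-homog ->
  pihomog mdeg i (f * g) = if (m <= i)%N then pihomog mdeg (i - m) f * g else 0.
Proof.
move=> hg; rewrite {1}[f]pihomog_sum mulr_suml raddf_sum /=.
have hom_i (j : nat) : pihomog mdeg j f * g \is (j + m).-homog.
  exact/dhomogM/hg/pihomogP.
case: leqP => hmi; last first.
  rewrite big1 // => j _; apply: (pihomog_ne0 _ (hom_i j)).
  by apply/eqP; lia.
case: (ltnP (i - m) (msize f)) => hs.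
  rewrite (bigD1 (Ordinal hs)) //= big1 ?addr0 => [|j ne].
    by rewrite pihomog_dE //; have := hom_i (i - m)%N; rewrite subnK.
  apply: (pihomog_ne0 _ (hom_i j)); apply/eqP; move/eqP: ne => ne e.
  by apply: ne; apply: val_inj => /=; lia.
rewrite big1 => [|j _].
  have -> : pihomog mdeg (i - m) f = 0; last by rewrite mul0r.
  rewrite [f]pihomog_sum raddf_sum big1 //= => j _.
  apply: (pihomog_ne0 _ (pihomogP _ _ _)).
  by have := ltn_ord j; apply: contraTneq => ->; rewrite -leqNgt.
apply: (pihomog_ne0 _ (hom_i j)); apply/eqP; have := ltn_ord j; lia.
Qed.

End Components.

(** * Complete intersections and coprime pairs *)

Section PairIdeal.
Variable K : fieldType.
Implicit Types (f g q r u t : {poly K}).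

(* The dehomogenized degree [b] part of the ideal generated by forms of degrees
   [d] and [n]. *)
Definition pair_ideal (d n : nat) (f g : {poly K}) (b : nat) (q : {poly K}) : Prop :=
  exists u t, [/\ q = u * f + t * g, (size u <= b.+1 - d)%N & (size t <= b.+1 - n)%N].

Lemma pair_idealC d n f g b q : pair_ideal d n f g b q -> pair_ideal n d g f b q.
Proof. by move=> [u [t [-> su st]]]; exists t, u; rewrite addrC. Qed.

Lemma pair_ideal_addr d n f g r b q : (size r <= (n - d).+1)%N -> (d <= n)%N ->
  pair_ideal d n f g b q -> pair_ideal d n f (g + r * f) b q.
Proof.
move=> sr dn [u [t [-> su st]]]; exists (u - t * r), t; split=> //; first by ring.
have [->|t0] := eqVneq t 0; first by rewrite mul0r subr0.
apply: leq_trans (size_polyD _ _) _; rewrite size_polyN geq_max su /=.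
apply: leq_trans (size_polyMleq _ _) _.
have : (0 < size t)%N by rewrite size_poly_gt0.
size_lia.
Qed.

Lemma pair_ideal_addrE d n f g r b q : (size r <= (n - d).+1)%N -> (d <= n)%N ->
  pair_ideal d n f (g + r * f) b q <-> pair_ideal d n f g b q.
Proof.
move=> sr dn; split; last exact: pair_ideal_addr.
move/(pair_ideal_addr (r := - r)); rewrite size_polyN => /(_ sr dn).
by rewrite -addrA mulNr subrr addr0.
Qed.

(** [g] has exact degree [n], so its form is prime to [l], and [f] has smaller degree, so the
    Euclidean algorithm can start from [(g, f)]. The degree of [f] may fall below [d]: this is the
    case of a generator divisible by [l]. *)
Definition coprime_pair (d n : nat) (f g : {poly K}) : Prop :=
  [/\ (0 < d <= n)%N, coprimep f g, size g = n.+1, (size f <= d.+1)%N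
    & (size f <= n)%N].

Lemma coprime_pair_normalize d n f g :
  (0 < d)%N -> (0 < n)%N -> coprimep f g -> (size f <= d.+1)%N -> (size g <= n.+1)%N ->
  size f = d.+1 \/ size g = n.+1 ->
  exists d' n' f' g', coprime_pair d' n' f' g' /\
    forall b q, pair_ideal d' n' f' g' b q <-> pair_ideal d n f g b q.
Proof.
wlog dn : d n f g / (d <= n)%N.
  move=> hw d0 n0 cop sf sg lead; case: (leqP d n) => dn; first exact: hw.
  have [||||||d' [n' [f' [g' [cp e]]]]] := hw n d g f (ltnW dn) => //.
  - by rewrite coprimep_sym.
  - by case: lead; [right | left].
  exists d', n', f', g'; split=> // b q; rewrite e.
  by split; apply: pair_idealC.
move=> d0 n0 cop sf sg lead.
(* If [l] divides the generator of degree [n], it does not divide the other one; adding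
   ['X^(n - d) * f] restores the degree without changing the ideal. *)
wlog {lead} sg' : g cop sg / size g = n.+1.
  move=> hw; have [sg'|sg'] := eqVneq (size g) n.+1; first exact: hw.
  have sf' : size f = d.+1 by case: lead => // e; rewrite e eqxx in sg'.
  have f0 : f != 0 by rewrite -size_poly_eq0 sf'.
  have lt_g : (size g < size ('X^(n - d) * f)%R)%N.
    by rewrite mulrC size_mulXn // sf' addnS subnK // ltn_neqAle sg' sg.
  have sr : (size ('X^(n - d) : {poly K}) <= (n - d).+1)%N by rewrite size_polyXn.
  have [|||d' [n' [f' [g' [cp e]]]]] := hw (g + 'X^(n - d) * f).
  - by rewrite addrC coprimep_addl_mul.
  - rewrite addrC size_polyDl // mulrC size_mulXn // sf'; lia.
  - rewrite addrC size_polyDl // mulrC size_mulXn // sf'; lia.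
  by exists d', n', f', g'; split=> // b q; rewrite e pair_ideal_addrE.
case: (leqP (size f) n) => sfn; first by exists d, n, f, g; split=> //; split=> //; rewrite d0.
have g0 : g != 0 by rewrite -size_poly_eq0 sg'.
have ed : d = n by lia.
have sf' : size f = n.+1 by lia.
(* Here [d = n] and both polynomials have full degree; cancelling the leading coefficient of [f]
   against [g] lowers the degree of [f]. *)
pose c := - (lead_coef f / lead_coef g).
exists n, n, (f + c%:P * g), g; split.
  have sf2 : (size (f + c%:P * g)%R <= n)%N.
    apply/leq_sizeP => j; rewrite leq_eqVlt => /orP[/eqP <-|lt_nj].
      rewrite coefD coefCM /c /lead_coef sf' sg' /= mulNr divfK ?subrr //.
      by have := lead_coef_eq0 g; rewrite /lead_coef sg' (negPf g0) => ->.
    by rewrite coefD coefCM !nth_default ?mulr0 ?addr0 ?sf' ?sg'.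
  split=> //; first by rewrite n0 leqnn.
  - by rewrite coprimep_sym addrC coprimep_addl_mul coprimep_sym.
  - exact: leqW.
move=> b q; have sc : (size (c%:P : {poly K}) <= (n - n).+1)%N.
  by rewrite subnn size_polyC_leq1.
rewrite ed; split=> [/pair_idealC h|/pair_idealC h]; apply: pair_idealC.
  by move: h; rewrite pair_ideal_addrE.
by rewrite pair_ideal_addrE.
Qed.

Variables (v w : 'I_2 -> K).
Hypothesis det_vw : v ord0 * w ord_max - v ord_max * w ord0 = 1.

Local Notation dehom := (dehom v w).
Local Notation homogenize := (homogenize v w).
Implicit Types (I : {mpoly K[2]} -> Prop).

Definition presents I (d n : nat) f g : Prop :=
  forall b (h : {mpoly K[2]}), h \is b.-homog -> I h <-> pair_ideal d n f g b (dehom h).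

Lemma graded_ideal_comp I h : graded_ideal I ->
  I h <-> forall i, I (pihomog mdeg i h).
Proof.
move=> [idI gI]; split=> [Ih i|Ih]; first exact: gI.
by rewrite [h]pihomog_sum; apply: ideal_sum => // i _; apply: Ih.
Qed.

Lemma pair_ideal_hom d n (F G : {mpoly K[2]}) b (h : {mpoly K[2]}) : F \is d.-homog -> G \is n.-homog -> h \is b.-homog ->
  (exists p q : {mpoly K[2]}, h = p * F + q * G) <->
  pair_ideal d n (dehom F) (dehom G) b (dehom h).
Proof.
move=> hF hG hh; split=> [[p [q e]]|[u [t [e su st]]]].
  exists (if (d <= b)%N then dehom (pihomog mdeg (b - d) p) else 0).
  exists (if (n <= b)%N then dehom (pihomog mdeg (b - n) q) else 0).
  rewrite -(pihomog_dE hh) e raddfD /= (pihomog_homogM _ _ hF) (pihomog_homogM _ _ hG).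
  split.
  - by rewrite rmorphD /=; congr (_ + _); case: ifP; rewrite ?rmorphM ?mul0r ?rmorph0.
  - case: ifP => db; last by rewrite size_poly0.
    by rewrite subSn // (size_dehom det_vw) // pihomogP.
  - case: ifP => nb; last by rewrite size_poly0.
    by rewrite subSn // (size_dehom det_vw) // pihomogP.
have key c (x : {poly K}) (X : {mpoly K[2]}) : X \is c.-homog -> (size x <= b.+1 - c)%N ->
    dehom (homogenize (b - c) x) = x /\ homogenize (b - c) x * X \is b.-homog.
  move=> hX; case: (leqP c b) => cb sx.
    rewrite homK ?subSn //; last by rewrite -subSn.
    by split=> //; rewrite -[X in X.-homog](subnK cb); apply/dhomogM/hX/homogenize_homog.
  have -> : x = 0.
    by apply/eqP; rewrite -size_poly_leq0 (leq_trans sx) // leqn0 subn_eq0.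
  by rewrite !raddf0 mul0r dhomog0.
have [ep hp] := key _ _ _ hF su; have [eq hq] := key _ _ _ hG st.
exists (homogenize (b - d) u), (homogenize (b - n) t); apply: (dehom_inj det_vw hh).
  exact: rpredD.
by rewrite rmorphD !rmorphM /= ep eq.
Qed.

Lemma homog0_const (F : {mpoly K[2]}) : F \is 0.-homog -> exists c : K, F = c *: 1.
Proof.
move=> hF; rewrite -(dehomK det_vw hF) /homogenize big_ord1 mulr1.
by exists (dehom F)`_0.
Qed.

Lemma ci_presented I : graded_ideal I -> complete_intersection I ->
  exists d n f g, coprime_pair d n f g /\ presents I d n f g.
Proof.
move=> gI [m [n [F [G [[hF hG] defI regF regG I1]]]]].
have [idI _] := gI.
have F0 : F <> 0.
  by move=> F0; have := regF 1; rewrite F0 mulr0 => /(_ erefl)/eqP; rewrite oner_eq0.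
have IF : I F by apply/defI; exists 1, 0; rewrite mul1r mul0r addr0.
have IG : I G by apply/defI; exists 0, 1; rewrite mul1r mul0r add0r.
have const0 X : X \is 0.-homog -> I X -> X = 0.
  move=> /homog0_const[c ->] Ic; have [->|c0] := eqVneq c 0; first by rewrite scale0r.
  by case: I1; rewrite -[1](scalerK c0); apply: idealZ.
have m0 : (0 < m)%N.
  by rewrite lt0n; apply/eqP => m0; apply: F0; apply: const0 => //; move: hF; rewrite m0.
have n0 : (0 < n)%N.
  rewrite lt0n; apply/eqP => n0; have G0 : G = 0 by apply: const0 => //; move: hG; rewrite n0.
  have [|p e] := regG 1; first by exists 0; rewrite G0 mulr0 mul0r.
  by apply: I1; rewrite e; apply: idealM.
have small c (h p : {mpoly K[2]}) : h \is c.-homog -> (c < m)%N ->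
      h * G = p * F -> h = 0.
  move=> hh cm e; have [|p' e'] := regG h; first by exists p.
  by rewrite -(pihomog_dE hh) e' (pihomog_homogM _ _ hF) leqNgt cm.
pose f := dehom F; pose g := dehom G.
have sf : (size f <= m.+1)%N by apply: (size_dehom det_vw).
have sg : (size g <= n.+1)%N by apply: (size_dehom det_vw).
have f0 : f != 0.
  apply/eqP => f0; apply: F0; apply: (dehom_inj det_vw hF); first exact: dhomog0.
  by rewrite -/f f0 rmorph0.
(* Regularity makes [f1] a multiple of [f] for forms, and its formal degree is below [m], so there
   is no syzygy of low degree. *)
have syz f1 g1 : (size f1 <= m)%N -> (size g1 <= n)%N -> f1 * g = g1 * f -> f1 = 0.
  move=> sf1 sg1 e; have sf1' : (size f1 <= m.-1.+1)%N by rewrite prednK.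
  have sg1' : (size g1 <= n.-1.+1)%N by rewrite prednK.
  have h0 : homogenize m.-1 f1 = 0.
    apply: (small m.-1 _ (homogenize n.-1 g1)); [exact: homogenize_homog | by rewrite prednK |].
    rewrite -(dehomK det_vw hF) -(dehomK det_vw hG) -!(homM det_vw) // e.
    by congr homogenize; lia.
  by rewrite -(homK det_vw sf1') h0 rmorph0.
(* A nonconstant gcd would give the low syzygy of the two quotients by it. *)
have cop : coprimep f g.
  rewrite /coprimep; have p0 : gcdp f g != 0 by rewrite gcdp_eq0 negb_and f0.
  have sp : (0 < size (gcdp f g))%N by rewrite size_poly_gt0.
  case: eqP => // /eqP ne; case/eqP: f0.
  have ef := divpK (dvdp_gcdl f g); have eg := divpK (dvdp_gcdr f g).
  rewrite -ef (syz (f %/ gcdp f g) (g %/ gcdp f g)) ?mul0r //.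
  - by rewrite size_divp //; size_lia.
  - by rewrite size_divp //; size_lia.
  by rewrite -[X in _ * X = _]eg -[X in _ = _ * X]ef mulrCA.
(* If both degrees drop, [l] is a common factor of the two forms, and [(f, g)] is itself a syzygy of
   too low formal degree. *)
have lead : size f = m.+1 \/ size g = n.+1.
  have [?|ne1] := eqVneq (size f) m.+1; first by left.
  have [?|ne2] := eqVneq (size g) n.+1; first by right.
  case/eqP: f0; apply: (syz f g); rewrite 1?mulrC // -ltnS ltn_neqAle.
    by rewrite ne1.
  by rewrite ne2.
have [d' [n' [f' [g' [cp e]]]]] := coprime_pair_normalize m0 n0 cop sf sg lead.
exists d', n', f', g'; split=> // b h hh; rewrite e -(pair_ideal_hom hF hG hh).
exact: defI.
Qed.

Lemma presents_ci I d n f g : graded_ideal I -> coprime_pair d n f g ->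
  presents I d n f g -> complete_intersection I.
Proof.
move=> gI [/andP[d0 dn] cop sg sf sf'] pI; have [idI _] := gI.
have g0 : g != 0 by rewrite -size_poly_eq0 sg.
have n0 : (0 < n)%N := leq_trans d0 dn.
have f0 : f != 0.
  by apply: contraTneq cop => ->; rewrite coprime0p -size_poly_eq1 sg; lia.
have sg_le : (size g <= n.+1)%N by rewrite sg.
pose F := homogenize d f; pose G := homogenize n g.
have hF : F \is d.-homog by apply: homogenize_homog.
have hG : G \is n.-homog by apply: homogenize_homog.
have defI h : I h <-> exists p q : {mpoly K[2]}, h = p * F + q * G.
  have homI b x : x \is b.-homog -> I x <-> exists p q : {mpoly K[2]}, x = p * F + q * G.
    move=> hx; rewrite (pair_ideal_hom hF hG hx) (homK det_vw sf) (homK det_vw sg_le).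
    exact: pI.
  rewrite graded_ideal_comp //; split=> [Ih|[p [q ->]] i]; last first.
    rewrite raddfD /=; apply/(homI i); first by apply: rpredD; apply: pihomogP.
    rewrite (pihomog_homogM _ _ hF) (pihomog_homogM _ _ hG).
    exists (if (d <= i)%N then pihomog mdeg (i - d) p else 0).
    exists (if (n <= i)%N then pihomog mdeg (i - n) q else 0).
    by congr (_ + _); case: ifP; rewrite ?mul0r.
  rewrite [h]pihomog_sum; elim/big_ind: _ => [|x y [p [q ->]] [p' [q' ->]]|i _].
  - by exists 0, 0; rewrite !mul0r addr0.
  - by exists (p + p'), (q + q'); ring.
  - exact/(homI i)/Ih/pihomogP.
have F0 : F != 0.
  by apply: contra f0 => /eqP e; rewrite -(homK det_vw sf) -/F e rmorph0.
have G0 : G != 0.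
  by apply: contra g0 => /eqP e; rewrite -(homK det_vw sg_le) -/G e rmorph0.
exists d, n, F, G; split=> //.
- by move=> h /eqP; rewrite mulf_eq0 (negPf F0) orbF => /eqP.
- move=> h [p e]; rewrite [h]pihomog_sum.
  elim/big_ind: _ => [|x y [p1 ->] [p2 ->]|i _]; first by exists 0; rewrite mul0r.
    by exists (p1 + p2); rewrite mulrDl.
  set x := pihomog mdeg i h; have hx : x \is i.-homog by apply: pihomogP.
  have [p' [hp' e']] : exists p', p' \is (i + n - d).-homog /\ x * G = p' * F.
    exists (pihomog mdeg (i + n - d) p); split; first exact: pihomogP.
    have := congr1 (pihomog mdeg (i + n)) e.
    by rewrite (pihomog_homogM _ _ hG) (pihomog_homogM _ _ hF) leq_addl addnK => ->;
       rewrite (leq_trans dn) ?leq_addl.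
  have ed := congr1 dehom e'; rewrite !rmorphM /= !(homK det_vw) // in ed.
  have fx : f %| dehom x by rewrite -(Gauss_dvdpl _ cop) ed dvdp_mull.
  have [t et] : exists t, dehom x = t * f by exists (dehom x %/ f); rewrite divpK.
  have ep : dehom p' = t * g.
    by apply: (mulIf f0); rewrite -ed et; ring.
  have sp := size_dehom det_vw hp'.
  have [t0|t0] := eqVneq t 0.
    exists 0; rewrite mul0r; apply: (dehom_inj det_vw hx); first exact: dhomog0.
    by rewrite et t0 mul0r rmorph0.
  (* Because [g] has exact degree [n], the size of [t * g] bounds that of [t], so [t] homogenizes in
     degree [i - d]. *)
  have st : (size t <= (i - d).+1)%N /\ (d <= i)%N.
    have := size_mul t0 g0; rewrite -ep sg => es.
    have st : (0 < size t)%N by rewrite size_poly_gt0.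
    by clear -es sp st dn; size_lia.
  case: st => st di; exists (homogenize (i - d) t); apply: (dehom_inj det_vw hx).
    by rewrite -[X in X.-homog](subnK di); apply/dhomogM/hF/homogenize_homog.
  by rewrite et rmorphM /= !(homK det_vw).
- move=> I1; have := pI 0%N 1 (dhomog1 _ _) => -[/(_ I1)[u [t [e su st]]] _].
  have u0 : u = 0 by apply/eqP; rewrite -size_poly_leq0 (leq_trans su) //; lia.
  have t0 : t = 0 by apply/eqP; rewrite -size_poly_leq0 (leq_trans st) //; lia.
  by move/eqP: e; rewrite u0 t0 !mul0r addr0 rmorph1 oner_eq0.
Qed.

Lemma presented_exists d n f g :
  coprime_pair d n f g -> exists I, graded_ideal I /\ presents I d n f g.
Proof.
move=> [_ _ sg sf _].
have sg_le : (size g <= n.+1)%N by rewrite sg.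
pose F := homogenize d f; pose G := homogenize n g.
have hF : F \is d.-homog by apply: homogenize_homog.
have hG : G \is n.-homog by apply: homogenize_homog.
exists (fun h => exists p q : {mpoly K[2]}, h = p * F + q * G); split; last first.
  move=> b h hh; rewrite (pair_ideal_hom hF hG hh).
  by rewrite (homK det_vw sf) (homK det_vw sg_le).
split; first split.
- by exists 0, 0; rewrite !mul0r addr0.
- by move=> x y [p [q ->]] [p' [q' ->]]; exists (p + p'), (q + q'); ring.
- by move=> x y [p [q ->]]; exists (x * p), (x * q); ring.
move=> h i [p [q ->]].
rewrite raddfD /= (pihomog_homogM _ _ hF) (pihomog_homogM _ _ hG).
exists (if (d <= i)%N then pihomog mdeg (i - d) p else 0).
exists (if (n <= i)%N then pihomog mdeg (i - n) q else 0).
by congr (_ + _); case: ifP; rewrite ?mul0r.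
Qed.

End PairIdeal.

(** * Sylvester matrices *)

Section Triangular.
Variables (K : fieldType) (W : nat -> {poly K}).
Hypothesis sW : forall a, size (W a) = a.+1.

Lemma triangular_free m (y : nat -> K) :
  \sum_(a < m) y a *: W a = 0 -> forall a, (a < m)%N -> y a = 0.
Proof.
elim: m => [//|m IH]; rewrite big_ord_recr /= => e.
have ym : y m = 0.
  have := congr1 (fun p : {poly K} => p`_m) e; rewrite coefD coef_sum big1 => [|a _].
    rewrite add0r coefZ coef0 => /eqP; rewrite mulf_eq0 => /orP[/eqP //|].
    have := lead_coef_eq0 (W m); rewrite /lead_coef sW /= => ->.
    by rewrite -size_poly_eq0 sW.
  by rewrite coefZ nth_default ?mulr0 // sW.
move: e; rewrite ym scale0r addr0 => /IH y0 a; rewrite ltnS leq_eqVlt.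
by case/orP=> [/eqP -> //|]; apply: y0.
Qed.

Lemma triangular_span m (q : {poly K}) : (size q <= m)%N ->
  exists y : nat -> K, q = \sum_(a < m) y a *: W a.
Proof.
elim: m q => [|m IH] q sq.
  exists (fun _ => 0); rewrite big_ord0; apply/eqP.
  by rewrite -size_poly_leq0.
have W0 : (W m)`_m != 0.
  have := lead_coef_eq0 (W m); rewrite /lead_coef sW /= => ->.
  by rewrite -size_poly_eq0 sW.
have [|y ey] := IH (q - (q`_m / (W m)`_m) *: W m).
  apply/leq_sizeP => j; rewrite leq_eqVlt coefB coefZ => /orP[/eqP <-|mj].
    by rewrite divfK ?subrr.
  have Wj : (W m)`_j = 0 by rewrite nth_default ?sW.
  by rewrite (nth_default _ (leq_trans sq mj)) Wj mulr0 subr0.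
exists (fun a => if (a < m)%N then y a else q`_m / (W m)`_m).
rewrite big_ord_recr /= ltnn; apply/eqP; rewrite -subr_eq ey; apply/eqP.
by apply: eq_bigr => a _; rewrite ltn_ord.
Qed.

End Triangular.

Section Sylvester.
Variables (K : fieldType) (d n : nat) (f g : {poly K}).
Implicit Types (q : {poly K}).

Definition sylvester_row (b i : nat) : {poly K} :=
  if (i < b.+1 - d)%N then 'X^i * f else 'X^(i - (b.+1 - d)) * g.

(** The number of rows is a free parameter tied to [b] by an equation, so that the matrix can have
    the row type [b.+1 - T b] of the Pluecker coordinates without a cast. *)
Definition sylvester (b R : nat) : 'M[K]_(R, b.+1) :=
  \matrix_(i, j) (sylvester_row b i)`_j.

Hypothesis cp : coprime_pair d n f g.

Let sg : size g = n.+1. Proof. by case: cp. Qed.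
Let sf : (size f <= d.+1)%N. Proof. by case: cp. Qed.

Lemma size_pair_ideal b q : pair_ideal d n f g b q -> (size q <= b.+1)%N.
Proof.
move=> [u [t [-> su st]]]; apply: leq_trans (size_polyD _ _) _.
have bound (x y : {poly K}) c : (size x <= b.+1 - c)%N -> (size y <= c.+1)%N ->
    (size (x * y)%R <= b.+1)%N.
  have [->|x0] := eqVneq x 0; first by rewrite mul0r size_poly0.
  have : (0 < size x)%N by rewrite size_poly_gt0.
  move=> h1 h2 h3; apply: leq_trans (size_polyMleq _ _) _.
  by clear -h1 h2 h3; size_lia.
by rewrite geq_max (bound _ _ d) // (bound _ _ n) // sg.
Qed.

Lemma pair_ideal_le b b' q : (b <= b')%N ->
  pair_ideal d n f g b q -> pair_ideal d n f g b' q.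
Proof.
move=> bb' [u [t [-> su st]]]; exists u, t; split=> //; first lia.
lia.
Qed.

Lemma sylvester_mul b R (F : nat -> K) :
  (R = (b.+1 - d) + (b.+1 - n))%N ->
  (\row_(i < R) F i) *m sylvester b R =
  poly_rV (\poly_(i < b.+1 - d) F i * f +
           \poly_(i < b.+1 - n) F (i + (b.+1 - d))%N * g).
Proof.
move=> eR; apply/rowP => j; rewrite !mxE.
under eq_bigr do rewrite !mxE.
rewrite -(big_mkord xpredT (fun i => F i * (sylvester_row b i)`_j)).
rewrite eR (big_cat_nat (n := b.+1 - d)) ?leq_addr //= coefD; congr (_ + _).
  rewrite poly_def mulr_suml coef_sum big_mkord; apply: eq_bigr => i _.
  by rewrite -scalerAl coefZ /sylvester_row ltn_ord.
rewrite -{1}[(b.+1 - d)%N]add0n big_addn addKn big_mkord.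
rewrite poly_def mulr_suml coef_sum; apply: eq_bigr => i _.
by rewrite -scalerAl coefZ /sylvester_row ltnNge leq_addl /= addnK.
Qed.

Lemma sylvester_sub b R q : (R = (b.+1 - d) + (b.+1 - n))%N ->
  (size q <= b.+1)%N ->
  (poly_rV q <= sylvester b R)%MS <-> pair_ideal d n f g b q.
Proof.
move=> eR sq; split=> [/submxP[x ex]|[u [t [eq su st]]]].
  pose F i := oapp (x 0) 0 (insub i).
  have eF : x = \row_(i < R) F i by apply/rowP => i; rewrite mxE /F valK.
  exists (\poly_(i < b.+1 - d) F i), (\poly_(i < b.+1 - n) F (i + (b.+1 - d))%N).
  split; rewrite ?size_poly //.
  have h : pair_ideal d n f g b (\poly_(i < b.+1 - d) F i * f +
           \poly_(i < b.+1 - n) F (i + (b.+1 - d))%N * g).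
    by do 2!eexists; split; [reflexivity | apply: size_poly..].
  rewrite -(poly_rV_K sq) ex eF sylvester_mul // poly_rV_K //.
  exact: size_pair_ideal h.
pose F i := if (i < b.+1 - d)%N then u`_i else t`_(i - (b.+1 - d)).
apply/submxP; exists (\row_(i < R) F i); rewrite sylvester_mul // eq.
congr (poly_rV (_ * _ + _ * _)); apply/polyP => i; rewrite coef_poly.
  by rewrite /F; case: ltnP => // /(leq_trans su) h; rewrite nth_default.
rewrite /F (ltnNge (i + _)) leq_addl /= addnK.
by case: ltnP => // /(leq_trans st) h; rewrite nth_default.
Qed.

(** A relation between the rows is a syzygy of a coprime pair, hence a multiple of the one formed by
    [g] and [f], which first occurs in degree [d + n]. *)
Lemma sylvester_free b R : (R = (b.+1 - d) + (b.+1 - n))%N -> (b < d + n)%N ->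
  row_free (sylvester b R).
Proof.
move=> eR bdn; rewrite -kermx_eq0; apply/eqP/row_matrixP => r; rewrite row0.
set x := row r _; have xM : x *m sylvester b R = 0 by rewrite -row_mul mulmx_ker row0.
pose F i := oapp (x 0) 0 (insub i).
have eF : x = \row_(i < R) F i by apply/rowP => i; rewrite [RHS]mxE /F valK.
have cop : coprimep f g by case: cp.
have g0 : g != 0 by rewrite -size_poly_eq0 sg.
set u := \poly_(i < b.+1 - d) F i.
set t := \poly_(i < b.+1 - n) F (i + (b.+1 - d))%N.
have e : u * f + t * g = 0.
  have h : pair_ideal d n f g b (u * f + t * g).
    by exists u, t; rewrite !size_poly.
  rewrite -(poly_rV_K (size_pair_ideal h)) -(sylvester_mul F eR) -eF xM.
  exact: raddf0.
have u0 : u = 0.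
  apply/eqP/negPn/negP => u0; have /dvdp_leq : g %| u.
    rewrite -(@Gauss_dvdpl _ u f g) 1?coprimep_sym //.
    by rewrite (_ : u * f = - (t * g)) ?dvdpNr ?dvdp_mull //; apply/eqP; rewrite -addr_eq0 e.
  move=> /(_ u0); rewrite sg; have := size_poly (b.+1 - d) F; rewrite -/u.
  by clear -bdn; size_lia.
have t0 : t = 0.
  by move/eqP: e; rewrite u0 mul0r add0r mulf_eq0 (negPf g0) orbF => /eqP.
rewrite eF; apply/rowP => i; rewrite !mxE.
have := congr1 (fun p : {poly K} => p`_i) u0; rewrite coef_poly coef0.
case: ltnP => // hi _.
have := congr1 (fun p : {poly K} => p`_(i - (b.+1 - d))) t0.
rewrite coef_poly coef0 subnK //; case: ltnP => // h _; exfalso.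
by have := ltn_ord i; clear -eR hi h; lia.
Qed.

End Sylvester.

(** * A basis adapted to the Euclidean algorithm *)

Section Adapted.
Variable K : fieldType.
Implicit Types (s : seq ({poly K} * K)).

Definition euclid_chain (d n : nat) s : Prop :=
  [/\ euclid_steps s, euclid_deg s = n, (0 < d <= n)%N
    & (size (euclid_pair s).2 <= d.+1)%N].

Definition chain_node s : pred nat := fun x => x \in euclid_nodes s.

Definition chain_top (d n : nat) s : nat := if d \in euclid_nodes s then d else n.

Lemma chain_coprime_pair d n s : euclid_chain d n s ->
  coprime_pair d n (euclid_pair s).2 (euclid_pair s).1.
Proof.
move=> [sv sd dn sf]; have [sA sB] := size_euclid sv.
by split=> //; rewrite ?sA ?sd // 1?coprimep_sym ?euclid_coprime // -ltnS -sd -sA.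
Qed.

Lemma coprime_pair_chain d n f g : coprime_pair d n f g ->
  exists s, euclid_chain d n s /\ forall b q,
    pair_ideal d n (euclid_pair s).2 (euclid_pair s).1 b q <-> pair_ideal d n f g b q.
Proof.
move=> [dn cop sg sf sf'].
have [||s [c [sv c0 eg ef]]] := @euclidP K g f; first by rewrite sg ltnS.
  by rewrite coprimep_sym.
exists s; split.
  split=> //; last by rewrite -(size_scale _ c0) -ef.
  have [sA _] := size_euclid sv.
  by move: sg; rewrite eg size_scale // sA => -[].
move=> b q; split=> [[u [t [-> su st]]]|[u [t [-> su st]]]].
  exists (c^-1 *: u), (c^-1 *: t); rewrite !size_scale ?invr_neq0 //; split=> //.
  by rewrite eg ef -!scalerAl -!scalerAr !scalerA mulVf // !scale1r.
exists (c *: u), (c *: t); rewrite !size_scale //; split=> //.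
by rewrite eg ef -!scalerAl -!scalerAr.
Qed.

Section Chain.
Variables (d n : nat) (s : seq ({poly K} * K)).
Hypothesis hs : euclid_chain d n s.

Local Notation f := (euclid_pair s).2.
Local Notation g := (euclid_pair s).1.
Local Notation t := (chain_top d n s).
Local Notation node := (chain_node s).

(** Every node other than [n] is at most the degree of the first remainder [f], which is at most
    [d]. *)
Lemma chain_gap x : x \in euclid_nodes s -> (d <= x < n)%N -> x = d /\ size f = d.+1.
Proof.
case: hs; case: s => [|y s'] /=; first by move=> _ <- /andP[]; lia.
move=> /andP[_ sv'] sd _ sf; rewrite inE => /orP[/eqP ->|nx /andP[dx xn]].
  by move=> /andP[_]; rewrite sd ltnn.
have [sA _] := size_euclid sv'; have := euclid_nodes_le nx.
by rewrite sA in sf *; lia.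
Qed.

Lemma chain_node_set : node_set d n node t.
Proof.
have [sv sd dn sf] := hs; rewrite /chain_top; split=> //.
- exact: euclid_nodes0.
- by rewrite /chain_node; case: ifP => // _; rewrite -sd euclid_nodes_deg.
case: ifP => nd; [by left | right; split=> // x xdn].
by apply/negP => nx; have [e _] := chain_gap nx xdn; rewrite -e [_ \in _]nx in nd.
Qed.

(* The least degree in which [l ^ i w] lies in the ideal, [w] being the generator
   of degree [a] of a string. *)
Definition death (a : nat) : nat :=
  if (a < t)%N then (a + part d n node t a)%N else a.

(** For [a < t] the cofactor bounds of [euclid_remainder] are exactly those required for membership
    in degree [a + part a]; for [a >= t] multiples of a generator are taken, already in the ideal in
    degree [a]. *)
Lemma adapted_basis_exists : exists W : nat -> {poly K}, forall a,
  size (W a) = a.+1 /\ pair_ideal d n f g (death a) (W a).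
Proof.
have [sv sd dn sf] := hs; have hN := chain_node_set; have [_ n0 nt ht] := hN.
have [sA sB] := size_euclid sv; have /andP[dt tn] := node_set_top_ge hN.
have small (a : 'I_t) : exists x : {poly K},
    size x = a.+1 /\ pair_ideal d n f g (a + part d n node t a) x.
  have an : (a < euclid_deg s)%N by rewrite sd (leq_trans (ltn_ord a)).
  have [lo [hi [u [x [[nlo nhi lo_hi gap] [sx su sx']]]]]] := euclid_remainder sv an.
  exists (u * g + x * f); split=> //; exists x, u; rewrite addrC.
  have elo : lo_node node a = lo.
    apply: lo_node_eq => //; first by case/andP: lo_hi.
    by move=> y /gap /orP[//|]; lia.
  have hit : (hi <= t)%N.
    have := euclid_nodes_le nhi; rewrite sd.
    case: (ht) => [td _|[-> _] //]; have := gap _ nt; have := ltn_ord a; lia.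
  have ehi : hi_node node t a = hi.
    apply: hi_node_eq => //; first by case/andP: lo_hi => _ ->.
    by move=> y /gap /orP[|//]; lia.
  have lh := lo_hi_lt hN (ltn_ord a); rewrite elo ehi in lh.
  rewrite /part elo ehi; split=> //.
    by move: sx'; rewrite sA sd; clear -lh; size_lia.
  case: su => [->|]; first by rewrite size_poly0.
  by move: sf; clear -lh; size_lia.
have /fin_all_exists[W0 hW0] := small.
(* A generator of exact degree [t]. When [d] is a node and [d < n], [chain_gap] gives [f] full
   degree; in all other cases [t = n] and [g] serves. *)
pose top_gen := if d \in euclid_nodes s then (if (d < n)%N then f else g) else g.
exists (fun a => oapp W0 ('X^(a - t) * top_gen) (insub a)) => a.
rewrite /death; case: insubP => [i ai <-|]; first by rewrite ltn_ord; apply: hW0.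
rewrite -leqNgt => ta; rewrite ltnNge ta /= /top_gen.
have sg : size g = n.+1 by rewrite sA sd.
have use (x : {poly K}) c : size x = c.+1 -> c = t ->
    size ('X^(a - t) * x) = a.+1 /\ (size ('X^(a - t) : {poly K}) <= a.+1 - c)%N.
  move=> sx ct; rewrite size_polyXn mulrC size_mulXn ?sx; first by clear -ta ct; lia.
  by rewrite -size_poly_eq0 sx.
have gen_g : t = n -> size ('X^(a - t) * g) = a.+1 /\
    pair_ideal d n f g a ('X^(a - t) * g).
  move=> etn; have [-> ?] := use g n sg (esym etn); split=> //.
  by exists 0, ('X^(a - t)); rewrite mul0r add0r size_poly0.
case: ifP => nd; last by apply: gen_g; rewrite /chain_top nd.
case: ifP => dn'; last first.
  by apply: gen_g; rewrite /chain_top nd; case/andP: dn; lia.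
have [|_ sf'] := chain_gap nd; first by rewrite leqnn.
have etd : d = t by rewrite /chain_top nd.
have [-> ?] := use f d sf' etd; split=> //.
by exists ('X^(a - t)), 0; rewrite mul0r addr0 size_poly0.
Qed.

Section Basis.
Variable W : nat -> {poly K}.
Hypothesis hW : forall a, size (W a) = a.+1 /\ pair_ideal d n f g (death a) (W a).

Let sW a : size (W a) = a.+1. Proof. by case: (hW a). Qed.

Lemma deathE a b : (b < death a)%N && (a <= b)%N =
  (a < t)%N && (a <= b < a + part d n node t a)%N.
Proof.
rewrite /death; case: (ltnP a t) => h /=; first by rewrite andbC.
by apply/negP; lia.
Qed.

Lemma count_death b :
  (\sum_(a < b.+1) (b < death a) = hilbT d (n - d).+1 b)%N.
Proof.
have hN := chain_node_set.
rewrite -(count_alive_hilbT hN b).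
rewrite -(big_mkord xpredT (fun a => nat_of_bool (b < death a)%N)).
rewrite -(big_mkord xpredT (fun a => nat_of_bool (a <= b < a + part d n node t a)%N)).
have e a : (b < death a)%N && (a < b.+1)%N =
    (a <= b < a + part d n node t a)%N && (a < t)%N by rewrite ltnS deathE andbC.
transitivity (\sum_(0 <= a < b.+1 + t) ((b < death a) && (a < b.+1)))%N.
  rewrite [RHS](big_cat_nat (n := b.+1)) ?leq_addr //= [X in (_ = _ + X)%N]big1_seq ?addn0.
    by apply: eq_big_nat => a /andP[_ ->]; rewrite andbT.
  by move=> a; rewrite mem_index_iota => /andP[_ /andP[ba _]]; rewrite (ltnNge a b.+1) ba andbF.
rewrite addnC [LHS](big_cat_nat (n := t)) ?leq_addr //= [X in (_ + X)%N]big1_seq ?addn0.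
  by apply: eq_big_nat => a /andP[_ at_]; rewrite e at_ andbT.
by move=> a; rewrite mem_index_iota e => /andP[_ /andP[ta _]]; rewrite [(a < t)%N]ltnNge ta andbF.
Qed.

Lemma chain_sylvester_size b : (b < d + n)%N ->
  (b.+1 - hilbT d (n - d).+1 b = (b.+1 - d) + (b.+1 - n))%N.
Proof.
have [_ _ /andP[d0 dn] _] := hs => bdn; rewrite /hilbT /socle_degree.
by clear -d0 dn bdn; case: ltnP => ?; [|case: leqP => ?]; lia.
Qed.

(* Both sides have the same dimension: the [W a] with [death a <= b] are free and
   there are as many of them as rows in the Sylvester matrix. *)
Lemma adapted_basis_mem b (y : nat -> K) :
  pair_ideal d n f g b (\sum_(a < b.+1) y a *: W a) ->
  forall a, (a <= b)%N -> (b < death a)%N -> y a = 0.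
Proof.
have cp := chain_coprime_pair hs; have hN := chain_node_set.
move=> hy a ab bda; case: (ltnP b (d + n)) => bdn; last first.
  have /andP[] : (a < t)%N && (a <= b < a + part d n node t a)%N by rewrite -deathE bda.
  move=> at_; have := hi_node_gt node t a; rewrite /part; clear -bdn; lia.
(* The indices whose string is already dead in degree [b]. *)
pose L := [seq a <- iota 0 b.+1 | (death a <= b)%N].
pose R := (b.+1 - hilbT d (n - d).+1 b)%N.
have sL : size L = R.
  rewrite /R -count_death size_filter.
  have := count_predC (fun a => death a <= b)%N (iota 0 b.+1); rewrite size_iota.
  have -> : count (predC (fun a => death a <= b)%N) (iota 0 b.+1) =
      (\sum_(a < b.+1) (b < death a))%N.
    rewrite -sum1_count big_mkcond -(big_mkord xpredT (fun a => nat_of_bool (b < death a)%N)).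
    rewrite /index_iota subn0; apply: eq_bigr => c _ /=; rewrite -ltnNge.
    by case: ifP.
  by clear; lia.
have eR := chain_sylvester_size bdn; rewrite -/R in eR.
pose M : 'M[K]_(R, b.+1) := \matrix_i poly_rV (W (nth 0%N L i)).
have inL i : (i < R)%N -> (nth 0%N L i <= b)%N /\ (death (nth 0%N L i) <= b)%N.
  move=> iR; have : nth 0%N L i \in L by rewrite mem_nth ?sL.
  by rewrite mem_filter mem_iota => /andP[-> /andP[_ ?]].
have uL : uniq L by rewrite filter_uniq ?iota_uniq.
pose co (x : 'rV_R) (c : nat) : K := \sum_(i < R | nth 0%N L i == c) x 0 i.
have combo (x : 'rV_R) : x *m M = poly_rV
    (\sum_(c < b.+1) co x c *: W c).
  rewrite mulmx_sum_row linear_sum /=.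
  under [RHS]eq_bigr do rewrite linearZ /= /co scaler_suml.
  rewrite (exchange_big_dep xpredT) //=; apply: eq_bigr => i _; rewrite rowK.
  have [hb _] := inL _ (ltn_ord i).
  rewrite (big_pred1 (inord (nth 0%N L i))) ?inordK // => c.
  by apply/eqP/eqP => [e|->]; rewrite ?inordK //; apply: val_inj; rewrite /= inordK.
have sz (z : nat -> K) : (size (\sum_(c < b.+1) z c *: W c)%R <= b.+1)%N.
  apply: (leq_trans (size_sum _ _ _)); apply/bigmax_leqP => c _.
  by rewrite (leq_trans (size_scale_leq _ _)) // sW.
have freeM : row_free M.
  rewrite -kermx_eq0; apply/eqP/row_matrixP => r; rewrite row0; set x := row r _.
  have xM : x *m M = 0 by rewrite -row_mul mulmx_ker row0.
  have := combo x; rewrite xM => /esym e.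
  have e' : \sum_(c < b.+1) co x c *: W c = 0.
    rewrite -(poly_rV_K (sz (co x))) e.
    exact: raddf0.
  apply/rowP => i; rewrite [RHS]mxE; have [hb _] := inL _ (ltn_ord i).
  have := @triangular_free _ _ sW _ (co x) e'; move=> /(_ (nth 0%N L i)); rewrite ltnS => /(_ hb); rewrite /co.
  rewrite (big_pred1 i) // => i'; rewrite nth_uniq ?sL //; exact: val_eqE.
have subM : (M <= sylvester d f g b R)%MS.
  apply/row_subP => i; rewrite rowK; have [hb hd] := inL _ (ltn_ord i).
  apply/(sylvester_sub cp eR); first by rewrite sW.
  by have [_ h] := hW (nth 0%N L i); apply: pair_ideal_le h.
(* Equal ranks turn the inclusion into an equality: the ideal in degree [b] is spanned by the dead
   [W a], and triangularity then excludes any contribution of a live one. *)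
have eqM : (sylvester d f g b R <= M)%MS.
  rewrite -(geq_leqif (mxrank_leqif_sup subM)).
  by rewrite (eqP freeM) (eqP (sylvester_free cp eR bdn)).
have /(sylvester_sub cp eR (size_pair_ideal cp hy)) yS := hy.
have /submxP[x ex] := submx_trans yS eqM.
have e : \sum_(c < b.+1) (y c - co x c) *: W c = 0.
  under eq_bigr do rewrite scalerBl.
  rewrite sumrB -[X in X - _](poly_rV_K (sz y)) ex combo poly_rV_K ?subrr //.
have := @triangular_free _ _ sW _ (fun c => y c - co x c) e a.
rewrite ltnS => /(_ ab); rewrite /co.
rewrite big_pred0 ?subr0 // => i; apply/negP => /eqP ea.
by have [_] := inL _ (ltn_ord i); rewrite ea leqNgt bda.
Qed.

End Basis.
End Chain.
End Adapted.

Lemma quotient_basis_ord (K : fieldType) (I V : {mpoly K[2]} -> Prop)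
    (U : finType) (b : U -> {mpoly K[2]}) (m : nat) : #|U| = m ->
  quotient_basis I V b -> exists b' : 'I_m -> {mpoly K[2]}, quotient_basis I V b'.
Proof.
move=> <- [Vb free_b span_b]; exists (fun i => b (enum_val i)).
have sumE (c : 'I_#|U| -> K) :
    \sum_i c i *: b (enum_val i) = \sum_u c (enum_rank u) *: b u.
  rewrite [RHS](reindex (fun i : 'I_#|U| => enum_val i)) /=; last exact/onW_bij/enum_val_bij.
  by apply: eq_bigr => i _; rewrite enum_valK.
split=> [i|c|f Vf]; first exact: Vb.
  by rewrite sumE => /free_b c0 i; rewrite -[i]enum_valK c0.
have [c Ic] := span_b f Vf; exists (fun i => c (enum_val i)).
by rewrite sumE; under eq_bigr do rewrite enum_rankK.
Qed.

Lemma jordan_type_artinian (K : fieldType) (I : {mpoly K[2]} -> Prop) l P :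
  jordan_type I l P -> artinian I.
Proof.
move=> [_ [g [bP _]]]; have [b hb] := quotient_basis_ord erefl bP.
by exists #|{: {r : 'I_(size P) & 'I_(nth 0%N P r)}}|, b.
Qed.

(** * The graded quotient presented by a Euclidean chain *)

Section Structure.
Variables (K : fieldType) (v w : 'I_2 -> K).
Hypothesis det_vw : v ord0 * w ord_max - v ord_max * w ord0 = 1.
Variables (I : {mpoly K[2]} -> Prop) (d n : nat) (s : seq ({poly K} * K)).
Hypotheses (gI : graded_ideal I) (hs : euclid_chain d n s).
Hypothesis pI : presents v w I d n (euclid_pair s).2 (euclid_pair s).1.

Local Notation f := (euclid_pair s).2.
Local Notation g := (euclid_pair s).1.
Local Notation t := (chain_top d n s).
Local Notation node := (chain_node s).
Local Notation l := (linear_form v).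
Local Notation hmg := (homogenize v w).

Let idI : is_ideal I := proj1 gI.
Let hN : node_set d n node t := chain_node_set hs.
Let cp : coprime_pair d n f g := chain_coprime_pair hs.

Lemma homogenize_mem b (q : {poly K}) : (size q <= b.+1)%N ->
  I (hmg b q) <-> pair_ideal d n f g b q.
Proof. by move=> sq; rewrite (pI (homogenize_homog v w b q)) homK. Qed.

Section Basis.
Variable W : nat -> {poly K}.
Hypothesis hW : forall a,
  size (W a) = a.+1 /\ pair_ideal d n f g (death d n s a) (W a).

Let sW a : size (W a) = a.+1. Proof. by case: (hW a). Qed.

Lemma adapted_dead a b : (a <= b)%N -> (death d n s a <= b)%N -> I (hmg b (W a)).
Proof.
move=> ab db; apply/homogenize_mem; first by rewrite sW.
by have [_] := hW a; apply: pair_ideal_le.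
Qed.

Lemma adapted_shift a b : (a <= b)%N -> hmg b (W a) = l ^+ (b - a) * hmg a (W a).
Proof. by move=> ab; rewrite -homogenize_mulvn ?sW ?subnK. Qed.

Lemma adapted_degree_span b h : h \is b.-homog ->
  exists y : nat -> K, h = \sum_(a < b.+1) y a *: hmg b (W a).
Proof.
move=> hh; have [y ey] := triangular_span sW (size_dehom det_vw hh).
exists y; rewrite -{1}(dehomK det_vw hh) ey linear_sum.
by apply: eq_bigr => a _; rewrite linearZ.
Qed.

Lemma adapted_degree_free b (y : nat -> K) :
  I (\sum_(a < b.+1) y a *: hmg b (W a)) ->
  forall a, (a <= b)%N -> (b < death d n s a)%N -> y a = 0.
Proof.
have -> : \sum_(a < b.+1) y a *: hmg b (W a) = hmg b (\sum_(a < b.+1) y a *: W a).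
  by rewrite linear_sum; apply: eq_bigr => a _; rewrite linearZ.
rewrite homogenize_mem; first exact: (adapted_basis_mem hs hW).
apply: (leq_trans (size_sum _ _ _)); apply/bigmax_leqP => a _.
by rewrite (leq_trans (size_scale_leq _ _)) // sW.
Qed.

Lemma adapted_degree_basis b : basis_of_degree I b
  (fun a : {a : 'I_b.+1 | (b < death d n s a)%N} => hmg b (W (val a))).
Proof.
split=> [a|c Ic a|h hh]; first exact: homogenize_homog.
  pose y (a : nat) := oapp (fun i : 'I_b.+1 => oapp c 0 (insub i)) 0 (insub a).
  have yE (i : 'I_b.+1) : y i = oapp c 0 (insub i) by rewrite /y valK.
  have := @adapted_degree_free b y _ (val a) (ltn_ord (val a)) (valP a).
  rewrite yE valK /=; apply; move: Ic; congr (I _).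
  rewrite [RHS](bigID (fun i : 'I_b.+1 => b < death d n s i)%N) /= [X in _ + X]big1 ?addr0.
    rewrite (reindex_omap (val : {a : 'I_b.+1 | (b < death d n s a)%N} -> _) insub) /=
      => [|i hi]; last by rewrite insubT.
    apply: eq_big => i; first by rewrite (valP i) valK eqxx.
    by rewrite yE valK.
  by move=> i hi; rewrite yE insubF ?scale0r //; apply: negPf.
have [y ->] := adapted_degree_span hh; apply: span_mod_sum => // a _.
apply: span_modZ => //; case: (ltnP b (death d n s a)) => ha.
  exact: (@span_mod_mem _ _ idI _ _ (exist _ a ha : {a : 'I_b.+1 | (b < death d n s a)%N})).
by apply: span_mod_ideal => //; apply: adapted_dead; rewrite // -ltnS.
Qed.

Lemma adapted_jordan : jordan_type I l (node_partition d n node t).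
Proof.
split; first exact: node_partition_is_partition.
set P := node_partition d n node t.
have sP : size P = t by apply: size_node_partition.
have nP (r : 'I_(size P)) : death d n s r = (r + nth 0%N P r)%N.
  have rt : (r < t)%N by rewrite -sP.
  by rewrite /death rt nth_node_partition.
have shift (r : nat) m : l ^+ m * hmg r (W r) = hmg (r + m) (W r).
  by rewrite [RHS]adapted_shift ?leq_addr // addKn.
exists (fun r => hmg r (W r)); split; last first.
  move=> r; rewrite shift.
  by apply: adapted_dead; rewrite ?nP ?leq_addr.
have sig_eq (u u' : {r : 'I_(size P) & 'I_(nth 0%N P r)}) :
    tag u = tag u' :> nat -> (tag u + tagged u = tag u' + tagged u')%N -> u = u'.
  case: u u' => r m [r' m'] /= e; have {}e := val_inj e; subst r' => /addnI e.
  by congr existT; apply: val_inj.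
split=> // [c Ic u0|h _].
  pose b := (tag u0 + tagged u0)%N.
  (* At most one index of the basis has given starting degree and total degree; the sum reads off
     its coefficient, or 0, so that the component of degree [b] becomes a relation between the
     [W a]. *)
  pose y (a : nat) := \sum_(u : {r : 'I_(size P) & 'I_(nth 0%N P r)} |
    (tag u == a :> nat) && (tag u + tagged u == b)%N) c u.
  have Ib : I (\sum_(a < b.+1) y a *: hmg b (W a)).
    have -> : \sum_(a < b.+1) y a *: hmg b (W a) = pihomog mdeg b
        (\sum_(u : {r : 'I_(size P) & 'I_(nth 0%N P r)})
           c u *: (l ^+ tagged u * hmg (tag u) (W (tag u)))).
      rewrite linear_sum /=.
      rewrite (bigID (fun u : {r : 'I_(size P) & 'I_(nth 0%N P r)} =>
        tag u + tagged u == b)%N) /= [X in _ = _ + X]big1 ?addr0 => [|u hu].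
        under eq_bigr do rewrite /y scaler_suml.
        rewrite (exchange_big_dep (fun u : {r : 'I_(size P) & 'I_(nth 0%N P r)} =>
          tag u + tagged u == b)%N) /= => [|a u _ /andP[] //].
        apply: eq_bigr => u /eqP eu; have hu : (tag u < b.+1)%N by rewrite -eu ltnS leq_addr.
        rewrite (big_pred1 (Ordinal hu)) => [|a].
          rewrite linearZ /= shift pihomog_dE; first by rewrite eu.
          by rewrite -[X in X.-homog]eu homogenize_homog.
        by rewrite eu eqxx andbT; apply/eqP/eqP => [e|->]; first exact: val_inj.
      rewrite shift linearZ /= (pihomog_ne0 hu) ?scaler0 //.
      exact: homogenize_homog.
    by case: gI => _; apply.
  have := adapted_degree_free Ib; move=> /(_ (tag u0) (leq_addr _ _)).
  rewrite nP ltn_add2l ltn_ord /y => /(_ isT) <-.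
  rewrite (big_pred1 u0) // => u; apply/andP/eqP => [[/eqP e1 /eqP e2]|-> //].
  exact: sig_eq.
rewrite [h]pihomog_sum; apply: span_mod_sum => // i _.
have [y ->] := adapted_degree_span (pihomogP mdeg i h).
apply: span_mod_sum => // a _; apply: span_modZ => //.
have ai : (a <= i)%N by rewrite -ltnS.
case: (ltnP i (death d n s a)) => ha; last first.
  by apply: span_mod_ideal => //; apply: adapted_dead.
have aP : (a < size P)%N.
  by rewrite sP; move: ha; rewrite /death; case: ifP => // _; rewrite ltnNge ai.
have hm : (i - a < nth 0%N P (Ordinal aP))%N.
  by move: ha; rewrite (nP (Ordinal aP)) /=; lia.
have := @span_mod_mem _ _ idI _
  (fun u : {r : 'I_(size P) & 'I_(nth 0%N P r)} => l ^+ tagged u * hmg (tag u) (W (tag u)))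
  (Tagged (fun r : 'I_(size P) => 'I_(nth 0%N P r)) (Ordinal hm)).
by rewrite /= -adapted_shift.
Qed.

(** If [i + 1] is a node, every gap starting at or below [i] ends by [i + 1], and all strings alive
    in degree [i] survive degree [d + n - 2 - i]. Otherwise the gap around [i + 1] produces a string
    that dies too early. *)
Lemma adapted_degenerate i : (i < d)%N ->
  (exists beta, [/\ beta \is i.-homog, ~ I beta & I (l ^+ (d + n - 2 - 2 * i) * beta)])
  <-> ~~ node i.+1.
Proof.
move=> id; have [/andP[d0 dn] n0 nt _] := hN; have /andP[dt _] := node_set_top_ge hN.
have it : (i < t)%N := leq_trans id dt.
have ej : (d + n - 2 - 2 * i + i = d + n - 2 - i)%N by clear -id dn; lia.
have sle (q : {poly K}) : (size q <= i.+1)%N -> (size q <= (d + n - 2 - i).+1)%N.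
  by move=> sq; apply: leq_trans sq _; clear -id dn; lia.
have [_ nh] := hi_nodeP nt it.
split=> [[beta [hb nIb Ib]]|ni].
  apply/negP => ni; case: nIb; have [y ey] := triangular_span sW (size_dehom det_vw hb).
  have sb := size_dehom det_vw hb.
  move: Ib; rewrite -(dehomK det_vw hb) -homogenize_mulvn // ej.
  rewrite homogenize_mem ?sle // => Ib.
  pose y' a := if (a < i.+1)%N then y a else 0.
  have e : dehom v w beta = \sum_(a < (d + n - 2 - i).+1) y' a *: W a.
    rewrite ey -(big_mkord xpredT (fun a => y a *: W a)).
    rewrite -(big_mkord xpredT (fun a => y' a *: W a)).
    rewrite [RHS](big_cat_nat (n := i.+1)) //=; last by clear -id dn; lia.
    rewrite [X in _ + X]big1_seq ?addr0 => [|a].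
      by apply: eq_big_nat => a /andP[_ ai]; rewrite /y' ai.
    rewrite mem_index_iota => /andP[_ /andP[ia _]].
    by rewrite /y' ltnNge ia scale0r.
  rewrite e in Ib; suff -> : dehom v w beta = 0 by rewrite raddf0; apply: ideal0.
  rewrite ey big1 // => a _; have ai := ltn_ord a.
  have := adapted_basis_mem hs hW Ib; move=> /(_ a); rewrite /y' ai => -> //.
  - by rewrite scale0r.
  - by clear -id dn ai; lia.
  rewrite /death; have at_ : (a < t)%N by rewrite (leq_trans ai).
  rewrite at_ /part; have := lo_node_le node a.
  have : (hi_node node t a <= i.+1)%N by apply: hi_node_min; rewrite // (leq_trans ai).
  by clear -id dn ai; lia.
(* The remainder at the lower end of the gap: it dies in degree [d + n - hi] with [hi >= i + 2]. *)
set a := lo_node node i; have ai : (a <= i)%N by apply: lo_node_le.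
have at_ : (a < t)%N := leq_ltn_trans ai it.
exists (hmg i (W a)); split; first exact: homogenize_homog.
  rewrite homogenize_mem ?sW // => -[u [x [e su sx]]].
  have u0 : u = 0.
    by apply/eqP; rewrite -size_poly_leq0 (leq_trans su) //; clear -id; lia.
  have x0 : x = 0.
    by apply/eqP; rewrite -size_poly_leq0 (leq_trans sx) //; clear -id dn; lia.
  by have := sW a; rewrite e u0 x0 !mul0r addr0 size_poly0.
rewrite -homogenize_mulvn ?sW // ej homogenize_mem ?sle ?sW //.
have [_] := hW a; apply: pair_ideal_le => //; rewrite /death at_ /part.
have na : node a by apply: lo_nodeP.
have -> : lo_node node a = a by apply: lo_node_eq.
have hia : (hi_node node t i <= hi_node node t a)%N.
  have [na' hat] := hi_nodeP nt at_; apply: hi_node_min => //.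
  rewrite ltnNge; apply/negP => hi_le.
  by have := lo_node_max na' hi_le; rewrite -/a leqNgt hi_node_gt.
have : hi_node node t i != i.+1.
  by apply: contraNneq ni => <-; have [] := hi_nodeP nt it.
have := hi_node_gt node t i; clear -id dn hia ai; lia.
Qed.

End Basis.

Lemma presented_hilbert : hilbert_function I (hilbT d (n - d).+1).
Proof.
move=> b; have [W hW] := adapted_basis_exists hs.
apply: quotient_basis_ord (adapted_degree_basis hW b).
rewrite card_sig -(count_death hs b) -sum1_card big_mkcond.
by apply: eq_bigr => a _; rewrite inE; case: ifP.
Qed.

Lemma presented_jordan : jordan_type I l (node_partition d n node t).
Proof. by have [W hW] := adapted_basis_exists hs; apply: adapted_jordan hW. Qed.

Lemma presented_degenerate i : (i < d)%N ->
  (exists beta, [/\ beta \is i.-homog, ~ I beta & I (l ^+ (d + n - 2 - 2 * i) * beta)])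
  <-> ~~ node i.+1.
Proof. by move=> id; have [W hW] := adapted_basis_exists hs; exact: (adapted_degenerate hW id). Qed.

End Structure.

(** * Polynomial families and the splitting of a node *)

Section PolynomialFamilies.
Variable K : fieldType.
Implicit Types (phi psi : K -> K) (F G : K -> {poly K}).

(** Families are plain functions of the parameter, so that their values are actual pairs and frames
    over [K]; the polynomial expression serves for specialization at 0. *)
Definition poly_fun phi : Prop := exists p : {poly K}, forall s, phi s = p.[s].

Lemma poly_fun_cst c : poly_fun (fun _ => c).
Proof. by exists c%:P => s; rewrite hornerC. Qed.

Lemma poly_fun_id : poly_fun id.
Proof. by exists 'X => s; rewrite hornerX. Qed.

Lemma poly_funD phi psi : poly_fun phi -> poly_fun psi ->
  poly_fun (fun s => phi s + psi s).
Proof. by move=> [p ep] [q eq]; exists (p + q) => s; rewrite hornerD ep eq. Qed.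

Lemma poly_funM phi psi : poly_fun phi -> poly_fun psi ->
  poly_fun (fun s => phi s * psi s).
Proof. by move=> [p ep] [q eq]; exists (p * q) => s; rewrite hornerM ep eq. Qed.

Lemma poly_funX phi m : poly_fun phi -> poly_fun (fun s => phi s ^+ m).
Proof. by move=> [p ep]; exists (p ^+ m) => s; rewrite horner_exp ep. Qed.

Lemma poly_fun_sum (J : Type) (r : seq J) (Q : pred J) (phi : J -> K -> K) :
  (forall i, poly_fun (phi i)) -> poly_fun (fun s => \sum_(i <- r | Q i) phi i s).
Proof.
move=> h; elim: r => [|i r IH].
  by exists 0 => s; rewrite big_nil horner0.
case Qi: (Q i); last by case: IH => p ep; exists p => s; rewrite big_cons Qi ep.
have [p ep] := poly_funD (h i) IH.
by exists p => s; rewrite big_cons Qi ep.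
Qed.

Lemma poly_fun_prod (J : Type) (r : seq J) (Q : pred J) (phi : J -> K -> K) :
  (forall i, poly_fun (phi i)) -> poly_fun (fun s => \prod_(i <- r | Q i) phi i s).
Proof.
move=> h; elim: r => [|i r IH].
  by exists 1 => s; rewrite big_nil hornerC.
case Qi: (Q i); last by case: IH => p ep; exists p => s; rewrite big_cons Qi ep.
have [p ep] := poly_funM (h i) IH.
by exists p => s; rewrite big_cons Qi ep.
Qed.

Lemma poly_fun_ext phi psi : phi =1 psi -> poly_fun phi -> poly_fun psi.
Proof. by move=> e [p ep]; exists p => s; rewrite -e. Qed.

Lemma poly_fun_det m (M : K -> 'M[K]_m) :
  (forall i j, poly_fun (fun s => M s i j)) -> poly_fun (fun s => \det (M s)).
Proof.
move=> h; apply: poly_fun_sum => sg; apply: poly_funM; first exact: poly_fun_cst.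
by apply: poly_fun_prod => i; apply: h.
Qed.

Lemma poly_fun_meval m (p : {mpoly K[m]}) (x : K -> 'I_m -> K) :
  (forall i, poly_fun (fun s => x s i)) -> poly_fun (fun s => p.@[x s]).
Proof.
move=> h; apply: (@poly_fun_ext (fun s =>
  \sum_(mm <- msupp p) p@_mm * \prod_i x s i ^+ mm i)) => [s|]; first by rewrite mevalE.
apply: poly_fun_sum => mm; apply: poly_funM; first exact: poly_fun_cst.
by apply: poly_fun_prod => i; apply: poly_funX.
Qed.

Definition poly_family F : Prop := forall i, poly_fun (fun s => (F s)`_i).

Lemma poly_family_cst p : poly_family (fun _ => p).
Proof. by move=> i; apply: poly_fun_cst. Qed.

Lemma poly_familyD F G : poly_family F -> poly_family G ->
  poly_family (fun s => F s + G s).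
Proof.
move=> hF hG i; apply: (poly_fun_ext _ (poly_funD (hF i) (hG i))) => s.
by rewrite coefD.
Qed.

Lemma poly_familyM F G : poly_family F -> poly_family G ->
  poly_family (fun s => F s * G s).
Proof.
move=> hF hG i; apply: (@poly_fun_ext (fun s => \sum_(j < i.+1) (F s)`_j * (G s)`_(i - j))).
  by move=> s; rewrite coefM.
by apply: poly_fun_sum => j; apply: poly_funM.
Qed.

Lemma poly_familyZ phi F : poly_fun phi -> poly_family F ->
  poly_family (fun s => phi s *: F s).
Proof.
move=> hp hF i; apply: (poly_fun_ext _ (poly_funM hp (hF i))) => s.
by rewrite coefZ.
Qed.

Lemma poly_family_horner (P : {poly {poly K}}) : poly_family (fun s => P.[s%:P]).
Proof.
move=> i; exists (\sum_(j < size P) (P`_j)`_i *: 'X^j) => s.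
rewrite horner_coef coef_sum horner_sum; apply: eq_bigr => j _.
by rewrite -polyC_exp mulrC coefCM hornerZ hornerXn mulrC.
Qed.

Lemma coef_comp_scale (c : K) (p : {poly K}) i : (p \Po (c *: 'X))`_i = c ^+ i * p`_i.
Proof.
rewrite comp_polyE coef_sum; under eq_bigr do rewrite exprZn !coefZ coefXn.
case: (ltnP i (size p)) => hi.
  rewrite (bigD1 (Ordinal hi)) //= eqxx mulr1 big1 ?addr0; first exact: mulrC.
  by move=> j ne; rewrite (_ : (i == j) = false) ?mulr0 //; apply/eqP => e;
     case/eqP: ne; apply: val_inj.
rewrite nth_default // mulr0 big1 // => j _.
by rewrite (_ : (i == j) = false) ?mulr0 //; apply/eqP; have := ltn_ord j; lia.
Qed.

Lemma poly_family_scale F : poly_family F -> poly_family (fun s => F s \Po (s *: 'X)).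
Proof.
move=> hF i; apply: (poly_fun_ext _ (poly_funM (poly_funX i poly_fun_id) (hF i))) => s.
by rewrite coef_comp_scale.
Qed.

End PolynomialFamilies.

Definition generically (K : fieldType) (Q : K -> Prop) : Prop :=
  exists2 e : {poly K}, e != 0 & forall s, e.[s] != 0 -> Q s.

Lemma generically_and (K : fieldType) (Q Q' : K -> Prop) :
  generically Q -> generically Q' -> generically (fun s => Q s /\ Q' s).
Proof.
move=> [e e0 h] [e' e0' h']; exists (e * e'); first by rewrite mulf_neq0.
by move=> s; rewrite hornerM mulf_eq0 negb_or => /andP[/h ? /h'].
Qed.

(** An algebraically closed field is infinite, so a polynomial vanishing off the zeros of another
    nonzero one is 0. This is how closed conditions pass to the limit. *)
Lemma poly_fun_eq0 (K : closedFieldType) (phi : K -> K) :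
  poly_fun phi -> generically (fun s => phi s = 0) -> phi 0 = 0.
Proof.
move=> [p ep] [e e0 he]; rewrite ep; have [->|p0] := eqVneq p 0; first by rewrite horner0.
have /closed_nonrootP[s] : p * e != 0 by rewrite mulf_neq0.
rewrite rootM negb_or /root => /andP[ps /he es].
by rewrite -ep es eqxx in ps.
Qed.

(** * Hensel lifting with bounded degrees *)

Section Hensel.
Variable K : fieldType.
Implicit Types (N U R B : {poly {poly K}}).

(** [y] is reduced modulo [p] and [x] absorbs the quotient; the size of [x] is then read off from
    [p * x = r - q * y]. *)
Lemma bezout_sized (p q r : {poly K}) m1 m2 : coprimep p q ->
  size p = m2.+1 -> size q = m1.+1 -> (size r <= (m1 + m2).+1)%N ->
  exists x y : {poly K}, [/\ p * x + q * y = r, (size x <= m1.+1)%N & (size y <= m2.+1)%N].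
Proof.
move=> cop sp sq sr; have p0 : p != 0 by rewrite -size_poly_eq0 sp.
have /Bezout_eq1_coprimepP[[a b] /= e] := cop.
pose y := (r * b) %% p; pose x := r * a + ((r * b) %/ p) * q.
have exy : p * x + q * y = r.
  rewrite /x /y -[RHS]mulr1 -e; have := divp_eq (r * b) p.
  set u := _ %/ _; set z := _ %% _ => eb.
  have -> : r * (a * p + b * q) = r * a * p + r * b * q by ring.
  by rewrite [r * b]eb; ring.
have sy : (size y <= m2)%N by rewrite -ltnS -sp ltn_modp.
exists x, y; split=> //; last exact: leqW.
have [->|x0] := eqVneq x 0; first by rewrite size_poly0.
have : (size (p * x)%R <= (m1 + m2).+1)%N.
  have -> : p * x = r - q * y by rewrite -exy addrK.
  rewrite (leq_trans (size_polyD _ _)) // size_polyN geq_max sr /=.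
  by apply: leq_trans (size_polyMleq _ _) _; rewrite sq; clear -sy; size_lia.
rewrite size_mul // sp; clear; size_lia.
Qed.

Lemma divX_poly B : B`_0 = 0 -> exists R, B = 'X * R.
Proof.
move=> B0; exists (drop_poly 1 B); rewrite -{1}(poly_take_drop 1 B) mulrC.
have -> : take_poly 1 B = 0; last by rewrite add0r.
by apply/polyP => i; rewrite coef_take_poly coef0; case: i => [|i].
Qed.

Lemma hensel_lift B (N0 U0 : {poly K}) m1 m2 : coprimep N0 U0 ->
  size N0 = m2.+1 -> size U0 = m1.+1 -> B`_0 = N0 * U0 ->
  (forall i, (size (B`_i)%R <= (m1 + m2).+1)%N) ->
  forall m, exists N U R, [/\ N`_0 = N0, U`_0 = U0,
    (forall i, (size (N`_i)%R <= m2.+1)%N), (forall i, (size (U`_i)%R <= m1.+1)%N)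
    & N * U = B + 'X^(m.+1) * R].
Proof.
move=> cop sN sU B0 sB; elim=> [|m [N [U [R [eN eU sN' sU' e]]]]].
  have [|R eR] := @divX_poly ((N0 * U0)%:P - B); first by rewrite coefB coefC B0 subrr.
  exists N0%:P, U0%:P, R; rewrite !coefC; split=> //.
  - by move=> i; rewrite coefC; case: ifP => _; rewrite ?sN ?size_poly0.
  - by move=> i; rewrite coefC; case: ifP => _; rewrite ?sU ?size_poly0.
  - by rewrite expr1 -eR addrC subrK polyCM.
have sR : (size (R`_0)%R <= (m1 + m2).+1)%N.
  have -> : R`_0 = (N * U - B)`_m.+1.
    by rewrite e addrC addKr mulrC coefMXn ltnn subnn.
  rewrite coefB (leq_trans (size_polyD _ _)) // size_polyN geq_max sB andbT coefM.
  apply: (leq_trans (size_sum _ _ _)); apply/bigmax_leqP => i _.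
  apply: leq_trans (size_polyMleq _ _) _.
  have aux (x y : nat) : (x <= m2.+1 -> y <= m1.+1 -> (x + y).-1 <= (m1 + m2).+1)%N.
    by clear; lia.
  exact: aux (sN' _) (sU' _).
have [|x [y [exy sx sy]]] := @bezout_sized N0 U0 (- R`_0) m1 m2 cop sN sU.
  by rewrite size_polyN.
have [|R' eR'] := @divX_poly (R + N * x%:P + U * y%:P + 'X^(m.+1) * (x * y)%:P).
  rewrite !coefD !coefMC eN eU coefXn mul0r addr0 -addrA exy.
  exact: subrr.
exists (N + 'X^(m.+1) * y%:P), (U + 'X^(m.+1) * x%:P), R'.
have coefY i (z : {poly K}) : ('X^(m.+1) * z%:P)`_i = if i == m.+1 then z else 0.
  by rewrite coefMC coefXn; case: eqP; rewrite ?mul1r ?mul0r.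
split.
- by rewrite coefD coefY addr0.
- by rewrite coefD coefY addr0.
- move=> i; rewrite coefD coefY (leq_trans (size_polyD _ _)) // geq_max sN'.
  by case: ifP => _; rewrite ?size_poly0 ?sy.
- move=> i; rewrite coefD coefY (leq_trans (size_polyD _ _)) // geq_max sU'.
  by case: ifP => _; rewrite ?size_poly0 ?sx.
rewrite ['X^(m.+2)]exprSr -mulrA -eR' polyCM; move: e.
set Z := 'X^(m.+1) => e; have -> : (N + Z * y%:P) * (U + Z * x%:P) =
   N * U + Z * (N * x%:P + U * y%:P + Z * (x%:P * y%:P)) by ring.
by rewrite e; ring.
Qed.

End Hensel.

(** * Factoring a deformed quotient *)

Section Splitting.
Variable K : closedFieldType.
Hypothesis charK0 : [pchar K] =i pred0.

(** In characteristic 0 the binomial is separable, so any distribution of its roots into two groups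
    gives coprime factors. *)
Lemma binomial_factor (c : K) m1 m2 : c != 0 -> (0 < m1 + m2)%N ->
  exists N0 U0 : {poly K}, [/\ coprimep N0 U0, size N0 = m2.+1, size U0 = m1.+1,
    N0`_0 = 1 /\ U0`_0 = 1 & N0 * U0 = 1 + c *: 'X^(m1 + m2)].
Proof.
move=> c0 m0; set q := (m1 + m2)%N; pose p : {poly K} := 1 + c *: 'X^q.
have q0 : q%:R != 0 :> K by rewrite (pcharf0P K).1 // -lt0n.
have sp : size p = q.+1.
  by rewrite /p addrC size_polyDl size_scale // size_polyXn // size_poly1 ltnS.
(* An explicit Bezout identity for [p] and its derivative; through the product rule it becomes one
   for any two complementary factors. *)
have bez : p - (q%:R^-1 *: 'X) * p^`() = 1.
  rewrite /p derivD derivC derivZ derivXn add0r -scaler_nat -scalerAl -!scalerAr.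
  by rewrite -exprS prednK // !scalerA mulrCA mulVf // mulr1 addrK.
have [rs ers] := closed_field_poly_normal p.
have lc0 : lead_coef p != 0 by rewrite lead_coef_eq0 -size_poly_eq0 sp.
have srs : size rs = q.
  by apply: succn_inj; rewrite -sp ers size_scale // size_prod_XsubC.
pose N1 : {poly K} := \prod_(z <- take m2 rs) ('X - z%:P).
pose U1 : {poly K} := lead_coef p *: \prod_(z <- drop m2 rs) ('X - z%:P).
have eNU : N1 * U1 = p.
  by rewrite /U1 -scalerAr -big_cat cat_take_drop -ers.
have sN1 : size N1 = m2.+1.
  by rewrite size_prod_XsubC size_takel // srs leq_addl.
have sU1 : size U1 = m1.+1.
  by rewrite size_scale // size_prod_XsubC size_drop srs addnK.
have v0 : N1`_0 * U1`_0 = 1.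
  have := congr1 (fun p : {poly K} => p.[0]) eNU.
  rewrite hornerM -!horner_coef0 => ->; rewrite /p hornerD hornerC hornerZ hornerXn.
  by rewrite expr0n -[q == _]negbK -lt0n m0 mulr0 addr0.
have ne0 : N1`_0 != 0.
  by apply: contra_eq_neq v0 => ->; rewrite mul0r eq_sym oner_eq0.
(* Scaling both constant terms to 1 is what makes the factors tend to 1. *)
exists ((N1`_0)^-1 *: N1), (N1`_0 *: U1); split.
- rewrite coprimepZl ?invr_neq0 // coprimepZr //.
  apply/Bezout_eq1_coprimepP.
  exists (U1 - (q%:R^-1 *: 'X) * U1^`(), - (q%:R^-1 *: 'X) * N1^`()) => /=.
  by rewrite -[RHS]bez -eNU derivM; ring.
- by rewrite size_scale ?invr_neq0.
- by rewrite size_scale.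
- by split; rewrite coefZ ?v0 ?mulVf.
by rewrite -scalerAl -scalerAr scalerA mulVf // scale1r.
Qed.

(* Scaling [z] by [s] makes the roots of [1 + s ^ q a] converge as [s] goes to
   [0], so that [1 + s ^ q D] factors for some [D] tending to [a]; both factors
   tend to [1]. *)
Lemma splitting_family (a : {poly K}) m1 m2 : size a = (m1 + m2).+1 ->
  (0 < m1 + m2)%N ->
  exists N U D : K -> {poly K},
    [/\ poly_family N, poly_family U & poly_family D] /\
    [/\ N 0 = 1, U 0 = 1, D 0 = a,
        forall s, N s * U s = 1 + s ^+ (m1 + m2) *: D s
      & generically (fun s => [/\ s != 0, size (N s) = m2.+1 & size (U s) = m1.+1])].
Proof.
set q := (m1 + m2)%N => sa q0.
have aq : a`_q != 0.
  by have := lead_coef_eq0 a; rewrite /lead_coef sa /= => ->; rewrite -size_poly_eq0 sa.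
have [N0 [U0 [cop sN0 sU0 [N00 U00] eNU]]] := binomial_factor aq q0.
(* This is [1 + s^q a(z / s)], polynomial in [s] because [a] has degree [q]; at [s = 0] the binomial
   [1 + a_q z^q] remains. *)
pose B : {poly {poly K}} := 1 + \sum_(i < q.+1) (a`_i *: 'X^i)%:P * 'X^(q - i).
have Bcoef k : B`_k = (k == 0%N)%:R + \sum_(i < q.+1) (if (q - i == k)%N then a`_i *: 'X^i else 0).
  rewrite coefD coef1 coef_sum; congr (_ + _); apply: eq_bigr => i _.
  by rewrite coefCM coefXn eq_sym; case: eqP; rewrite ?mulr1 ?mulr0.
have B0 : B`_0 = N0 * U0.
  rewrite Bcoef eNU; congr (_ + _); rewrite big_ord_recr /= subnn eqxx big1 ?add0r //.
  by move=> i _; rewrite (_ : (q - i == 0)%N = false) //; have := ltn_ord i; lia.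
have sB k : (size (B`_k)%R <= q.+1)%N.
  rewrite Bcoef (leq_trans (size_polyD _ _)) // geq_max; apply/andP; split.
    by case: eqP => _; rewrite ?size_poly1 ?size_poly0.
  apply: (leq_trans (size_sum _ _ _)); apply/bigmax_leqP => i _.
  case: ifP => _; last by rewrite size_poly0.
  by rewrite (leq_trans (size_scale_leq _ _)) // size_polyXn.
(* Lifting to order [q] leaves an error divisible by [s^(q+1)], one power more than [s^q], so that
   [D] tends to [a]. *)
have [N [U [R [eN eU sN sU e]]]] := hensel_lift cop sN0 sU0 B0 sB q.
have evalB s : B.[s%:P] \Po (s *: 'X) = 1 + s ^+ q *: a.
  rewrite hornerD hornerC horner_sum comp_polyD comp_polyC raddf_sum /=; congr (_ + _).
  rewrite -[a in RHS]coefK sa poly_def scaler_sumr; apply: eq_bigr => i _.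
  rewrite hornerM hornerC hornerXn -polyC_exp comp_polyM comp_polyZ comp_Xn_poly comp_polyC.
  rewrite exprZn mulrC mul_polyC !scalerA; congr (_ *: _).
  have <- : s ^+ (q - i) * s ^+ i = s ^+ q by rewrite -exprD subnK // -ltnS.
  ring.
pose Ns s := N.[s%:P] \Po (s *: 'X); pose Us s := U.[s%:P] \Po (s *: 'X).
pose Ds s := a + s *: (R.[s%:P] \Po (s *: 'X)).
exists Ns, Us, Ds; split; first split.
- exact/poly_family_scale/poly_family_horner.
- exact/poly_family_scale/poly_family_horner.
- apply: poly_familyD; first exact: poly_family_cst.
  apply: poly_familyZ; first exact: poly_fun_id.
  exact/poly_family_scale/poly_family_horner.
have comp0 (P : {poly K}) : P \Po (0 *: 'X) = (P`_0)%:P.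
  by rewrite scale0r comp_poly0r.
split.
- by rewrite /Ns comp0 horner_coef0 eN N00.
- by rewrite /Us comp0 horner_coef0 eU U00.
- by rewrite /Ds scale0r addr0.
- move=> s; rewrite /Ns /Us /Ds -comp_polyM -hornerM e hornerD comp_polyD evalB.
  rewrite scalerDr addrA; congr (_ + _); rewrite hornerM hornerXn comp_polyM.
  by rewrite -polyC_exp comp_polyC mul_polyC exprSr scalerA.
have size_gen (P : {poly {poly K}}) (P0 : {poly K}) m : P`_0 = P0 -> size P0 = m.+1 ->
    (forall i, (size (P`_i)%R <= m.+1)%N) ->
    generically (fun s => s != 0 /\ size (P.[s%:P] \Po (s *: 'X)) = m.+1).
  move=> eP sP0 sP.
  have [p ep] := poly_family_horner P m.
  have p0 : p != 0.
    apply: contraTneq (isT) => p0; have := ep 0; rewrite p0 horner0 horner_coef0 eP => e0.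
    have := lead_coef_eq0 P0; rewrite /lead_coef sP0 /= e0 eqxx => /esym.
    by rewrite -size_poly_eq0 sP0.
  exists (p * 'X); first by rewrite mulf_neq0 ?polyX_eq0.
  move=> s; rewrite hornerM hornerX mulf_eq0 negb_or -ep => /andP[cm s0]; split=> //.
  rewrite size_comp_poly2; last by rewrite size_scale ?size_polyX.
  apply/eqP; rewrite eqn_leq; apply/andP; split.
    rewrite horner_coef; apply: (leq_trans (size_sum _ _ _)); apply/bigmax_leqP => i _.
    by rewrite -polyC_exp mulrC mul_polyC (leq_trans (size_scale_leq _ _)).
  by rewrite ltnNge; apply: contra cm => h; rewrite nth_default.
have [e1 e10 h1] := generically_and (size_gen N N0 m2 eN sN0 sN) (size_gen U U0 m1 eU sU0 sU).
by exists e1 => // s /h1[[? ?] [_ ?]].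
Qed.

End Splitting.

Lemma euclid_deform (K : closedFieldType) (charK0 : [pchar K] =i pred0)
    (d n x : nat) (s : seq ({poly K} * K)) :
  euclid_chain d n s -> x \notin euclid_nodes s -> (x <= d)%N ->
  exists F G : K -> {poly K},
    [/\ poly_family F, poly_family G, F 0 = (euclid_pair s).2, G 0 = (euclid_pair s).1
      & generically (fun tau => exists s',
          [/\ euclid_chain d n s', euclid_pair s' = (G tau, F tau)
            & forall y, (y \in euclid_nodes s') = (y \in euclid_nodes s) || (y == x)])].
Proof.
move=> [sv sd dn sf] nx xd.
have xn : (x < euclid_deg s)%N.
  have xn : (x <= euclid_deg s)%N by rewrite sd; case/andP: dn => _; apply: leq_trans.
  rewrite ltn_neqAle xn andbT; apply: contra nx => /eqP ->.
  exact: euclid_nodes_deg.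
have [pre [q [c [post [es /andP[px xq]]]]]] := euclid_split xn nx.
move: sv; rewrite es /euclid_steps all_cat /= => /andP[vpre /andP[/andP[sq c0] vpost]].
(* The lower of the two new quotients gets the degree that puts the inserted node at [x]. *)
pose m2 := (x - euclid_deg post)%N; pose m1 := ((size q).-1 - m2)%N.
have m20 : (0 < m2)%N by rewrite /m2 subn_gt0.
have m10 : (0 < m1)%N by rewrite /m1 /m2; clear -px xq; size_lia.
have sqm : size q = (m1 + m2).+1 by rewrite /m1 /m2; clear -px xq; size_lia.
have m0 : (0 < m1 + m2)%N by rewrite addn_gt0 m10.
have [N [U [D [[hN hU hD] [N0 U0 D0 eNU gen]]]]] := splitting_family charK0 sqm m0.
set Q := (m1 + m2)%N in eNU sqm m0.
pose B := (euclid_pair post).1; pose C := (euclid_pair post).2.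
(* Over [(B, C)] these steps compose to [(D B + c U C, N B + tau^Q c C)]: the poles cancel by
   [N U = 1 + tau^Q D]. At [tau = 0] this is the pair given by the old step [(q, c)]. *)
pose s' tau := ((tau ^+ Q)^-1 *: U tau, - (tau ^+ Q)^-1) :: (N tau, tau ^+ Q * c) :: post.
have [G [F [hG hF e0 egen]]] : exists G F : K -> {poly K},
    [/\ poly_family G, poly_family F, euclid_pair (pre ++ (q, c) :: post) = (G 0, F 0)
      & forall tau, tau != 0 -> euclid_pair (pre ++ s' tau) = (G tau, F tau)].
  elim: (pre) => [|[a e] pre' [G [F [hG hF e0 egen]]]] /=.
    exists (fun tau => D tau * B + U tau * (c *: C)).
    exists (fun tau => N tau * B + (tau ^+ Q * c) *: C); split.
    - by apply: poly_familyD; apply: poly_familyM => //; apply: poly_family_cst.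
    - apply: poly_familyD; first by apply: poly_familyM => //; apply: poly_family_cst.
      apply: poly_familyZ; last exact: poly_family_cst.
      by apply: poly_funM; [apply/poly_funX/poly_fun_id | apply: poly_fun_cst].
    - rewrite D0 U0 N0 !mul1r expr0n (_ : Q == 0%N = false) ?mul0r ?scale0r ?addr0 //.
      by apply/negbTE; rewrite -lt0n.
    move=> tau t0; have tQ : tau ^+ Q != 0 by rewrite expf_neq0.
    rewrite -/B -/C; congr (_, _).
    rewrite -!mul_polyC polyCN polyCM; set k := ((tau ^+ Q)^-1)%:P; set X := (tau ^+ Q)%:P.
    have kX : k * X = 1 by rewrite -polyCM mulVf.
    have eX : N tau * U tau = 1 + X * D tau by rewrite eNU mul_polyC.
    have -> : k * U tau * (N tau * B + X * c%:P * C) + - k * B =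
        k * (N tau * U tau) * B + k * X * (U tau * (c%:P * C)) - k * B by ring.
    rewrite eX; have -> : k * (1 + X * D tau) * B + k * X * (U tau * (c%:P * C)) - k * B =
        k * X * (D tau * B + U tau * (c%:P * C)) by ring.
    by rewrite kX mul1r.
  exists (fun tau => a * G tau + e *: F tau), G; split=> //.
  - apply: poly_familyD; first by apply: poly_familyM => //; apply: poly_family_cst.
    by apply: poly_familyZ => //; apply: poly_fun_cst.
  - by rewrite e0.
  - by move=> tau t0; rewrite egen.
exists F, G; split=> //; [by rewrite e0 | by rewrite e0 |].
case: gen => e en0 he; exists e => // tau /he[t0 sN sU].
have tQ : tau ^+ Q != 0 by rewrite expf_neq0.
have sU' : size ((tau ^+ Q)^-1 *: U tau) = m1.+1 by rewrite size_scale ?invr_neq0.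
have steps' : euclid_steps (pre ++ s' tau).
  rewrite /euclid_steps all_cat vpre /= sU' sN vpost oppr_eq0 invr_eq0 tQ mulf_neq0 //.
  by rewrite !ltnS m10 m20.
have deg' : euclid_deg (pre ++ s' tau) = n.
  rewrite -sd es !euclid_deg_cat /= sU' sN sqm /=; clear; lia.
exists (pre ++ s' tau); split; [split=> // | exact: egen |].
  have sv0 : euclid_steps (pre ++ (q, c) :: post).
    by rewrite /euclid_steps all_cat vpre /= sq c0.
  (* The degree of the second component is unchanged if a step precedes the split quotient; if the
     first quotient is split, it becomes [x], which is at most [d]. *)
  rewrite es in sf; case: (pre) sv0 steps' sf => [|[a b] pre'] /=.
    move=> _ /andP[_ vs] _.
    have [sz _] := size_euclid (vs : euclid_steps ((N tau, tau ^+ Q * c) :: post)).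
    by move: sz => /= ->; rewrite sN /= ltnS /m2 subnK // ltnW.
  move=> /andP[_ v1] /andP[_ v2].
  have [-> _] := size_euclid v1; have [-> _] := size_euclid v2.
  by rewrite !euclid_deg_cat /= sU' sN sqm /=; clear; lia.
move=> y; rewrite /s' (euclid_nodes_refine _ (q := q) c) ?sU' ?sN ?sqm //=.
by rewrite /m2 subnK // ltnW.
Qed.

(** * Pluecker coordinates *)

(** Cauchy-Binet summed over all column sequences instead of increasing ones, as in the indexing of
    the Pluecker coordinates. *)
Lemma det_mul_minors (R : comRingType) m p (A : 'M[R]_(m, p)) (B : 'M[R]_(p, m)) :
  \det (A *m B) =
  \sum_(f : {ffun 'I_m -> 'I_p}) (\prod_i B (f i) i) * \det (colsub f A).
Proof.
rewrite -det_tr trmx_mul /determinant.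
transitivity (\sum_(sg : 'S_m) \sum_(f : {ffun 'I_m -> 'I_p})
    (-1) ^+ sg * \prod_i (B (f i) i * A (sg i) (f i))).
  apply: eq_bigr => sg _; rewrite -big_distrr /=; congr (_ * _).
  rewrite -(bigA_distr_bigA (fun i k => B k i * A (sg i) k)) /=.
  by apply: eq_bigr => i _; rewrite mxE; apply: eq_bigr => k _; rewrite !mxE.
rewrite exchange_big; apply: eq_bigr => f _ /=.
rewrite -/(determinant _) -det_tr big_distrr /=; apply: eq_bigr => sg _.
rewrite big_split /= mulrCA; congr (_ * (_ * _)).
by apply: eq_bigr => i _; rewrite !mxE.
Qed.

Section Coordinates.
Variables (K : fieldType) (v w : 'I_2 -> K).
Hypothesis det_vw : v ord0 * w ord_max - v ord_max * w ord0 = 1.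

Let e0 : 'I_2 -> K := fun i => (i == ord0)%:R.
Let e1 : 'I_2 -> K := fun i => (i == ord_max)%:R.

Let det_e : e0 ord0 * e1 ord_max - e0 ord_max * e1 ord0 = 1.
Proof. by rewrite /e0 /e1 !eqxx mulr1 mul0r subr0. Qed.

Lemma form_ofE i (x : 'rV[K]_i.+1) : form_of x = homogenize e0 e1 i (rVpoly x).
Proof.
rewrite /form_of /homogenize; apply: eq_bigr => u _.
rewrite coef_rVpoly_ord !linear_formE /e0 /e1 !eqxx /=.
by rewrite !scale1r !scale0r addr0 add0r.
Qed.

(* The passage from the monomials in [l], [l'] to the monomials in the two
   variables. *)
Definition change_basis i : 'M[K]_i.+1 :=
  lin1_mx (fun x : 'rV[K]_i.+1 => poly_rV (dehom e0 e1 (homogenize v w i (rVpoly x)))).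

Lemma change_basis_mul i (x : 'rV[K]_i.+1) :
  x *m change_basis i = poly_rV (dehom e0 e1 (homogenize v w i (rVpoly x))).
Proof.
pose F (y : 'rV[K]_i.+1) : 'rV[K]_i.+1 :=
  poly_rV (dehom e0 e1 (homogenize v w i (rVpoly y))).
have linF : linear F.
  by move=> a y z; rewrite /F !linearP rmorphD /= dehomZ linearP.
pose lF : {linear 'rV[K]_i.+1 -> 'rV[K]_i.+1} := HB.pack F (GRing.isLinear.Build K _ _ _ F linF).
exact: (mul_rV_lin1 lF x).
Qed.

Lemma form_of_change i (x : 'rV[K]_i.+1) :
  form_of (x *m change_basis i) = homogenize v w i (rVpoly x).
Proof.
have hh := homogenize_homog v w i (rVpoly x).
by rewrite form_ofE change_basis_mul (poly_rV_K (size_dehom det_e hh)) (dehomK det_e hh).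
Qed.

Lemma change_basis_free i : row_free (change_basis i).
Proof.
rewrite -kermx_eq0; apply/eqP/row_matrixP => r; rewrite row0; set x := row r _.
have xM : x *m change_basis i = 0 by rewrite -row_mul mulmx_ker row0.
have := form_of_change x; rewrite xM form_ofE !raddf0 => /esym e.
rewrite -[x]rVpolyK -(homK det_vw (size_poly _ _ : size (rVpoly x) <= i.+1)%N) e.
by rewrite !raddf0.
Qed.

Lemma change_basis_unit i : change_basis i \in unitmx.
Proof. by rewrite -row_free_unit change_basis_free. Qed.

Lemma frame_unit (I : {mpoly K[2]} -> Prop) i m (M : 'M[K]_(m, i.+1)) (G : 'M[K]_m) :
  G \in unitmx -> frame I M -> frame I (G *m M).
Proof.
move=> uG [fM hM]; split.
  by rewrite /row_free eqmxMfull ?row_full_unit.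
by move=> x; rewrite hM eqmxMfull ?row_full_unit.
Qed.

Lemma frame_change (I : {mpoly K[2]} -> Prop) i m (M M' : 'M[K]_(m, i.+1)) :
  frame I M -> frame I M' -> exists2 G : 'M[K]_m, G \in unitmx & M' = G *m M.
Proof.
move=> [fM hM] [fM' hM']; apply/eqmxMunitP/andP; split; apply/row_subP => r.
  by apply/hM/hM'; apply: row_sub.
by apply/hM'/hM; apply: row_sub.
Qed.

Variables (I : {mpoly K[2]} -> Prop) (d n : nat) (f g : {poly K}).
Hypotheses (cp : coprime_pair d n f g) (pI : presents v w I d n f g).

Lemma sylvester_frame i R : (R = (i.+1 - d) + (i.+1 - n))%N -> (i < d + n)%N ->
  frame I (sylvester d f g i R *m change_basis i).
Proof.
move=> eR idn; split.
  by rewrite /row_free mxrankMfree ?change_basis_free //; apply: (sylvester_free cp eR idn).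
move=> x; have [y ->] : exists y, x = y *m change_basis i.
  by exists (x *m invmx (change_basis i)); rewrite mulmxKV ?change_basis_unit.
rewrite form_of_change submxMfree ?change_basis_free //.
rewrite (pI (homogenize_homog v w i (rVpoly y))) homK ?size_poly //.
by rewrite -(sylvester_sub cp eR) ?size_poly // rVpolyK.
Qed.

End Coordinates.

(** * Complete intersections as Euclidean chains *)

Section ChainsOfIdeals.
Variables (K : fieldType) (v w : 'I_2 -> K).
Hypothesis det_vw : v ord0 * w ord_max - v ord_max * w ord0 = 1.
Implicit Types (I : {mpoly K[2]} -> Prop) (s : seq ({poly K} * K)).

Definition chain_presents I d n s : Prop :=
  [/\ graded_ideal I, euclid_chain d n s
    & presents v w I d n (euclid_pair s).2 (euclid_pair s).1].

Lemma ci_chain I : graded_ideal I -> complete_intersection I ->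
  exists d n s, chain_presents I d n s.
Proof.
move=> gI cI; have [d [n [f [g [cp pI]]]]] := ci_presented det_vw gI cI.
have [s [hs e]] := coprime_pair_chain cp.
by exists d, n, s; split=> // b h hh; rewrite e; apply: pI.
Qed.

Lemma chain_presents_CI_T I d n s : chain_presents I d n s ->
  CI_T (hilbT d (n - d).+1) I.
Proof.
move=> [gI hs pI]; split; first by split=> //; apply: (presented_hilbert det_vw gI hs pI).
exact: (presents_ci det_vw gI (chain_coprime_pair hs) pI).
Qed.

Lemma chain_presents_exists d n s : euclid_chain d n s ->
  exists I, chain_presents I d n s.
Proof.
move=> hs; have [I [gI pI]] := presented_exists det_vw (chain_coprime_pair hs).
by exists I.
Qed.

(** A complete intersection comes with its own generator degrees; its Hilbert function forces them
    to be [d] and [d + k - 1]. *)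
Lemma CI_T_chain I d k : (0 < d)%N -> (0 < k)%N -> CI_T (hilbT d k) I ->
  exists s, chain_presents I d (d + k.-1) s.
Proof.
move=> d0 k0 [[gI hT] cI]; have [d' [n' [s hIs]]] := ci_chain gI cI.
have [_ hs pI] := hIs; have [_ _ /andP[d'0 dn'] _] := hs.
have [|ed ek] := @hilbT_inj d k d' (n' - d').+1 d0 k0 d'0 isT.
  exact: (hilbert_function_unique (proj1 gI) hT (presented_hilbert det_vw gI hs pI)).
exists s; rewrite ed ek /=; have -> : (d' + (n' - d') = n')%N by rewrite subnKC.
by [].
Qed.

End ChainsOfIdeals.

Definition degenerate (K : fieldType) (v : 'I_2 -> K) (d n : nat)
    (I : {mpoly K[2]} -> Prop) (i : nat) : Prop :=
  exists beta, [/\ beta \is i.-homog, ~ I beta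
    & I (linear_form v ^+ (d + n - 2 - 2 * i) * beta)].

(** * Specialization, and the closed degeneracy conditions *)

Section Zariski.
Variables (K : closedFieldType) (v w : 'I_2 -> K).
Hypothesis charK0 : [pchar K] =i pred0.
Hypothesis det_vw : v ord0 * w ord_max - v ord_max * w ord0 = 1.
Variables (d n N : nat).
Hypotheses (dn : (0 < d <= n)%N) (eN : N = (d + n)%N).
Implicit Types (I : {mpoly K[2]} -> Prop).

Local Notation T := (hilbT d (n - d).+1).

Lemma sylvester_rows (i : 'I_N) : (i.+1 - T i = (i.+1 - d) + (i.+1 - n))%N.
Proof.
have [/andP[d0 dn'] iN] : (0 < d <= n)%N /\ (i < d + n)%N by rewrite -eN.
rewrite /hilbT /socle_degree.
by clear -d0 dn' iN; case: ltnP => ?; [|case: leqP => ?]; lia.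
Qed.

(** An equation of [Z], evaluated on the frames of the deformed ideals, is polynomial in the
    parameter and vanishes generically, hence also at 0. *)
Lemma closure_step (Z : ({mpoly K[2]} -> Prop) -> Prop) I s x :
  zariski_closed T N Z -> chain_presents v w I d n s ->
  x \notin euclid_nodes s -> (x <= d)%N ->
  (forall J s', chain_presents v w J d n s' ->
     (forall y, (y \in euclid_nodes s') = (y \in euclid_nodes s) || (y == x)) -> Z J) ->
  Z I.
Proof.
move=> [S [hS defZ]] hI nx xd hZ; have [gI hs pI] := hI.
apply/defZ; split; first exact: chain_presents_CI_T hI.
move=> p Sp M hM.
have [F [G [hF hG F0 G0 gen]]] := euclid_deform charK0 hs nx xd.
have iN (i : 'I_N) : (i < d + n)%N by rewrite -eN.
have cp := chain_coprime_pair hs.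
have frameI (i : 'I_N) := sylvester_frame det_vw cp pI (sylvester_rows i) (iN i).
have /fin_all_exists2[g ug eg] := fun i => frame_change (frameI i) (hM i).
(* The invertible matrices carrying the Sylvester frames of [I] to the given frames [M] are kept
   constant along the family, so that its value at 0 is exactly [M]. *)
pose Mt tau (i : 'I_N) := g i *m (sylvester d (F tau) (G tau) i (i.+1 - T i) *m
  change_basis v w i).
pose phi tau := p.@[fun u => plucker (Mt tau) (enum_val u)].
have phi0 : p.@[fun u => plucker M (enum_val u)] = phi 0.
  by apply: meval_eq => u; rewrite /plucker /Mt F0 G0 -eg.
rewrite phi0; apply: poly_fun_eq0.
  apply: poly_fun_meval => u; apply: poly_fun_det => a b.
  pose i := tag (enum_val u).
  suff : poly_fun (fun tau => \sum_c g i a c *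
      \sum_(e < i.+1) (sylvester_row d (F tau) (G tau) i c)`_e *
         change_basis v w i e (tagged (enum_val u) b)).
    apply: poly_fun_ext => tau; rewrite [RHS]mxE [RHS]mxE; apply: eq_bigr => c _.
    rewrite [X in _ = _ * X]mxE; congr (_ * _); apply: eq_bigr => e _.
    by rewrite [X in _ = X * _]mxE.
  apply: poly_fun_sum => c; apply: poly_funM; first exact: poly_fun_cst.
  apply: poly_fun_sum => e; apply: poly_funM; last exact: poly_fun_cst.
  suff : poly_family (fun tau => sylvester_row d (F tau) (G tau) i c) by apply.
  rewrite /sylvester_row; case: (c < _)%N; apply: poly_familyM => //;
    exact: poly_family_cst.
case: gen => e en0 he; exists e => // tau /he[s' [hs' es' ns']].
have [J hJ] := chain_presents_exists det_vw hs'; have [gJ _ pJ] := hJ.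
have /defZ[_ /(_ p Sp)] := hZ J s' hJ ns'; apply=> i.
have := sylvester_frame det_vw (chain_coprime_pair hs') pJ (sylvester_rows i) (iN i).
by rewrite es' /=; apply: frame_unit.
Qed.

(* The coordinates of a form of degree [b] that vanish exactly when it is
   divisible by [l ^ (b - i)]. *)
Definition divisibility_mx b R i : 'M[K]_(b.+1, R) :=
  invmx (change_basis v w b) *m \matrix_(u, r) (u == i.+1 + r :> nat)%:R.

Lemma divisibility_mxP b i (x : 'rV[K]_b.+1) R : (b = i + R)%N ->
  (x *m change_basis v w b *m divisibility_mx b R i = 0) <->
  (size (rVpoly x) <= i.+1)%N.
Proof.
move=> eb; rewrite mulmxA mulmxK ?(change_basis_unit det_vw) //.
have entry (r : 'I_R) : (x *m \matrix_(u < b.+1, r < R) (u == i.+1 + r :> nat)%:R) 0 r =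
    (rVpoly x)`_(i.+1 + r).
  have hr : (i.+1 + r < b.+1)%N by rewrite eb addSn ltnS ltn_add2l.
  rewrite mxE (bigD1 (Ordinal hr)) //= big1 ?addr0 => [|u ne].
    by rewrite mxE /= eqxx mulr1 -(coef_rVpoly_ord x (Ordinal hr)).
  rewrite mxE; case: eqP => [e|]; last by rewrite mulr0.
  by case/eqP: ne; apply: val_inj.
split=> [e|sx]; last first.
  apply/rowP => r; rewrite entry mxE nth_default //.
  by rewrite (leq_trans sx) // leq_addr.
apply/leq_sizeP => j ij; case: (ltnP j b.+1) => jb; last first.
  by rewrite nth_default // (leq_trans (size_poly _ _)).
have hr : (j - i.+1 < R)%N by clear -eb ij jb; lia.
by have := entry (Ordinal hr); rewrite /= subnKC // e mxE => <-.
Qed.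

(* By the Cauchy-Binet expansion, a linear form in the Pluecker coordinates. *)
Definition degenerate_poly (b : 'I_N) i : {mpoly K[#|plucker_index T N|]} :=
  \sum_(f : {ffun 'I_(b.+1 - T b) -> 'I_b.+1})
    (\prod_r divisibility_mx b (b.+1 - T b) i (f r) r) *:
      'X_(enum_rank (Tagged (fun i : 'I_N => {ffun 'I_(i.+1 - T i) -> 'I_i.+1}) f)).

Lemma degenerate_poly_eval (b : 'I_N) i (M : forall i : 'I_N, 'M[K]_(i.+1 - T i, i.+1)) :
  (degenerate_poly b i).@[fun u => plucker M (enum_val u)] =
  \det (M b *m divisibility_mx b (b.+1 - T b) i).
Proof.
rewrite det_mul_minors /degenerate_poly raddf_sum /=; apply: eq_bigr => f _.
by rewrite mevalZ mevalXU enum_rankK.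
Qed.

Lemma degenerate_poly_multihomogeneous b i : multihomogeneous (degenerate_poly b i).
Proof.
exists (fun c => (c == b) : nat) => m.
move=> /msupp_sum_le /flatten_mapP[f _]; rewrite ?mem_filter /= => hm c.
have := msuppZ_le hm; rewrite msuppX inE => /eqP ->.
pose u : plucker_index T N :=
  Tagged (fun i : 'I_N => {ffun 'I_(i.+1 - T i) -> 'I_i.+1}) f.
rewrite -/u.
have [ec|nc] := eqVneq c b.
  rewrite (bigD1 u) /=; last by rewrite ec.
  rewrite mnm1E eqxx big1 // => u' /andP[_ ne]; rewrite mnm1E.
  by rewrite (inj_eq enum_rank_inj) eq_sym (negPf ne).
rewrite big1 // => u' /eqP eu'; rewrite mnm1E (inj_eq enum_rank_inj).
by case: eqP => // e; case/eqP: nc; rewrite -eu' -e.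
Qed.

Local Notation degenerate := (degenerate v d n).

(** For [b = j - i] the ideal has dimension [b - i] in degree [b], as many as the conditions for
    divisibility by [l ^ (b - i)]. The determinant vanishes when some nonzero element satisfies them
    all; its quotient [beta] is not in [I] because [I] has no nonzero form of degree [i < d]. *)
Lemma degenerate_polyP I s (b : 'I_N) i : chain_presents v w I d n s ->
  (i < d)%N -> b = (d + n - 2 - i)%N :> nat ->
  vanishes_at (degenerate_poly b i) I <-> degenerate I i.
Proof.
move=> [gI hs pI] id eb; have idI := proj1 gI; have cp := chain_coprime_pair hs.
have iN (c : 'I_N) : (c < d + n)%N by rewrite -eN.
have [d0 dn'] := andP dn.
have eR : (b = i + (b.+1 - T b) :> nat)%N.
  by rewrite sylvester_rows eb; clear -id d0 dn'; lia.
have ej : (d + n - 2 - 2 * i + i = b)%N by rewrite eb; clear -id dn'; lia.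
have ib : (i <= b)%N by rewrite eR leq_addr.
have I_small (q : {poly K}) : (size q <= i.+1)%N ->
    I (homogenize v w i q) -> q = 0.
  move=> sq; rewrite (pI _ _ (homogenize_homog v w i q)) homK // => -[u [t [-> su st]]].
  have -> : u = 0 by apply/eqP; rewrite -size_poly_leq0 (leq_trans su) //; clear -id; lia.
  have -> : t = 0.
    by apply/eqP; rewrite -size_poly_leq0 (leq_trans st) //; clear -id dn'; lia.
  by rewrite !mul0r addr0.
have key (M : 'M[K]_(b.+1 - T b, b.+1)) : frame I M ->
    \det (M *m divisibility_mx b (b.+1 - T b) i) = 0 <-> degenerate I i.
  move=> [fM hM]; split=> [/eqP/det0P[x x0 ex]|[beta [hb nb Ib]]].
    pose y := x *m M *m invmx (change_basis v w b).
    have eyx : y *m change_basis v w b = x *m M.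
      by rewrite /y mulmxKV ?(change_basis_unit det_vw).
    have y0 : y != 0.
      apply: contraNneq x0 => y0; move: eyx; rewrite y0 mul0mx => /esym/eqP.
      by rewrite mulmx_free_eq0.
    have sy : (size (rVpoly y) <= i.+1)%N.
      by apply/(divisibility_mxP y eR); rewrite eyx -mulmxA ex.
    exists (homogenize v w i (rVpoly y)); split; first exact: homogenize_homog.
      move=> /(I_small _ sy) e; case/eqP: y0.
      by rewrite -[y]rVpolyK e raddf0.
    rewrite -homogenize_mulvn // ej -form_of_change // eyx; apply/hM.
    exact: submxMl.
  pose y : 'rV[K]_b.+1 := poly_rV (dehom v w beta).
  have sb := size_dehom det_vw hb.
  have sb' : (size (dehom v w beta) <= b.+1)%N by rewrite (leq_trans sb).
  have ey : form_of (y *m change_basis v w b) =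
      linear_form v ^+ (d + n - 2 - 2 * i) * beta.
    by rewrite form_of_change // poly_rV_K // -ej homogenize_mulvn // (dehomK det_vw hb).
  have /hM/submxP[x ex] : I (form_of (y *m change_basis v w b)) by rewrite ey.
  apply/eqP/det0P; exists x.
    apply/eqP => x0; apply: nb; move: ex; rewrite x0 mul0mx => /eqP.
    rewrite mulmx_free_eq0 ?change_basis_free // => /eqP y0.
    rewrite -(dehomK det_vw hb) -(poly_rV_K sb') -/y y0 !raddf0.
    exact: ideal0.
  rewrite mulmxA -ex; apply/(divisibility_mxP y eR).
  by rewrite poly_rV_K.
split=> [van|deg M hM]; last first.
  by rewrite degenerate_poly_eval; apply/(key _ (hM b)).
have hM (c : 'I_N) := sylvester_frame det_vw cp pI (sylvester_rows c) (iN c).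
by have := van _ hM; rewrite degenerate_poly_eval => /(key _ (hM b)).
Qed.

Lemma degenerate_closed (S : nat -> Prop) :
  zariski_closed T N (fun I => CI_T T I /\ forall i, S i -> (i < d)%N -> degenerate I i).
Proof.
have [d0 dn'] := andP dn.
exists (fun p => exists (b : 'I_N) i, [/\ S i, (i < d)%N, b = (d + n - 2 - i)%N :> nat
  & p = degenerate_poly b i]); split.
  by move=> p [b [i [_ _ _ ->]]]; apply: degenerate_poly_multihomogeneous.
move=> I; split=> [[hI hS]|[hI hS]]; split=> //.
  have [s hs] := CI_T_chain det_vw d0 (ltn0Sn _) hI; rewrite /= subnKC // in hs.
  by move=> p [b [i [Si id eb ->]]]; apply/(degenerate_polyP hs id eb)/hS.
have [s hs] := CI_T_chain det_vw d0 (ltn0Sn _) hI; rewrite /= subnKC // in hs.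
move=> i Si id; have hb : (d + n - 2 - i < N)%N by rewrite eN; clear -d0; lia.
by apply/(degenerate_polyP (b := Ordinal hb) hs id erefl)/hS; exists (Ordinal hb), i.
Qed.

End Zariski.

(** * Hessians *)

Section Hessian.
Variable K : fieldType.
Implicit Types (f g F G : {mpoly K[2]}).

(** A summation range independent of the support of [f] makes linearity a termwise statement. *)
Lemma diffactwE b f F : (msize f <= b)%N ->
  diffact f F = \sum_(m : 'X_{1..2 < b}) f@_m *: F^`M[m].
Proof.
move=> sf; rewrite /diffact (big_mksub 'X_{1..2 < b}) /=; first last.
- by move=> m /msize_mdeg_lt /leq_trans; apply.
- exact: msupp_uniq.
by rewrite big_rmcond //= => m /memN_msupp_eq0 ->; rewrite scale0r.
Qed.

Lemma diffact_linearl F : linear (fun f => diffact f F).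
Proof.
move=> c f g; set b := maxn (msize (c *: f + g)) (maxn (msize f) (msize g)).
rewrite !(@diffactwE b) /b ?leq_max ?leqnn ?orbT // scaler_sumr -big_split.
by apply: eq_bigr => m _; rewrite mcoeffD mcoeffZ scalerDl scalerA.
Qed.

Lemma diffact0l F : diffact 0 F = 0.
Proof. by rewrite /diffact msupp0 big_nil. Qed.

Lemma diffactZl c f F : diffact (c *: f) F = c *: diffact f F.
Proof. by have := diffact_linearl F c f 0; rewrite /= diffact0l !addr0. Qed.

Lemma diffactDl f g F : diffact (f + g) F = diffact f F + diffact g F.
Proof. by have := diffact_linearl F 1 f g; rewrite /= !scale1r. Qed.

Lemma diffact_suml (J : Type) (r : seq J) (P : pred J) (f : J -> {mpoly K[2]}) F :
  diffact (\sum_(i <- r | P i) f i) F = \sum_(i <- r | P i) diffact (f i) F.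
Proof.
exact: (big_morph (fun f => diffact f F) (fun f g => diffactDl f g F) (diffact0l F)).
Qed.

Lemma diffact_linearr f : linear (diffact f).
Proof.
move=> c F G; rewrite /diffact scaler_sumr -big_split; apply: eq_bigr => m _ /=.
by rewrite linearP /= scalerDr !scalerA mulrC.
Qed.

HB.instance Definition _ f := GRing.isLinear.Build K {mpoly K[2]} {mpoly K[2]} _
  (diffact f) (diffact_linearr f).

Lemma diffactX m F : diffact 'X_[m] F = F^`M[m].
Proof. by rewrite /diffact msuppX big_seq1 mcoeffX eqxx scale1r. Qed.

Lemma diffactM f g F : diffact (f * g) F = diffact f (diffact g F).
Proof.
rewrite [f]mpolyE mulr_suml diffact_suml diffact_suml /=.
apply: eq_bigr => m _; rewrite -scalerAl diffactZl.
rewrite diffactZl /=; congr (_ *: _).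
rewrite [g]mpolyE mulr_sumr diffact_suml diffact_suml /=.
rewrite linear_sum; apply: eq_bigr => m' _.
rewrite -scalerAr diffactZl diffactZl linearZ /=.
by rewrite -mpolyXD !diffactX addmC mderivmDm.
Qed.

Lemma mderivm_homog b m F : F \is b.-homog -> F^`M[m] \is (b - mdeg m).-homog.
Proof.
move=> /dhomogP hF; apply/dhomogP => m'; rewrite mcoeff_msupp mcoeff_mderivm => ne.
have : (m + m')%MM \in msupp F.
  by rewrite mcoeff_msupp; apply: contra ne => /eqP ->; rewrite mul0rn.
by move=> /hF e; have <- : mdeg (m + m') = b := e; rewrite mdegD addKn.
Qed.

Lemma diffact_homog i b f F : f \is i.-homog -> F \is b.-homog ->
  diffact f F \is (b - i).-homog.
Proof.
move=> /dhomogP hf hF; rewrite /diffact big_seq; apply: rpred_sum => m mf.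
by apply: rpredZ; rewrite -(hf m mf); apply: mderivm_homog.
Qed.

Lemma Ann_ideal F : is_ideal (Ann F).
Proof.
split; rewrite /Ann.
- exact: diffact0l.
- by move=> f g hf hg; rewrite diffactDl /= hf hg addr0.
- by move=> f g hg; rewrite diffactM hg linear0.
Qed.

Lemma euler b F (v : 'I_2 -> K) : F \is b.-homog ->
  (diffact (linear_form v) F).@[v] = b%:R * F.@[v].
Proof.
move=> hF; have mono m : mdeg m = b ->
    (diffact (linear_form v) 'X_[m]).@[v] = b%:R * ('X_[m]).@[v].
  move=> <-; rewrite /linear_form diffact_suml raddf_sum mdegE natr_sum mulr_suml /=.
  apply: eq_bigr => i _; rewrite diffactZl diffactX mderivmU1m mevalZ mderivX mevalZ.
  have [->|mi] := eqVneq (m i) 0%N; first by rewrite !mul0r mulr0.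
  rewrite mulrCA; congr (_ * _); rewrite -{1}(mevalXU v i) -mevalM -mpolyXD.
  rewrite addmC submK //; apply/mnm_lepP => j; rewrite mnm1E.
  by case: eqP => // <-; rewrite lt0n.
rewrite [in LHS](mpolyE F) [in RHS](mpolyE F) (linear_sum (diffact (linear_form v))) !(raddf_sum (meval v)) mulr_sumr /= big_seq [RHS]big_seq.
apply: eq_bigr => m mF; rewrite linearZ /= !mevalZ (mono _ (dhomog_mf hF mF)).
exact: mulrCA.
Qed.

(** Iterated Euler relation: it trades evaluation at the point [v] for the action of a power of
    [l]. *)
Lemma diffact_linear_form_exp b F (v : 'I_2 -> K) : F \is b.-homog ->
  (diffact (linear_form v ^+ b) F).@[v] = (b`!)%:R * F.@[v].
Proof.
elim: b F => [|b IH] F hF.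
  rewrite expr0 fact0 mul1r -[1]mpolyX0 diffactX mderivm0m //.
rewrite exprSr diffactM IH.
  by rewrite (euler _ hF) factS natrM mulrA [_%:R * _%:R]mulrC.
have := diffact_homog (linear_form_homog v) hF.
by rewrite subn1.
Qed.

Hypothesis charK0 : [pchar K] =i pred0.

Lemma natf_neq0_char0 m : (0 < m)%N -> m%:R != 0 :> K.
Proof. by move=> m0; rewrite (pcharf0P K).1 // -lt0n. Qed.

Lemma diffact_nondegenerate b G : G \is b.-homog ->
  (forall g, g \is b.-homog -> diffact g G = 0) -> G = 0.
Proof.
move=> hG h; apply/mpolyP => m; rewrite mcoeff0; apply/eqP.
have [e|ne] := eqVneq (mdeg m) b; last by rewrite (dhomog_nemf_coeff hG ne).
have hX : 'X_[m] \is [in K[2], b.-homog] by rewrite dhomogX; apply/eqP.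
have := congr1 (mcoeff 0%MM) (h _ hX); rewrite diffactX.
rewrite mcoeff_mderivm addm0 mcoeff0 -mulr_natr => /eqP; rewrite mulf_eq0 => /orP[//|].
rewrite (pcharf0P K).1 //.
move=> e0; exfalso; move: e0; apply/negP; rewrite -lt0n.
by apply: prodn_gt0 => i; rewrite ffactnn fact_gt0.
Qed.

Lemma homog0_meval F (v : 'I_2 -> K) : F \is 0.-homog -> F.@[v] = 0 -> F = 0.
Proof.
move=> hF e; apply/mpolyP => m; rewrite mcoeff0.
have [m0|ne] := eqVneq (mdeg m) 0%N; last by rewrite (dhomog_nemf_coeff hF ne).
have cF : F = (F@_0%MM)%:MP.
  apply/mpolyP => m'; rewrite mcoeffC; have [->|ne] := eqVneq m' 0%MM.
    by rewrite mulr1.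
  by rewrite mulr0 (dhomog_nemf_coeff hF) // mdeg_eq0.
by move: e; rewrite cF mevalC => ->; rewrite mcoeffC mul0r.
Qed.

Lemma hessian_eq0 (i m : nat) F (v : 'I_2 -> K) (alpha : 'I_i.+1 -> {mpoly K[2]}) :
  F \is (m + 2 * i).-homog -> basis_of_degree (Ann F) i alpha ->
  (hessian alpha F).@[v] = 0 <->
  exists beta, [/\ beta \is i.-homog, ~ Ann F beta & Ann F (linear_form v ^+ m * beta)].
Proof.
move=> hF [ha free_a span_a]; have idA := Ann_ideal F.
pose A : 'M[K]_i.+1 := \matrix_(a, b) (diffact (alpha a * alpha b) F).@[v].
have -> : (hessian alpha F).@[v] = \det A.
  rewrite /hessian -det_map_mx; congr (\det _); apply/matrixP => a b.
  by rewrite !mxE.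
have hlm : linear_form v ^+ m \is m.-homog.
  by have := dhomogMn m (linear_form_homog v); rewrite mul1n.
have hH f g : f \is i.-homog -> g \is i.-homog -> diffact (f * g) F \is m.-homog.
  move=> hf hg; have := diffact_homog (dhomogM hf hg) hF.
  by rewrite (_ : m + 2 * i - (i + i) = m)%N //; clear; lia.
(* Up to the factor [m!], the matrix [A] is the Gram matrix of the pairing of [f] and [g] through
   [l ^ m * f * g] acting on [F]. *)
have pairE f g : f \is i.-homog -> g \is i.-homog ->
    (diffact (f * g) F).@[v] = 0 <-> diffact g (diffact (linear_form v ^+ m * f) F) = 0.
  move=> hf hg; have := diffact_linear_form_exp v (hH f g hf hg).
  have -> : diffact (linear_form v ^+ m) (diffact (f * g) F) =
      diffact g (diffact (linear_form v ^+ m * f) F).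
    by rewrite -!diffactM; congr diffact; ring.
  move=> e; split=> e0; last first.
    move: e; rewrite e0 meval0 => /esym/eqP; rewrite mulf_eq0.
    by rewrite (negPf (natf_neq0_char0 (fact_gt0 m))) => /eqP.
  apply: (@homog0_meval _ v); last by rewrite e e0 mulr0.
  have := diffact_homog hg (diffact_homog (dhomogM hlm hf) hF).
  by rewrite (_ : m + 2 * i - (m + i) - i = 0)%N //; clear; lia.
pose comb (x : 'rV[K]_i.+1) := \sum_a x 0 a *: alpha a.
have hcomb x : comb x \is i.-homog.
  by apply: rpred_sum => a _; apply/rpredZ/ha.
have mulA x b : (x *m A) 0 b = (diffact (comb x * alpha b) F).@[v].
  rewrite mxE mulr_suml diffact_suml raddf_sum /=.
  apply: eq_bigr => a _; rewrite mxE -scalerAl diffactZl /=.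
  by rewrite mevalZ.
have key x : x *m A = 0 <-> Ann F (linear_form v ^+ m * comb x).
  split=> [e|e]; last first.
    apply/rowP => b; rewrite mulA mxE; apply/(pairE _ _ (hcomb x) (ha b)).
    by rewrite [diffact (_ * comb x) F]e linear0.
  rewrite /Ann; apply: (@diffact_nondegenerate i).
    have := diffact_homog (dhomogM hlm (hcomb x)) hF.
    by rewrite (_ : m + 2 * i - (m + i) = i)%N //; clear; lia.
  (* Modulo [Ann F] every form of degree [i] is a combination of the [alpha], and by commutativity
     [Ann F] also kills what [l ^ m * comb x] makes of [F]. *)
  move=> g hg; have [c Ic] := span_a g hg.
  rewrite -[g](subrK (\sum_u c u *: alpha u)) diffactDl /=.
  have -> : diffact (g - \sum_u c u *: alpha u)
      (diffact (linear_form v ^+ m * comb x) F) = 0.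
    by rewrite -diffactM [(g - _) * _]mulrC diffactM (Ic : diffact _ F = 0) linear0.
  rewrite add0r.
  rewrite diffact_suml big1 //= => b _.
  rewrite diffactZl /=.
  have := mulA x b; rewrite e mxE => /esym/(pairE _ _ (hcomb x) (ha b)) ->.
  by rewrite scaler0.
split=> [/eqP/det0P[x x0 e]|[beta [hb nb Ib]]].
  exists (comb x); split; [exact: hcomb | | exact/key].
  move=> /free_a x0'; case/eqP: x0; apply/rowP => a; rewrite mxE; exact: x0'.
have [c Ic] := span_a beta hb; pose x : 'rV[K]_i.+1 := \row_a c a.
have ex : comb x = \sum_u c u *: alpha u.
  by apply: eq_bigr => a _; rewrite mxE.
apply/eqP/det0P; exists x.
  apply/eqP => x0; apply: nb; move: Ic; rewrite -ex x0 /comb big1 ?subr0 // => a _.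
  by rewrite mxE scale0r.
apply/key; rewrite ex -[\sum_u _](subKr beta) mulrBr; apply: idealB => //.
exact: idealM.
Qed.

End Hessian.

(** * Classification and closures *)

(** Agreement at [d] forces equal tops: when [d < n], the top is [d] exactly if [d] is a node. With
    top [n], nothing but [n] is left between [d] and [n]. *)
Lemma eq_node_partition d n (node node' : pred nat) t t' :
  node_set d n node t -> node_set d n node' t' ->
  (forall x, (x <= d)%N -> node x = node' x) ->
  node_partition d n node t = node_partition d n node' t'.
Proof.
move=> hN hN' e; have [/andP[d0 dn] n0 nt ht] := hN; have [_ n0' nt' ht'] := hN'.
have ett : t = t'.
  case: ht ht' => [td|[tn gap]] [td'|[tn' gap']].
  - by rewrite td.
  - apply/eqP; rewrite td tn' eqn_leq dn /= leqNgt; apply/negP => lt_dn.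
    by have := gap' d; rewrite leqnn lt_dn -e // -td nt => /(_ isT).
  - apply/eqP; rewrite tn td' eqn_leq dn andbT leqNgt; apply/negP => lt_dn.
    by have := gap d; rewrite leqnn lt_dn e // -td' nt' => /(_ isT).
  - by rewrite tn.
subst t'; have e' x : (x <= t)%N -> node x = node' x.
  move=> xt; have [/e //|dx] := leqP x d.
  case: ht => [td|[tn gap]]; first by move: dx; rewrite -td ltnNge xt.
  case: ht' => [td|[_ gap']]; first by move: dx; rewrite -td ltnNge xt.
  have [->|ne] := eqVneq x n; first by rewrite -tn nt nt'.
  have xn : (x < n)%N by rewrite ltn_neqAle ne -tn.
  by rewrite (negPf (gap x _)) ?(negPf (gap' x _)) ?xn ?(ltnW dx).
apply/eq_in_map => a; rewrite mem_iota /= add0n => at_; rewrite /part.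
have -> : lo_node node a = lo_node node' a.
  elim: a at_ => //= a IH at_; rewrite e'; last exact: ltnW.
  by case: ifP => // _; apply/IH/ltnW.
congr (_ - _)%N; rewrite /hi_node; congr (_ + _)%N.
by apply: eq_in_find => x; rewrite mem_iota => /andP[_ xt]; apply: e'; lia.
Qed.

Section Classification.
Variables (d n : nat).
Hypothesis dn : (0 < d <= n)%N.

Local Notation active := 'I_(num_active d (n - d).+1).
Implicit Types (S : {set active}).

(** The active [h^i] match the possible nodes [i + 1] up to [d], except that [d = n] is a forced
    node. *)
Lemma num_activeE : num_active d (n - d).+1 = if d == n then d.-1 else d.
Proof.
by case/andP: dn => d0 dn'; rewrite /num_active; case: eqP => [<-|ne]; lia.
Qed.

Lemma active_lt (i : active) : (i < d)%N.
Proof.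
by apply: leq_trans (ltn_ord i) _; rewrite num_activeE; case: ifP => // _; apply: leq_pred.
Qed.

Definition vanishing_at S (i : nat) : bool := [exists j : active, (j == i :> nat) && (j \in S)].

Definition vanishing_top S : nat := if vanishing_at S d.-1 then n else d.

(** A nonvanishing [h^i] contributes the node [i + 1], while 0 and the top are forced; the vanishing
    of [h^(d-1)] moves the top from [d] to [n]. *)
Definition vanishing_node S : pred nat := fun x =>
  [|| x == 0%N, (x <= d)%N && ~~ vanishing_at S x.-1 | x == vanishing_top S].

Definition vanishing_partition S : seq nat :=
  node_partition d n (vanishing_node S) (vanishing_top S).

Lemma vanishing_at_active S (i : active) : vanishing_at S i = (i \in S).
Proof.
apply/existsP/idP => [[j /andP[/eqP e jS]]|iS]; last by exists i; rewrite eqxx.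
by have <- : j = i by apply: val_inj.
Qed.

Lemma vanishing_at_ge S i : (num_active d (n - d).+1 <= i)%N -> vanishing_at S i = false.
Proof.
move=> hi; apply/existsP => -[j /andP[/eqP e _]].
by have := ltn_ord j; rewrite e ltnNge hi.
Qed.

Lemma vanishing_node_set S : node_set d n (vanishing_node S) (vanishing_top S).
Proof.
split; rewrite // /vanishing_node ?eqxx ?orbT //.
rewrite /vanishing_top; case: ifP => z; [right; split=> // x | by left].
case/andP: dn => d0 _ /andP[dx xn]; rewrite !negb_or negb_and -lt0n (leq_trans d0 dx) /=.
rewrite neq_ltn xn andbT negbK -ltnNge; case: ltngtP dx => // <- _.
by rewrite z orbT.
Qed.

Lemma vanishing_nodeE S x : (x <= d)%N ->
  vanishing_node S x = (x == 0%N) || ~~ vanishing_at S x.-1.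
Proof.
move=> xd; rewrite /vanishing_node xd /=; case: eqP => //= x0.
case z: (vanishing_at S x.-1) => //=; apply/eqP; rewrite /vanishing_top.
case: ifP => z' e; last by rewrite -e z in z'.
have edn : d = n by case/andP: dn; lia.
move: z'; rewrite vanishing_at_ge // num_activeE edn eqxx.
exact: leqnn.
Qed.

Lemma vanishing_node_active S (i : active) : vanishing_node S i.+1 = (i \notin S).
Proof. by rewrite vanishing_nodeE ?active_lt //= vanishing_at_active. Qed.

Lemma active_cases x : (x <= d)%N -> x = 0%N \/ x = d /\ d = n \/ exists i : active, x = i.+1.
Proof.
case: x => [|x] xd; first by left.
case: (ltnP x (num_active d (n - d).+1)) => h; first by right; right; exists (Ordinal h).
right; left; move: h; rewrite num_activeE; case: eqP => [e|_]; lia.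
Qed.

Lemma vanishing_at_top S : d = n -> vanishing_at S d.-1 = false.
Proof. by move=> e; rewrite vanishing_at_ge // num_activeE e eqxx. Qed.

Lemma vanishing_partition_dominated S S' :
  dominated (vanishing_partition S') (vanishing_partition S) <-> S \subset S'.
Proof.
rewrite (node_partition_dominated (vanishing_node_set S) (vanishing_node_set S')).
split=> [h|/subsetP h x xd].
  apply/subsetP => i; apply: contraLR; rewrite -!vanishing_node_active.
  exact/h/active_lt.
have [->|[[-> e]|[i ->]]] := active_cases xd; first by rewrite vanishing_nodeE.
  by rewrite !vanishing_nodeE // !vanishing_at_top.
by rewrite !vanishing_node_active; apply: contra; apply: h.
Qed.

Lemma vanishing_partition_inj : injective vanishing_partition.
Proof.
move=> S S' e; apply/eqP; rewrite eqEsubset; apply/andP; split;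
  by apply/vanishing_partition_dominated; rewrite e.
Qed.

Section Field.
Variable K : fieldType.
Implicit Types (s : seq ({poly K} * K)) (I : {mpoly K[2]} -> Prop) (v w : 'I_2 -> K).

Definition chain_vanishing s : {set active} := [set i : active | i.+1 \notin euclid_nodes s].

Lemma chain_partition s : euclid_chain d n s ->
  node_partition d n (chain_node s) (chain_top d n s) =
  vanishing_partition (chain_vanishing s).
Proof.
move=> hs; apply: eq_node_partition => [||x xd]; first exact: chain_node_set.
  exact: vanishing_node_set.
have [->|[[-> e]|[i ->]]] := active_cases xd.
- by rewrite vanishing_nodeE // /chain_node euclid_nodes0.
- rewrite vanishing_nodeE // vanishing_at_top // orbT /chain_node.
  by have [_ sd _ _] := hs; rewrite e -sd euclid_nodes_deg.
- by rewrite vanishing_node_active inE negbK.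
Qed.

Lemma vanishing_chain_exists S : exists s, euclid_chain d n s /\ chain_vanishing s = S.
Proof.
have hN := vanishing_node_set S; have [_ n0 nt ht] := hN.
have [s [sv sd sn]] := @euclid_steps_exists K _ _ n0 nt.
have [d0 dn'] := andP dn.
have same s' : (forall x, (x <= d)%N -> (x \in euclid_nodes s') = vanishing_node S x) ->
    chain_vanishing s' = S.
  move=> e; apply/setP => i; rewrite inE e ?active_lt // vanishing_node_active.
  exact: negbK.
have ns x : (x <= d)%N -> (x \in euclid_nodes s) = vanishing_node S x.
  move=> xd; rewrite sn; have /andP[dt _] := node_set_top_ge hN.
  by rewrite (leq_trans xd dt) andbT.
have [tn|tn] := eqVneq (vanishing_top S) n.
  exists s; split; last exact: same.
  split=> //; first by rewrite sd.
  (* The second component has the next node below [n] as degree; none lies between [d] and [n], so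
     it is at most [d]. *)
  case: (s) sv sd sn => [|y s'] /=; first by rewrite tn => _ e; move: d0 dn'; rewrite -e; lia.
  move=> /andP[/andP[sy _] sv'] sd' sn'; have [-> _] := size_euclid sv'.
  have nd : vanishing_node S (euclid_deg s').
    have := sn' (euclid_deg s'); rewrite inE euclid_nodes_deg orbT => /esym.
    by case/andP.
  rewrite ltnS leqNgt; apply/negP => dlt.
  have lt_n : (euclid_deg s' < n)%N by rewrite -tn -sd'; clear -sy; size_lia.
  case: ht => [td|[_ gap]]; first by move: lt_n dlt; rewrite -tn td; lia.
  by have := gap (euclid_deg s'); rewrite lt_n (ltnW dlt) nd => /(_ isT).
have td : vanishing_top S = d by case: ht tn => [//|[-> _]]; rewrite eqxx.
have lt_dn : (d < n)%N by rewrite ltn_neqAle dn' andbT -td.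
(* With top [d < n] the chain only reaches degree [d]; one more quotient of degree [n - d] adds the
   node [n], beyond the range compared. *)
exists (('X^(n - d), 1) :: s); split.
  split=> //=.
  - by rewrite sv oner_neq0 size_polyXn !andbT ltnS subn_gt0.
  - by rewrite size_polyXn sd td /= subnK.
  - by have [-> _] := size_euclid sv; rewrite sd td.
apply: same => x xd; rewrite -ns //= inE size_polyXn sd td /= subnK //.
by case: eqP => // e; move: xd; rewrite e leqNgt lt_dn.
Qed.

Local Notation T := (hilbT d (n - d).+1).

Lemma chain_jordan v w I s : v ord0 * w ord_max - v ord_max * w ord0 = 1 ->
  chain_presents v w I d n s ->
  jordan_type I (linear_form v) (vanishing_partition (chain_vanishing s)).
Proof.
move=> det_vw [gI hs pI]; rewrite -chain_partition //.
exact: (presented_jordan det_vw gI hs pI).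
Qed.

Lemma chain_jordan_unique v w I s S : v ord0 * w ord_max - v ord_max * w ord0 = 1 ->
  chain_presents v w I d n s ->
  jordan_type I (linear_form v) (vanishing_partition S) -> chain_vanishing s = S.
Proof.
move=> det_vw hI hJ; apply: vanishing_partition_inj.
have [[idI _] _ _] := hI.
exact: (jordan_type_unique idI (chain_jordan det_vw hI) hJ).
Qed.

Lemma CIJT_vanishing P : CIJT K T P <-> exists S, P = vanishing_partition S.
Proof.
have [d0 dn'] := andP dn; split=> [[pP dP [I [v [[gI _ cI] v0 hJ]]]]|[S ->]].
  have [w det_vw] := complement_exists v0.
  have [d' [n' [s [_ hs pI]]]] := ci_chain det_vw gI cI.
  have eP := jordan_type_unique (proj1 gI) hJ (presented_jordan det_vw gI hs pI).
  have [_ _ /andP[d'0 dn''] _] := hs.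
  (* [CIJT] does not prescribe the Hilbert function of the ideal; the diagonal lengths of [P]
     determine it and thereby the generator degrees. *)
  have [|ed ek] := @hilbT_inj d (n - d).+1 d' (n' - d').+1 d0 isT d'0 isT.
    by move=> i; rewrite -dP eP node_partition_diagonal //; apply: chain_node_set.
  have en : n' = n by move: ek; rewrite ed; lia.
  rewrite -ed en in hs eP.
  by exists (chain_vanishing s); rewrite eP chain_partition.
pose v : 'I_2 -> K := fun i => (i == ord0)%:R.
have v0 : linear_form v != 0.
  rewrite linear_formE /v eqxx /= scale1r scale0r addr0.
  apply/eqP => e; have := congr1 (mcoeff U_(ord0)%MM) e.
  by rewrite mcoeffXU eqxx mcoeff0 => /eqP; rewrite oner_eq0.
have [w det_vw] := complement_exists v0.
have [s [hs <-]] := vanishing_chain_exists S.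
have [I hI] := chain_presents_exists det_vw hs.
have hJ := chain_jordan det_vw hI; have [[gI hT] cI] := chain_presents_CI_T det_vw hI.
split.
- by have [] := hJ.
- by move=> i; apply: node_partition_diagonal; apply: vanishing_node_set.
- by exists I, v; split=> //; split=> //; apply: jordan_type_artinian hJ.
Qed.

Lemma CI_T_vanishing_chain v w I : v ord0 * w ord_max - v ord_max * w ord0 = 1 ->
  CI_T T I -> exists s, chain_presents v w I d n s.
Proof.
have [d0 dn'] := andP dn; move=> det_vw /(CI_T_chain det_vw d0 (ltn0Sn _)) [s hs].
by exists s; rewrite /= subnKC in hs.
Qed.

Lemma chain_degenerate v w I s (i : active) :
  v ord0 * w ord_max - v ord_max * w ord0 = 1 -> chain_presents v w I d n s ->
  degenerate v d n I i <-> i \in chain_vanishing s.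
Proof.
move=> det_vw [gI hs pI]; rewrite inE.
exact: (presented_degenerate det_vw gI hs pI (active_lt i)).
Qed.

End Field.

Lemma closure_vanishing (K : closedFieldType) (charK0 : [pchar K] =i pred0)
    (v w : 'I_2 -> K) (N : nat) S I :
  v ord0 * w ord_max - v ord_max * w ord0 = 1 -> N = (d + n)%N ->
  zariski_closure (hilbT d (n - d).+1) N
    (V_E (hilbT d (n - d).+1) (linear_form v) (vanishing_partition S)) I <->
  exists s, chain_presents v w I d n s /\ S \subset chain_vanishing s.
Proof.
move=> det_vw eN; split=> [[hI clos]|[s [hs]]].
  have [s hs] := CI_T_vanishing_chain det_vw hI; exists s; split=> //.
  have := clos _ (degenerate_closed det_vw dn eN (fun i => vanishing_at S i)).
  case=> [J [hJ jJ]|_ deg].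
    split=> // i iS _; have /existsP[j /andP[/eqP <- jS]] := iS.
    have [s' hs'] := CI_T_vanishing_chain det_vw hJ.
    by apply/(chain_degenerate j det_vw hs'); rewrite (chain_jordan_unique det_vw hs' jJ).
  apply/subsetP => i iS; apply/(chain_degenerate i det_vw hs)/deg; last exact: active_lt.
  by rewrite vanishing_at_active.
move=> sub; split; first exact: chain_presents_CI_T hs.
(* Induction on the number of Hessians vanishing for the algebra but not in [S]: each deformation
   inserts one node and so removes one of them, and specialization carries membership in [Z]
   back. *)
move=> Z clZ hZ; move: {2}#|_| (leqnn #|chain_vanishing s :\: S|) => m.
elim: m I s hs sub => [|m IH] I s hs sub.
  rewrite leqn0 cards_eq0 setD_eq0 => sub'; apply: hZ; split.
    exact: chain_presents_CI_T hs.
  have <- : chain_vanishing s = S by apply/eqP; rewrite eqEsubset sub'.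
  exact: chain_jordan det_vw hs.
have [e _|[i]] := set_0Vmem (chain_vanishing s :\: S).
  by apply: (IH I s) => //; rewrite e cards0.
move=> iD card_le; have /setDP[is_ iS] := iD; rewrite inE in is_.
apply: (closure_step charK0 det_vw dn eN clZ hs is_ (active_lt i)) => J s' hs' ns'.
have es' : chain_vanishing s' = chain_vanishing s :\ i.
  apply/setP => j; rewrite !inE ns' negb_or andbC; congr (_ && _).
apply: (IH J s' hs'); rewrite es'.
  by rewrite subsetD1 sub.
rewrite -ltnS (leq_trans _ card_le) // proper_card // properEneq.
have sub' : chain_vanishing s :\ i :\: S \subset chain_vanishing s :\: S.
  by rewrite setSD // subD1set.
rewrite sub' andbT; apply: contraTneq iD => <-; rewrite !inE eqxx.
by rewrite !andbF.
Qed.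

End Classification.

Theorem theorem3p19 (K : closedFieldType) (charK0 : [pchar K] =i pred0)
    (d k : nat) (hd : (2 <= d)%N) (hk : (1 <= k)%N) :
  (exists phi : seq nat -> {set 'I_(num_active d k)},
     [/\ forall P P', CIJT K (hilbT d k) P -> CIJT K (hilbT d k) P' ->
           phi P = phi P' -> P = P',
         forall S, exists P, CIJT K (hilbT d k) P /\ phi P = S
       & forall (F : {mpoly K[2]}) (v : 'I_2 -> K) (P : seq nat),
           F \is (socle_degree d k).-homog ->
           CI_T (hilbT d k) (Ann F) ->
           linear_form v != 0 ->
           jordan_type (Ann F) (linear_form v) P ->
           CIJT K (hilbT d k) P /\
           forall (i : 'I_(num_active d k)) (alpha : 'I_i.+1 -> {mpoly K[2]}),
             basis_of_degree (Ann F) i alpha ->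
             i \in phi P <-> (hessian alpha F).@[v] = 0])
  /\
  (forall (v : 'I_2 -> K) (P : seq nat),
     linear_form v != 0 ->
     CIJT K (hilbT d k) P ->
     forall I : {mpoly K[2]} -> Prop,
       zariski_closure (hilbT d k) (socle_degree d k).+2
         (V_E (hilbT d k) (linear_form v) P) I
       <-> exists P', [/\ CIJT K (hilbT d k) P', dominated P' P
                        & V_E (hilbT d k) (linear_form v) P' I]).
Proof.
have [n [dn ->]] : exists n, (0 < d <= n)%N /\ k = (n - d).+1.
  by exists (d + k.-1)%N; lia.
have [d0 dn'] := andP dn.
(* The factors are the degrees up to [j + 1 = d + n - 1], all below the first syzygy, so the
   Sylvester rows are independent in each of them. *)
have eN : (socle_degree d (n - d).+1).+2 = (d + n)%N by rewrite /socle_degree; lia.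
(* The inverse of [vanishing_partition]; the default [set0] is never reached on a CIJT partition. *)
pose phi P : {set 'I_(num_active d (n - d).+1)} :=
  odflt set0 [pick S | vanishing_partition S == P].
have phiK S : phi (vanishing_partition S) = S.
  rewrite /phi; case: pickP => [S' /eqP|/(_ S)]; last by rewrite eqxx.
  exact: (vanishing_partition_inj dn).
have CIJTE P := CIJT_vanishing dn K P.
split.
  exists phi; split=> [P P' /CIJTE[S ->] /CIJTE[S' ->]|S|F v P hF hI v0 hJ].
  - by rewrite !phiK => ->.
  - by exists (vanishing_partition S); split; [apply/CIJTE; exists S | apply: phiK].
  have [w det_vw] := complement_exists v0.
  have [s hs] := CI_T_vanishing_chain dn det_vw hI.
  have -> : P = vanishing_partition (chain_vanishing d n s).
    exact: (jordan_type_unique (Ann_ideal F) hJ (chain_jordan dn det_vw hs)).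
  split=> [|i alpha ha]; first by apply/CIJTE; exists (chain_vanishing d n s).
  rewrite phiK -(chain_degenerate dn i det_vw hs) /degenerate.
  rewrite (hessian_eq0 charK0 (m := (d + n - 2 - 2 * i)%N) v _ ha) //.
  have id := active_lt dn i.
  by rewrite subnK; [move: hF; rewrite (_ : socle_degree _ _ = d + n - 2)%N //; lia | lia].
move=> v P v0 /CIJTE[S ->] I; have [w det_vw] := complement_exists v0.
rewrite (closure_vanishing dn charK0 S I det_vw eN).
split=> [[s [hs sub]]|[P' [/CIJTE[S' ->] dom [hI hJ]]]].
  exists (vanishing_partition (chain_vanishing d n s)); split.
  - by apply/CIJTE; exists (chain_vanishing d n s).
  - exact/vanishing_partition_dominated.
  - by split; [apply: chain_presents_CI_T hs | apply: chain_jordan det_vw hs].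
have [s hs] := CI_T_vanishing_chain dn det_vw hI; exists s; split=> //.
rewrite (chain_jordan_unique dn det_vw hs hJ).
by apply/vanishing_partition_dominated.
Qed.
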